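(* Fix $\alpha\in(\frac12,1)$ and let $\mu>0$. For each of the Whitham equation $$-\mu\varphi+\varphi^2+K*\varphi=0$$ and the KdV equation $$(1-\mu)\varphi+\varphi^2+\tfrac16\varphi''=0,$$ the solutions in $C^\alpha_{\mathrm{even}}(\mathbb{S})$ coincide with the kernel (zero set) of an analytic operator $F\colon C^\alpha_{\mathrm{even}}(\mathbb{S})\times\mathbb{R}_{>0}\to C^\alpha_{\mathrm{even}}(\mathbb{S})$ given by $$F(\varphi,\mu):=\mu\varphi-L(\mu)\varphi+N(\varphi,\mu),$$ where $L(\mu)$ is bounded, linear and compact on $C^\alpha_{\mathrm{even}}(\mathbb{S})$, and $N$, which is given by $$N_{W}(\varphi,\mu)=-\varphi^2\ \text{ (Whitham)},\qquad N_{KdV}(\varphi,\mu)=-L(\mu)\varphi^2\ \text{ (KdV)},$$ fulfills $D_\varphi N[0,\mu]=0$. Thus $D_\varphi F[0,\mu]$ is Fredholm of index $0$. In the case of the Whitham equation the operators $L$ and $N$ are independent of $\mu$.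
   Context: $\mathbb{S}$ is the unit circle; functions on $\mathbb{S}$ are identified with $2\pi$-periodic functions on $\mathbb{R}$. $C^\alpha_{\mathrm{even}}(\mathbb{S})$ is the Banach space of real-valued, even, $\alpha$-Hölder continuous functions on $\mathbb{S}$. The Whitham kernel $K\in L^1(\mathbb{R})$ is the inverse Fourier transform of $\xi\mapsto(\tanh(\xi)/\xi)^{1/2}$ (value $1$ at $\xi=0$), where the Fourier transform is $\int f(x)e^{-ix\xi}\,dx$. Derivatives in the KdV equation are understood in the sense of distributions. $D_\varphi$ denotes the Fréchet derivative with respect to $\varphi$. *)

(* Defs.v *)
From HB Require Import structures.
From mathcomp Require Import all_boot all_order all_algebra perm.
From mathcomp Require Import complex.
From mathcomp Require Import all_classical all_reals all_analysis.
From mathcomp Require Import ring lra.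

Set Implicit Arguments.
Unset Strict Implicit.
Unset Printing Implicit Defensive.

Import Order.TTheory GRing.Theory Num.Theory.
Import numFieldNormedType.Exports.

Local Open Scope classical_set_scope.
Local Open Scope ring_scope.

Section HolderEvenPredicate.
Context {R : realType}.
Variable alpha : R.

(* The bound on `|f x| follows from the other clauses when 0 < alpha; stating
   it makes the norm below meaningful for every alpha. *)
Definition is_holder_even (f : R -> R) :=
  [/\ forall x, f (x + 2 * pi) = f x,
      forall x, f (- x) = f x
    & exists C, forall x y,
        `|f x| <= C /\ `|f x - f y| <= C * `|x - y| `^ alpha].

Definition holder_even_pred : {pred R -> R} := mem [set f | is_holder_even f].

Lemma holder_even_predP f : reflect (is_holder_even f) (f \in holder_even_pred).
Proof. by apply: (iffP idP) => [/set_mem|?]; [|exact/mem_set]. Qed.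

Lemma holder_even_submod_closed : submod_closed holder_even_pred.
Proof.
split.
  apply/holder_even_predP; split=> //; exists 0 => x y.
  by rewrite /= subr0 normr0 mul0r.
move=> a f g /holder_even_predP [fp fe [C fC]] /holder_even_predP [gp ge [D gD]].
apply/holder_even_predP; split=> [x|x|].
- by rewrite !fctE fp gp.
- by rewrite !fctE fe ge.
exists (`|a| * C + D) => x y; have [f1 f2] := fC x y; have [g1 g2] := gD x y.
rewrite !fctE; split.
  rewrite (le_trans (ler_normD _ _))// lerD// normrZ ler_wpM2l//.
have -> : a *: f x + g x - (a *: f y + g y) = a *: (f x - f y) + (g x - g y).
  by rewrite scalerBr opprD addrACA.
rewrite (le_trans (ler_normD _ _))// mulrDl lerD// normrZ -mulrA ler_wpM2l//.
Qed.

End HolderEvenPredicate.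

HB.instance Definition _ (R : realType) (alpha : R) :=
  GRing.isSubmodClosed.Build R (R -> R) (holder_even_pred alpha)
    (holder_even_submod_closed alpha).

Record holder_even (R : realType) (alpha : R) := HolderEven {
  holder_fun :> R -> R ;
  holder_funP : holder_fun \in holder_even_pred alpha }.

HB.instance Definition _ (R : realType) (alpha : R) :=
  [isSub for @holder_fun R alpha].
HB.instance Definition _ (R : realType) (alpha : R) :=
  [Choice of holder_even alpha by <:].
HB.instance Definition _ (R : realType) (alpha : R) :=
  [SubChoice_isSubLmodule of holder_even alpha by <:].

Definition sup_norm (R : realType) (f : R -> R) : R := sup [set `|f x| | x in [set: R]].

Definition holder_seminorm (R : realType) (alpha : R) (f : R -> R) : R :=
  sup [set `|f p.1 - f p.2| / `|p.1 - p.2| `^ alpha |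
         p in [set p : R * R | p.1 != p.2]].

Section HolderNorm.
Context {R : realType} {alpha : R}.
Local Notation X := (holder_even alpha).
Implicit Types f g : X.

Definition holder_norm (f : X) : R := sup_norm f + holder_seminorm alpha f.

Lemma holder_evenP f : is_holder_even alpha f.
Proof. exact/holder_even_predP/holder_funP. Qed.

Lemma holder_eqP f g : f =1 g -> f = g.
Proof. by move=> fg; apply/val_inj/funext. Qed.

Lemma le_sup_norm f x : `|f x| <= sup_norm f.
Proof.
apply: ub_le_sup; last by exists x.
have [_ _ [C fC]] := holder_evenP f.
by exists C => _ [z _ <-]; have [] := fC z z.
Qed.

Lemma ge_sup_norm f C : (forall x, `|f x| <= C) -> sup_norm f <= C.
Proof.
move=> fC; apply: ge_sup; first by exists `|f 0|; exists 0.
by move=> _ [z _ <-].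
Qed.

Lemma holder_dist_gt0 (x y : R) : x != y -> 0 < `|x - y| `^ alpha.
Proof. by move=> xy; rewrite powR_gt0// normr_gt0 subr_eq0. Qed.

Lemma le_holder_seminorm f x y : x != y ->
  `|f x - f y| <= holder_seminorm alpha f * `|x - y| `^ alpha.
Proof.
move=> xy; rewrite -ler_pdivrMr ?holder_dist_gt0//.
apply: ub_le_sup; last by exists (x, y).
have [_ _ [C fC]] := holder_evenP f.
exists C => _ [[z t] /= zt <-]; rewrite ler_pdivrMr ?holder_dist_gt0//.
by have [] := fC z t.
Qed.

Lemma ge_holder_seminorm f C :
  (forall x y, x != y -> `|f x - f y| <= C * `|x - y| `^ alpha) ->
  holder_seminorm alpha f <= C.
Proof.
move=> fC; apply: ge_sup.
  by exists (`|f 1 - f 0| / `|1 - 0| `^ alpha); exists (1, 0) => //=; rewrite oner_neq0.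
by move=> _ [[z t] /= zt <-]; rewrite ler_pdivrMr ?holder_dist_gt0// fC.
Qed.

Lemma holder_norm_le f C D : (forall x, `|f x| <= C) ->
  (forall x y, x != y -> `|f x - f y| <= D * `|x - y| `^ alpha) ->
  holder_norm f <= C + D.
Proof. by move=> ? ?; rewrite lerD ?ge_sup_norm ?ge_holder_seminorm. Qed.

Lemma sup_norm_ge0 f : 0 <= sup_norm f.
Proof. exact: le_trans (normr_ge0 (f 0)) (le_sup_norm _ _). Qed.

Lemma holder_seminorm_ge0 f : 0 <= holder_seminorm alpha f.
Proof.
have /(le_holder_seminorm f) : (1 : R) != 0 by rewrite oner_neq0.
move=> /(le_trans (normr_ge0 _)).
by rewrite pmulr_lge0// holder_dist_gt0.
Qed.

Lemma holder_normD f g : holder_norm (f + g) <= holder_norm f + holder_norm g.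
Proof.
have -> : holder_norm f + holder_norm g =
    (sup_norm f + sup_norm g) + (holder_seminorm alpha f + holder_seminorm alpha g).
  by rewrite addrACA.
apply: holder_norm_le => [x|x y xy] /=.
  by rewrite (le_trans (ler_normD _ _))// lerD// le_sup_norm.
have -> : (f + g) x - (f + g) y = (f x - f y) + (g x - g y).
  by rewrite /= opprD addrACA.
by rewrite (le_trans (ler_normD _ _))// mulrDl lerD// le_holder_seminorm.
Qed.

Lemma holder_normZ_le a f : holder_norm (a *: f) <= `|a| * holder_norm f.
Proof.
rewrite /holder_norm mulrDr; apply: holder_norm_le => [x|x y xy] /=.
  by rewrite normrM ler_wpM2l// le_sup_norm.
have -> : (a *: f) x - (a *: f) y = a * (f x - f y) by rewrite mulrBr.
by rewrite normrM -mulrA ler_wpM2l// le_holder_seminorm.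
Qed.

Lemma holder_norm_eq0 f : holder_norm f = 0 -> f = 0.
Proof.
move=> f0; apply: holder_eqP => x /=; apply/eqP; rewrite -normr_le0.
rewrite (le_trans (le_sup_norm f x))// -f0 lerDl holder_seminorm_ge0//.
Qed.

Lemma holder_normZ a f : holder_norm (a *: f) = `|a| * holder_norm f.
Proof.
apply/eqP; rewrite eq_le holder_normZ_le /=.
have [->|a0] := eqVneq a 0.
  by rewrite normr0 mul0r addr_ge0// ?sup_norm_ge0 ?holder_seminorm_ge0.
rewrite -ler_pdivlMl ?normr_gt0//.
rewrite -[in leLHS](scalerK a0 f) -normfV.
exact: holder_normZ_le.
Qed.

End HolderNorm.

HB.instance Definition _ (R : realType) (alpha : R) :=
  Lmodule_isNormed.Build R (holder_even alpha)
    (@holder_normD R alpha) (@holder_normZ R alpha) (@holder_norm_eq0 R alpha).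


Section HolderComplete.
Context {R : realType} {alpha : R}.
Local Notation X := (holder_even alpha).

Lemma holder_normE (f : X) : `|f| = sup_norm f + holder_seminorm alpha f.
Proof. by []. Qed.

Lemma le_holder_norm (f : X) x : `|f x| <= `|f|.
Proof.
by rewrite holder_normE (le_trans (le_sup_norm f x))// lerDl holder_seminorm_ge0.
Qed.

Lemma le_holder_norm_dist (f : X) x y : x != y ->
  `|f x - f y| <= `|f| * `|x - y| `^ alpha.
Proof.
move=> xy; rewrite (le_trans (le_holder_seminorm f xy))// ler_wpM2r ?powR_ge0//.
by rewrite holder_normE lerDr sup_norm_ge0.
Qed.

Lemma holder_complete (F : set_system X) : ProperFilter F -> cauchy F -> cvg F.
Proof.
move=> FF /cauchy_ballP Fc.
have FB (e : R) : 0 < e ->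
    exists A, F A /\ forall f g : X, A f -> A g -> `|f - g| < e.
  move=> e0; have [[A B] /= [FA FB] AB] := Fc e e0.
  exists (A `&` B); split=> [|f g [Af _] [_ Bg]]; first exact: filterI.
  exact: (AB (f, g)).
have Fx x : cvg ((fun f : X => f x) @ F).
  apply: cauchy_cvg; apply/cauchy_ballP => e e0.
  have [A [FA Ae]] := FB e e0.
  exists ((fun f : X => f x) @` A, (fun f : X => f x) @` A) => /=.
    have FI : F ((fun f : X => f x) @^-1` ((fun f : X => f x) @` A)).
      by apply: (filterS _ FA) => f Af; exists f.
    by split; exact: FI.
  move=> [_ _] [/= [f Af <-] [g Ag <-]].
  rewrite /ball/= (le_lt_trans _ (Ae _ _ Af Ag))//.
  exact: (le_holder_norm (f - g) x).
pose g x : R := lim ((fun f : X => f x) @ F).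
have gE x (d : R) : 0 < d -> \forall f \near F, `|g x - (f : X) x| < d.
  by move=> d0; have /cvgrPdist_lt := Fx x; apply.
have approx (A : set X) (x y d : R) : F A -> 0 < d ->
    exists f : X, [/\ A f, `|g x - f x| < d & `|g y - f y| < d].
  move=> FA d0.
  have FI : F (A `&` [set f : X | `|g x - f x| < d] `&`
               [set f : X | `|g y - f y| < d]).
    by apply: filterI; [apply: filterI|]; [exact: FA|exact: gE|exact: gE].
  by have [f [[Af fx] fy]] := filter_ex FI; exists f.
have dist1 (A : set X) (e : R) (f : X) x : F A ->
    (forall f g : X, A f -> A g -> `|f - g| < e) -> A f -> `|f x - g x| <= e.
  move=> FA Ae Af; apply/ler_addgt0Pr => d d0.
  have [h [Ah hx _]] := approx A x x d FA d0.
  rewrite -(subrKA (h x)) (le_trans (ler_normD _ _))// lerD//; last first.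
    by rewrite distrC ltW.
  by rewrite (le_trans (le_holder_norm (f - h) x))// ltW// Ae.
have dist2 (A : set X) (e : R) (f : X) x y : F A -> x != y ->
    (forall f g : X, A f -> A g -> `|f - g| < e) -> A f ->
    `|(f x - g x) - (f y - g y)| <= e * `|x - y| `^ alpha.
  move=> FA xy Ae Af; apply/ler_addgt0Pr => d d0.
  have d20 : 0 < d / 2 by rewrite divr_gt0.
  have [h [Ah hx hy]] := approx A x y (d / 2) FA d20.
  have -> : f x - g x - (f y - g y) =
      ((f - h) x - (f - h) y) + ((h x - g x) - (h y - g y)).
    have E z : (f - h) z = f z - h z by [].
    by rewrite !E; lra.
  rewrite (le_trans (ler_normD _ _))// lerD//.
    rewrite (le_trans (le_holder_norm_dist _ xy))// ler_wpM2r ?powR_ge0// ltW//.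
    exact: Ae.
  rewrite (le_trans (ler_normB _ _))// [leRHS]splitr lerD// distrC ltW//.
have gX : g \in holder_even_pred alpha.
  have [A [FA A1]] := FB 1 ltr01.
  have [f Af] := filter_ex FA.
  have [fp fe [C fC]] := holder_evenP f.
  apply/holder_even_predP; split=> [x|x|].
  - by rewrite /g; congr (lim (_ @ F)); apply/funext => h;
      have [-> _ _] := holder_evenP h.
  - by rewrite /g; congr (lim (_ @ F)); apply/funext => h;
      have [_ -> _] := holder_evenP h.
  exists (C + 1) => x y; have [Cx Cxy] := fC x y; split.
    rewrite -(subrK (f x) (g x)) addrC (le_trans (ler_normD _ _))// lerD//.
    by rewrite distrC; exact: dist1 FA A1 Af.
  have [->|xy] := eqVneq x y.
    by rewrite subrr normr0 mulr_ge0 ?powR_ge0// addr_ge0// (le_trans _ Cx).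
  have -> : g x - g y = (f x - f y) - ((f x - g x) - (f y - g y)) by lra.
  rewrite (le_trans (ler_normB _ _))// mulrDl lerD//.
  exact: dist2 FA xy A1 Af.
apply/cvg_ex; exists (HolderEven gX); apply/cvgrPdist_le => e e0.
have e20 : 0 < e / 2 by rewrite divr_gt0.
have [A [FA Ae]] := FB (e / 2) e20.
apply: (filterS _ FA) => f Af; rewrite distrC [leRHS]splitr.
apply: holder_norm_le => [x|x y xy] /=; first exact: dist1 FA Ae Af.
exact: dist2 FA xy Ae Af.
Qed.

End HolderComplete.

HB.instance Definition _ (R : realType) (alpha : R) :=
  Uniform_isComplete.Build (holder_even alpha) (@holder_complete R alpha).

Section HolderSquare.
Context {R : realType} {alpha : R}.

Lemma holder_sqr_subproof (f : holder_even alpha) :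
  (fun x => f x ^+ 2) \in holder_even_pred alpha.
Proof.
have [fp fe [C fC]] := holder_evenP f.
apply/holder_even_predP; split=> [x|x|]; rewrite ?fp ?fe//.
exists (Num.max (C ^+ 2) (2 * C ^+ 2)) => x y; have [Cx Cxy] := fC x y.
have [Cy _] := fC y x.
have C0 : 0 <= C by exact: le_trans (normr_ge0 _) Cx.
split; first by rewrite le_max normrX ler_sqr ?nnegrE// Cx.
rewrite (@le_trans _ _ (2 * C ^+ 2 * `|x - y| `^ alpha))//; last first.
  by rewrite ler_wpM2r ?powR_ge0// le_max lexx orbT.
have -> : 2 * C ^+ 2 * `|x - y| `^ alpha = C * `|x - y| `^ alpha * (C + C).
  by ring.
rewrite subr_sqr normrM ler_pM// (le_trans (ler_normD _ _))// lerD//.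
Qed.

Definition holder_sqr (f : holder_even alpha) : holder_even alpha :=
  HolderEven (holder_sqr_subproof f).

End HolderSquare.

Section Operators.
Context {R : realType}.

Definition bounded_op (V W : normedModType R) (T : V -> W) :=
  exists C : R, forall v, `|T v| <= C * `|v|.

Definition compact_op (V W : normedModType R) (T : V -> W) :=
  forall B : set V, bounded_set B -> compact (closure (T @` B)).

Definition has_dim (V : lmodType R) (S : set V) (n : nat) :=
  exists e : 'I_n -> V,
    (forall c : 'I_n -> R, \sum_(i < n) c i *: e i = 0 -> forall i, c i = 0) /\
    S = [set v | exists c : 'I_n -> R, v = \sum_(i < n) c i *: e i].

(* The dimension of an algebraic complement of the subspace S. *)
Definition has_codim (V : lmodType R) (S : set V) (n : nat) :=
  exists W : set V, [/\ has_dim W n,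
    forall v, exists s w, [/\ S s, W w & v = s + w]
    & S `&` W = [set 0]].

Definition fredholm_index (V W : normedModType R) (T : {linear V -> W})
    (k : int) :=
  [/\ bounded_op T, closed (range T)
    & exists n m : nat, [/\ has_dim [set v | T v = 0] n,
        has_codim (range T) m & k = n%:Z - m%:Z]].

Definition multilinear (V W : lmodType R) (k : nat) (m : ('I_k -> V) -> W) :=
  forall (v : 'I_k -> V) (i : 'I_k) (a : R) (x y : V),
    m [eta v with i |-> a *: x + y] =
    a *: m [eta v with i |-> x] + m [eta v with i |-> y].

Definition symmetric_map (V W : Type) (k : nat) (m : ('I_k -> V) -> W) :=
  forall (s : 'S_k) (v : 'I_k -> V), m (v \o s) = m v.

(* Real-analyticity between normed spaces: near x the map is the sum of a power
   series of bounded symmetric k-linear forms m k with sup_k r^k ‖m k‖ finite. *)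
Definition analytic_at (V W : normedModType R) (F : V -> W) (x : V) :=
  exists (m : forall k : nat, ('I_k -> V) -> W) (r C : R),
    [/\ 0 < r,
      forall k, multilinear (m k) /\ symmetric_map (m k),
      forall k (v : 'I_k -> V),
        r ^+ k * `|m k v| <= C * \prod_(i < k) `|v i|
    & forall h : V, `|h| < r ->
        series (fun k => m k (fun=> h)) @ \oo --> F (x + h)].

Definition bifurcation_map (V : normedModType R) (L : R -> {linear V -> V})
    (N : V -> R -> V) (phi : V) (mu : R) : V :=
  mu *: phi - L mu phi + N phi mu.

(* [sol mu phi] reads: phi solves the equation with parameter mu. The maps are
   total in mu, but only their values at mu > 0 are constrained. *)
Definition zero_set_formulation (V : normedModType R) (sol : R -> V -> Prop)
    (L : R -> {linear V -> V}) (N : V -> R -> V) :=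
  let F := bifurcation_map L N in
  [/\ forall p : V * R, 0 < p.2 ->
         analytic_at (fun q : V * R => F q.1 q.2) p,
      forall phi (mu : R), 0 < mu -> (sol mu phi <-> F phi mu = 0),
      forall mu : R, 0 < mu -> bounded_op (L mu) /\ compact_op (L mu),
      forall mu : R, 0 < mu -> differentiable (N ^~ mu) 0 /\
                           'd (N ^~ mu) 0 = (fun=> 0) :> (V -> V)
    & forall mu : R, 0 < mu -> differentiable (F ^~ mu) 0 /\
                           fredholm_index ('d (F ^~ mu) 0) 0].

End Operators.

Section Equations.
Context {R : realType}.
Local Notation leb := (@lebesgue_measure R).
Implicit Types (K phi psi : R -> R) (mu xi x : R).

Definition tanh x : R := (expR x - expR (- x)) / (expR x + expR (- x)).

Definition whitham_symbol xi : R :=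
  if xi == 0 then 1 else Num.sqrt (tanh xi / xi).

(* The integral of f(x) e^(-i x xi) over the line, for a real-valued f. *)
Definition fourier_transform (f : R -> R) xi : R[i] :=
  ((\int[leb]_x (f x * cos (x * xi)))%R +i*
   (- \int[leb]_x (f x * sin (x * xi)))%R)%C.

(* The symbol decays like |xi|^(-1/2) and is not integrable, so the inverse
   transform is not an absolutely convergent integral; K is the L^1 function
   (unique almost everywhere) whose Fourier transform is the symbol. *)
Definition is_whitham_kernel K :=
  leb.-integrable [set: R] (EFin \o K) /\
  forall xi, fourier_transform K xi = (whitham_symbol xi)%:C%C.

Definition convolution K phi x : R := (\int[leb]_y (K y * phi (x - y)))%R.

Definition whitham_solution K mu phi :=
  forall x, - mu * phi x + phi x ^+ 2 + convolution K phi x = 0.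

Definition periodic_test_function psi :=
  (forall x, psi (x + 2 * pi) = psi x) /\
  (forall n x, derivable (derive1n n psi) x 1).

(* The equation tested against C^oo(S), i.e. in the distributions on the
   circle: phi'' is paired with psi as the integral of phi psi'' . *)
Definition kdv_solution mu phi :=
  forall psi, periodic_test_function psi ->
    (\int[leb]_(x in `[- pi, pi])
      (((1 - mu) * phi x + phi x ^+ 2) * psi x + 6^-1 * phi x * derive1n 2 psi x))%R
    = 0.

End Equations.

(* Main.v *)
Require Import Defs.
From HB Require Import structures.
From mathcomp Require Import all_boot all_order all_algebra perm.
From mathcomp Require Import complex.
From mathcomp Require Import all_classical all_reals all_analysis.
From mathcomp Require Import ring lra.
Import Order.TTheory GRing.Theory Num.Theory.
Import numFieldNormedType.Exports.
Local Open Scope classical_set_scope.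
Local Open Scope ring_scope.

(** In both equations the linear part is, up to a multiple of the identity, a
    convolution with an integrable kernel [K] whose sine moments
    [int K(y) sin(ny) dy] vanish. For the Whitham equation this is the kernel
    itself. The KdV equation reads [(mu - (1/6) d^2/dx^2) phi = phi + phi^2];
    multiplying the inverse of the left-hand operator by [mu] gives
    [mu phi = L(mu) (phi + phi^2)], where [L(mu)] is convolution with the Green
    function [k cosh (k (pi - y)) / (2 sinh (k pi))], [k^2 = 6 mu], on one period.

    Such a convolution is diagonal on the cosines, [cos(nx)] being multiplied by
    [symbol K n]. Cosine polynomials are uniformly dense among even periodic
    continuous functions (Bernstein polynomials in [cos x]), so a linear
    functional that is continuous for the uniform norm and kills all cosines is
    zero ([cos_dense_functional]). Evenness of [K * phi], the uniqueness of
    cosine coefficients, the formula for the coefficients of [K * phi], and the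
    weak form of the KdV equation for [L(mu) g] are all instances of this.

    Compactness holds for every integrable kernel. A kernel which is a polynomial
    on a segment and zero elsewhere turns uniform bounds into Lipschitz bounds,
    and such kernels are dense in [L^1], whence
    [|L f| <= e |f| + C(e) sup |f|] for every [e > 0] ([convolution_ehrling]).
    Since bounded sets of Hoelder functions are totally bounded for the uniform
    norm, [L] maps them to totally bounded sets ([ehrling_compact]).

    The same inequality shows that [symbol K n = mu] for finitely many [n] only,
    because the Hoelder norm of [cos(nx)] grows. The corresponding cosines span
    the kernel of [mu - L]. The range consists of the functions whose
    coefficients at these [n] vanish: on that closed invariant subspace [mu - L]
    is injective, hence onto by Riesz' argument ([riesz_surjective]). The same
    cosines span a complement of the range, so the index is zero
    ([convolution_fredholm]).

    Analyticity is immediate for the Whitham map, which is a polynomial. For KdV,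
    [L(mu + s) - 1] is the Neumann series of [(1 + (s / mu) L(mu))^-1] applied to
    [L(mu) - 1] ([kdv_operator_series]); in either case the map has the form
    [G(mu) phi + H(mu) phi^2] with [G] and [H] operator power series, and its
    expansion is rearranged into symmetric multilinear forms
    ([analytic_at_quadratic]). The nonlinear part is bounded by a multiple of
    [|phi|^2], so it does not contribute to the differential at zero. *)

Set Implicit Arguments.
Unset Strict Implicit.
Unset Printing Implicit Defensive.

(** * Compactness in complete normed spaces *)

(** Total boundedness, stated through a colouring of the set by finitely many
    colours: this is the form in which sampling arguments produce it. *)
Definition totally_bounded {R : realType} {V : normedModType R} (A : set V) :=
  forall e : R, 0 < e -> exists (I : finType) (c : V -> I),
    forall x y, A x -> A y -> c x = c y -> `|x - y| < e.

(** An ultrafilter contains one of the finitely many colour classes, hence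
    contains sets of arbitrarily small diameter: it is Cauchy. *)
Lemma totally_bounded_compact {R : realType} {V : completeNormedModType R}
  (A : set V) : totally_bounded A -> compact (closure A).
Proof.
move=> tbA; rewrite compact_ultra => F FU FA.
have small e : 0 < e ->
    exists B, F B /\ forall x y, B x -> B y -> `|x - y| < e.
  move=> e0; have e30 : 0 < e / 3 by rewrite divr_gt0.
  have [I [c cP]] := tbA _ e30.
  pose near_pt x := get [set a | A a /\ `|x - a| < e / 3].
  have near_ptP x : closure A x -> A (near_pt x) /\ `|x - near_pt x| < e / 3.
    move=> /(_ _ (nbhsx_ballx x (e / 3) e30)) [a [Aa xa]].
    apply: (@getPex _ [set a | A a /\ `|x - a| < e / 3]); exists a; split => //.
    by move: xa; rewrite -ball_normE.
  pose D i := [set x | closure A x /\ c (near_pt x) = i].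
  have [[i FDi]|noF] := pselect (exists i, F (D i)).
    exists (D i); split=> // x y [cx xi] [cy yi].
    have [Ax xx] := near_ptP x cx; have [Ay yy] := near_ptP y cy.
    have xy := cP _ _ Ax Ay (etrans xi (esym yi)).
    have -> : x - y = (x - near_pt x) + (near_pt x - near_pt y)
                      + (near_pt y - y) by rewrite !addrA !subrK.
    rewrite (le_lt_trans (ler_normD _ _))//.
    have := ler_normD (x - near_pt x) (near_pt x - near_pt y).
    by rewrite [`|near_pt y - y|]distrC; lra.
  have FC : F [set x | forall i, ~ D i x].
    apply: filter_forall => i; have [Fi|//] := in_ultra_setVsetC (D i) FU.
    by exfalso; apply: noF; exists i.
  have [x [xA /(_ (c (near_pt x)))]] := filter_ex (filterI FA FC).
  by move=> nD; exfalso; apply: nD.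
have Fc : cvg F.
  apply: cauchy_cvg; apply/cauchy_ballP => e e0.
  have [B [FB Be]] := small e e0.
  exists (B, B) => //= -[x y] [/= Bx By].
  by rewrite -ball_normE /=; exact: Be.
have /cvg_ex[p Fp] := Fc.
exists p; split => //.
exact: (@closed_cvg _ _ F _ id (closure A) (@closed_closure _ A) FA p Fp).
Qed.

(** Riesz' argument ends on this: a sequence whose terms keep a fixed distance
    from each other lies in no compact set. *)
Lemma compact_seq_close {R : realType} {V : normedModType R} (A : set V)
    (u : nat -> V) (e : R) : compact A -> (forall n, A (u n)) -> 0 < e ->
  exists n m, (n < m)%N /\ `|u n - u m| < e.
Proof.
move=> cA Au e0; have e20 : 0 < e / 2 by rewrite divr_gt0.
have uA : (u n @[n --> \oo]) A by exists 0%N => // n _; exact: Au.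
have [p [_ clp]] := cA _ _ uA.
have hit N : exists2 n, (N <= n)%N & `|p - u n| < e / 2.
  have tail : (u n @[n --> \oo]) (u @` [set n | (N <= n)%N]).
    by exists N => // n Nn; exists n.
  have [_ [[n /= Nn <-]]] := clp _ _ tail (nbhsx_ballx p (e / 2) e20).
  by rewrite -ball_normE; exists n.
have [n _ pn] := hit 0; have [m nm pm] := hit n.+1.
exists n, m; split => //.
have -> : u n - u m = (p - u m) - (p - u n) by rewrite opprB [RHS]addrC [RHS]addrA subrK.
by rewrite (le_lt_trans (ler_normB _ _))//; lra.
Qed.

(** * Riesz theory for compact perturbations of a multiple of the identity *)

Section Riesz.
Context {R : realType} {V : completeNormedModType R}.
Variables (L : {linear V -> V}) (mu : R).
Hypotheses (Lb : bounded_op L) (Lc : compact_op L) (mu0 : 0 < mu).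

Let T (v : V) := mu *: v - L v.

Let T_lin a u v : T (a *: u + v) = a *: T u + T v.
Proof.
rewrite /T linearP scalerDr scalerA (mulrC mu) -scalerA opprD addrACA.
by rewrite scalerBr.
Qed.

Let TB u v : T (u - v) = T u - T v.
Proof. by rewrite -[u - v]addrC -scaleN1r T_lin scaleN1r addrC. Qed.

Let TZ a u : T (a *: u) = a *: T u.
Proof. by have := T_lin a u 0; rewrite /T linear0 !scaler0 subr0 !addr0 scalerBr. Qed.

Let T_bounded : exists2 C : R, 0 < C & forall v, `|T v| <= C * `|v|.
Proof.
have [C LC] := Lb; exists (mu + `|C|) => [|v].
  by rewrite ltr_wpDr.
rewrite mulrDl (le_trans (ler_normB _ _))// lerD//.
  by rewrite normrZ gtr0_norm.
by rewrite (le_trans (LC v))// ler_wpM2r// ler_norm.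
Qed.

Definition closed_subspace (Y : set V) :=
  [/\ closed Y, Y 0 & forall a u v, Y u -> Y v -> Y (a *: u + v)].

Let subB (Y : set V) u v : closed_subspace Y -> Y u -> Y v -> Y (u - v).
Proof. by move=> [_ _ YD] Yu Yv; rewrite addrC -scaleN1r; exact: YD. Qed.

Let subZ (Y : set V) a u : closed_subspace Y -> Y u -> Y (a *: u).
Proof. by move=> [_ Y0 YD] Yu; rewrite -[_ *: _]addr0; exact: YD. Qed.

Let subD (Y : set V) u v : closed_subspace Y -> Y u -> Y v -> Y (u + v).
Proof. by move=> [_ _ YD] Yu Yv; rewrite -[u]scale1r; exact: YD. Qed.

Let unit_ball_bounded : bounded_set [set v : V | `|v| <= 1].
Proof.
by exists 1; split; [exact: num_real | move=> M M1 v /= /le_trans; apply; exact: ltW].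
Qed.

(** If unit vectors [y n] of [Y] had images under [T] tending to [0], a cluster
    point of [L (y n)] would be a nonzero kernel vector in [Y]. *)
Lemma riesz_bounded_below (Y : set V) : closed_subspace Y ->
  (forall v, Y v -> T v = 0 -> v = 0) ->
  exists2 c : R, 0 < c & forall v, Y v -> c * `|v| <= `|T v|.
Proof.
move=> Ys Yinj; apply: contrapT => no.
have {no} no n : exists y, [/\ Y y, `|y| = 1 & `|T y| < n.+1%:R^-1].
  apply: contrapT => noy; apply: no; exists n.+1%:R^-1; first by rewrite invr_gt0.
  move=> v Yv; rewrite leNgt; apply/negP => Tv; apply: noy.
  have v0 : `|v| != 0.
    by apply/negP => /eqP v0; move: Tv; rewrite v0 mulr0 normr_lt0.
  exists (`|v|^-1 *: v); split; first exact: subZ.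
    by rewrite normrZ normfV normr_id mulVf.
  rewrite TZ normrZ normfV normr_id mulrC ltr_pdivrMr//.
  by rewrite lt0r v0 normr_ge0.
pose y n := sval (cid (no n)).
have yP n : [/\ Y (y n), `|y n| = 1 & `|T (y n)| < n.+1%:R^-1].
  exact: svalP (cid (no n)).
have Ly n : closure (L @` [set v | `|v| <= 1]) (L (y n)).
  by apply: subset_closure; exists (y n) => //=; have [_ -> _] := yP n.
have LyA : (L (y n) @[n --> \oo]) (closure (L @` [set v | `|v| <= 1])).
  by exists 0%N => // n _; exact: Ly.
have [p [_ clp]] := Lc unit_ball_bounded _ LyA.
have hit e : 0 < e -> exists n, `|p - mu *: y n| < e /\ `|T (y n)| < e.
  move=> e0; have e20 : 0 < e / 2 by rewrite divr_gt0.
  have [N _ NP] : \forall n \near \oo, n.+1%:R^-1 < e / 2 :> R.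
    exact: near_infty_natSinv_lt (PosNum e20).
  have tail : (L (y n) @[n --> \oo]) ((L \o y) @` [set n | (N <= n)%N]).
    by exists N => // n Nn; exists n.
  have [_ [[n /= Nn <-]]] := clp _ _ tail (nbhsx_ballx p (e / 2) e20).
  rewrite -ball_normE /= => pn; have [_ _ Tn] := yP n.
  have Te := lt_trans Tn (NP n Nn).
  exists n; split; last by rewrite (lt_trans Te)//; lra.
  have -> : p - mu *: y n = (p - L (y n)) - T (y n).
    by rewrite /T opprB addrA subrK.
  by rewrite (le_lt_trans (ler_normB _ _))//; lra.
have [C C0 TC] := T_bounded.
have Tp : T p = 0.
  apply/eqP; rewrite -normr_le0; apply/ler_addgt0Pr => e e0; rewrite add0r.
  have d0 : 0 < e / (C + mu) by rewrite divr_gt0// addr_gt0.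
  have [n [pn Tn]] := hit _ d0.
  have -> : T p = T (p - mu *: y n) + mu *: T (y n) by rewrite TB TZ subrK.
  rewrite (le_trans (ler_normD _ _))// normrZ gtr0_norm//.
  have -> : e = C * (e / (C + mu)) + mu * (e / (C + mu)).
    by rewrite -mulrDl mulrC divfK// gt_eqF// addr_gt0.
  rewrite lerD//; last by rewrite ler_wpM2l// ltW.
  by rewrite (le_trans (TC _))// ler_wpM2l// ltW.
have Yp : Y p.
  have [Yc _ _] := Ys; apply: Yc => B /nbhs_ballP [e /= e0 eB].
  have [n [pn _]] := hit _ e0; exists (mu *: y n); split.
    by apply: subZ => //; have [] := yP n.
  by apply: eB; rewrite -ball_normE.
have p0 := Yinj _ Yp Tp.
have [n []] := hit _ mu0; rewrite p0 sub0r normrN normrZ gtr0_norm//.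
by have [_ -> _] := yP n; rewrite mulr1 ltxx.
Qed.

(** By the lower bound on [Y], the elements of [Y] whose images are close to a
    limit point of [T @` Y] form a Cauchy filter. *)
Lemma riesz_closed_image (Y : set V) : closed_subspace Y ->
  (forall v, Y v -> T v = 0 -> v = 0) -> closed_subspace (T @` Y).
Proof.
move=> Ys Yinj; have [c c0 Tc] := riesz_bounded_below Ys Yinj.
have [Yc Y0 YD] := Ys; split; last 2 first.
- by exists 0 => //; rewrite /T scaler0 linear0 subr0.
- by move=> a _ _ [u Yu <-] [v Yv <-]; exists (a *: u + v); [exact: YD|exact: T_lin].
move=> z clz.
have ex e : 0 < e -> exists y, Y y /\ `|z - T y| < e.
  move=> e0; have [_ [[y Yy <-]]] := clz _ (nbhsx_ballx z e e0).
  by rewrite -ball_normE; exists y.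
pose G : set_system V :=
  filter_from [set e : R | 0 < e] (fun e => [set y | Y y /\ `|z - T y| < e]).
have GF : ProperFilter G.
  apply: filter_from_proper; last by move=> e /ex [y yP]; exists y.
  apply: filter_from_filter; first by exists 1; rewrite /= ltr01.
  move=> e d /= e0 d0; exists (Num.min e d); first by rewrite lt_min e0.
  by move=> y [Yy]; rewrite lt_min => /andP[].
have /cvg_ex[y Gy] : cvg G.
  apply: cauchy_cvg; apply/cauchy_ballP => e e0.
  pose B := [set y | Y y /\ `|z - T y| < c * e / 2].
  have GB : G B by exists (c * e / 2) => //; rewrite /= divr_gt0// mulr_gt0.
  exists (B, B) => //= -[u v] [/= [Yu zu] [Yv zv]].
  rewrite -ball_normE /= -(ltr_pM2l c0) (le_lt_trans (Tc _ (subB Ys Yu Yv)))//.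
  have -> : T (u - v) = (z - T v) - (z - T u).
    by rewrite TB (opprB z) [RHS]addrC [RHS]addrA subrK.
  by rewrite (le_lt_trans (ler_normB _ _))//; lra.
have GY : G Y by exists 1 => [|? []]//; rewrite /= ltr01.
have Yy : Y y := closed_cvg (u_ := id) Y Yc GY y Gy.
exists y; first exact: Yy.
apply/eqP; rewrite -subr_eq0 -normr_le0.
apply/ler_addgt0Pr => e e0; rewrite add0r.
have [C C0 TC] := T_bounded.
have d0 : 0 < e / (C + 1) by rewrite divr_gt0// addr_gt0.
have G1 : G (ball y (e / (C + 1))) by apply: Gy; exact: nbhsx_ballx.
have G2 : G [set u | Y u /\ `|z - T u| < e / (C + 1)] by exists (e / (C + 1)).
have [u [yu [_ zu]]] := filter_ex (filterI G1 G2).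
have -> : T y - z = T (y - u) - (z - T u) by rewrite TB (opprB z) [RHS]addrA subrK.
have -> : e = C * (e / (C + 1)) + e / (C + 1).
  by rewrite -[X in _ + X]mul1r -mulrDl mulrC divfK// gt_eqF// addr_gt0.
rewrite (le_trans (ler_normB _ _))// lerD//; last exact: ltW.
rewrite (le_trans (TC _))// ler_wpM2l//; first exact: ltW.
by move: yu; rewrite -ball_normE => /ltW.
Qed.

(** Riesz' lemma. The constant [1/2] comes from choosing [y] in [Y] that realizes
    the distance from [v] to [Y] within a factor two. *)
Lemma riesz_lemma (Y : set V) (v : V) : closed_subspace Y -> ~ Y v ->
  exists a y, Y y /\ let u := a *: (v - y) in
    `|u| = 1 /\ forall z, Y z -> 2^-1 <= `|u - z|.
Proof.
move=> Ys nYv; have [Yc Y0 _] := Ys.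
pose D := [set `|v - y| | y in Y].
have Dinf : has_inf D.
  split; first by exists `|v - 0|; exists 0.
  by exists 0 => _ [y _ <-].
have dle y : Y y -> inf D <= `|v - y|.
  by move=> Yy; apply: ge_inf; [exact: Dinf.2|exists y].
have d0 : 0 < inf D.
  have [//|d0] := ltP 0 (inf D); exfalso; apply: nYv; apply: Yc.
  move=> B /nbhs_ballP [e /= e0 eB].
  have [_ [y Yy <-] ye] := inf_adherent e0 Dinf.
  exists y; split => //; apply: eB; rewrite -ball_normE /=.
  by apply: lt_le_trans ye _; lra.
have [_ [y Yy <-] yd] := inf_adherent d0 Dinf.
have w0 : 0 < `|v - y| by apply: lt_le_trans d0 (dle _ Yy).
exists `|v - y|^-1, y; split=> //=; split.
  by rewrite normrZ normfV normr_id mulVf// gt_eqF.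
move=> z Yz.
have -> : `|v - y|^-1 *: (v - y) - z =
    `|v - y|^-1 *: (v - (y + `|v - y| *: z)).
  by rewrite opprD addrA [RHS]scalerBr scalerA mulVf ?gt_eqF// scale1r.
rewrite normrZ normfV normr_id ler_pdivlMl//.
apply: le_trans (dle _ (subD Ys Yy (subZ _ Ys Yz))); lra.
Qed.

(** If [T] were injective but not onto on [Y], the subspaces [T^n Y] would
    decrease strictly; Riesz' lemma then gives unit vectors whose images by the
    compact [L] stay [mu / 2] apart. *)
Theorem riesz_surjective (Y : set V) : closed_subspace Y ->
  (forall v, Y v -> Y (T v)) -> (forall v, Y v -> T v = 0 -> v = 0) ->
  forall z, Y z -> exists2 y, Y y & T y = z.
Proof.
move=> Ys TY Yinj z Yz; apply: contrapT => nz.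
pose Yn n := iter n (fun A : set V => T @` A) Y.
have Yn_sub n : Yn n `<=` Y.
  by elim: n => [//|n IHn] _ [y /IHn Yy <-]; exact: TY.
have Yn_dec n : Yn n.+1 `<=` Yn n.
  elim: n => [|n IHn]; first by move=> _ [y Yy <-]; exact: TY.
  by move=> _ [y Yy <-]; exists y => //; exact: IHn.
have Yn_le n m : (n <= m)%N -> Yn m `<=` Yn n.
  move=> /subnK <-; elim: (m - n)%N => [//|k IHk] v.
  by rewrite addSn => /Yn_dec; exact: IHk.
have Yn_s n : closed_subspace (Yn n).
  elim: n => [//|n IHn]; apply: riesz_closed_image => // v /Yn_sub.
  exact: Yinj.
have z_in n : Yn n (iter n T z) /\ ~ Yn n.+1 (iter n T z).
  elim: n => [|n [IH1 IH2]]; first by split=> // -[y Yy yz]; apply: nz; exists y.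
  split; first by exists (iter n T z).
  move=> [y Yy Tyz]; apply: IH2.
  suff -> : iter n T z = y by [].
  apply/eqP; rewrite -subr_eq0; apply/eqP/Yinj.
    by apply: (@Yn_sub n); apply: subB => //; exact: Yn_dec.
  by rewrite TB Tyz subrr.
have exu n : exists u, [/\ Yn n u, `|u| = 1 &
    forall w, Yn n.+1 w -> 2^-1 <= `|u - w|].
  have [zn nzn] := z_in n.
  have [a [y [Yy [u1 uw]]]] := riesz_lemma (Yn_s n.+1) nzn.
  exists (a *: (iter n T z - y)); split => //.
  by apply: subZ => //; apply: subB => //; exact: Yn_dec.
pose u n := sval (cid (exu n)).
have uP n : [/\ Yn n (u n), `|u n| = 1 & forall w, Yn n.+1 w -> 2^-1 <= `|u n - w|].
  exact: svalP (cid (exu n)).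
have Lu n : closure (L @` [set v | `|v| <= 1]) (L (u n)).
  by apply: subset_closure; exists (u n) => //=; have [_ -> _] := uP n.
have h0 : 0 < mu / 2 by rewrite divr_gt0.
have [n [m [nm]]] := compact_seq_close (Lc unit_ball_bounded) Lu h0.
apply/negP; rewrite -leNgt.
pose w := mu^-1 *: (T (u n) + L (u m)).
have -> : L (u n) - L (u m) = mu *: (u n - w).
  rewrite scalerBr scalerA divff ?gt_eqF// scale1r opprD addrA /T opprB.
  by rewrite [mu *: u n + (_ - _)]addrC subrK.
rewrite normrZ gtr0_norm// ler_wpM2l//; first exact: ltW.
have [Yu _ uw] := uP n; have [Yum _ _] := uP m.
apply: uw; apply: subZ => //; apply: subD => //; first by exists (u n).
have -> : L (u m) = mu *: u m - T (u m) by rewrite /T opprB addrC subrK.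
apply: subB => //; first by apply: subZ => //; exact: Yn_le Yum.
by apply: (Yn_le _ _ (leqW nm)); exists (u m).
Qed.

End Riesz.

(** * Uniform approximation by cosine polynomials *)

(** Bernstein's operator through Pascal's recursion: on [[0, 1]] it averages
    [g 0, ..., g n] against the binomial weights of parameter ['X]. *)
Fixpoint bernstein {R : nzRingType} (n : nat) (g : nat -> R) : {poly R} :=
  if n is n'.+1 then
    (1 - 'X) * bernstein n' g + 'X * bernstein n' (g \o succn)
  else (g 0%N)%:P.

Section Bernstein.
Context {R : realType}.
Implicit Types (g h : nat -> R) (t : R) (n : nat).

Lemma bernsteinS n g t : (bernstein n.+1 g).[t] =
  (1 - t) * (bernstein n g).[t] + t * (bernstein n (g \o succn)).[t].
Proof. by rewrite /= !hornerE. Qed.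

Lemma bernsteinD n g h t :
  (bernstein n (fun k => g k + h k)).[t] = (bernstein n g).[t] + (bernstein n h).[t].
Proof.
elim: n g h => [|n IHn] g h; first by rewrite /= !hornerE.
rewrite !bernsteinS IHn -[_ \o succn]/(fun k => g k.+1 + h k.+1) IHn /comp; ring.
Qed.

Lemma bernsteinZ n a g t :
  (bernstein n (fun k => a * g k)).[t] = a * (bernstein n g).[t].
Proof.
elim: n g => [|n IHn] g; first by rewrite /= !hornerE.
rewrite !bernsteinS IHn -[_ \o succn]/(fun k => a * g k.+1) IHn /comp; ring.
Qed.

Lemma bernstein_cst n (a : R) t : (bernstein n (fun=> a)).[t] = a.
Proof.
elim: n => [|n IHn]; first by rewrite /= hornerE.
by rewrite bernsteinS -[_ \o succn]/(fun=> a) IHn; ring.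
Qed.

Lemma bernstein_le n g h t : 0 <= t <= 1 -> (forall k, (k <= n)%N -> g k <= h k) ->
  (bernstein n g).[t] <= (bernstein n h).[t].
Proof.
move=> /andP[t0 t1]; elim: n g h => [|n IHn] g h gh.
  by rewrite /= !hornerE; exact: gh.
rewrite !bernsteinS lerD// ler_wpM2l ?subr_ge0// IHn// => k kn.
- by apply: gh; exact: leqW.
- exact: gh.
Qed.

(** The variance of the binomial law, in the form that Pascal's recursion
    proves by induction. *)
Lemma bernstein_variance n (c t : R) :
  (bernstein n (fun k => (k%:R - c) ^+ 2)).[t] =
  n%:R * (t * (1 - t)) + (n%:R * t - c) ^+ 2.
Proof.
elim: n c => [|n IHn] c; first by rewrite /= !hornerE /=; ring.
rewrite bernsteinS IHn.
rewrite (_ : _ \o succn = fun k => (k%:R - (c - 1)) ^+ 2); last first.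
  by apply/funext => k /=; rewrite -natr1; ring.
by rewrite IHn -natr1; ring.
Qed.

(** Korovkin's argument: the assumed modulus of continuity turns the variance
    bound into a uniform error bound. *)
Lemma bernstein_approx (h : R -> R) :
  (forall e, 0 < e -> exists C, forall s t, 0 <= s <= 1 -> 0 <= t <= 1 ->
     `|h s - h t| <= e + C * (s - t) ^+ 2) ->
  forall e, 0 < e -> exists p : {poly R}, forall t, 0 <= t <= 1 ->
    `|h t - p.[t]| <= e.
Proof.
move=> hm e e0; have e20 : 0 < e / 2 by rewrite divr_gt0.
have [C hC] := hm _ e20.
pose D := Num.max C 0.
have [n nD] : exists n : nat, D / (e / 2) <= n.+1%:R.
  have := archi_boundP (_ : 0 <= D / (e / 2)).
  rewrite divr_ge0 ?le_max ?lexx ?orbT ?ltW// => /(_ isT) H.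
  exists (Num.bound (D / (e / 2))); rewrite (le_trans (ltW H))// ler_nat.
  exact: leqnSn.
have n0 : (0 : R) < n.+1%:R by [].
pose g k : R := h (k%:R / n.+1%:R).
exists (bernstein n.+1 g) => t t01.
pose var (k : nat) : R := e / 2 + D / n.+1%:R ^+ 2 * (k%:R - n.+1%:R * t) ^+ 2.
have gk k : (k <= n.+1)%N -> `|h t - g k| <= var k.
  move=> kn; have k01 : 0 <= (k%:R / n.+1%:R : R) <= 1.
    by rewrite divr_ge0//= ler_pdivrMr// mul1r ler_nat.
  apply: le_trans (hC _ _ t01 k01) _; rewrite lerD2l.
  have -> : D / n.+1%:R ^+ 2 * (k%:R - n.+1%:R * t) ^+ 2
      = D * (t - k%:R / n.+1%:R) ^+ 2.
    by move: n.+1%:R (lt0r_neq0 n0) => N N0; field.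
  by rewrite ler_wpM2r ?sqr_ge0// le_max lexx.
have var_le : (bernstein n.+1 var).[t] <= e.
  rewrite bernsteinD bernstein_cst bernsteinZ bernstein_variance.
  rewrite subrr expr0n addr0.
  have -> : D / n.+1%:R ^+ 2 * (n.+1%:R * (t * (1 - t))) =
      D / n.+1%:R * (t * (1 - t)).
    by move: n.+1%:R (lt0r_neq0 n0) => N N0; field.
  have D0 : 0 <= D / n.+1%:R by rewrite divr_ge0// le_max lexx orbT.
  have De : D / n.+1%:R <= e / 2.
    by rewrite ler_pdivrMr// -ler_pdivrMl// mulrC.
  have tt : t * (1 - t) <= 1 by case/andP: t01 => *; nra.
  have : D / n.+1%:R * (t * (1 - t)) <= D / n.+1%:R * 1 by rewrite ler_wpM2l.
  by rewrite mulr1 => H; rewrite [leRHS]splitr lerD2l (le_trans H).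
rewrite ler_norml; apply/andP; split.
- rewrite lerNl opprB -[X in _ - X](bernstein_cst n.+1 (h t) t).
  rewrite lerBlDr (le_trans _ (lerD var_le (lexx _)))// -bernsteinD.
  apply: bernstein_le => // k /gk; rewrite ler_norml => /andP[]; lra.
- rewrite -[X in X - _](bernstein_cst n.+1 (h t) t).
  rewrite lerBlDr (le_trans _ (lerD var_le (lexx _)))// -bernsteinD.
  apply: bernstein_le => // k /gk; rewrite ler_norml => /andP[]; lra.
Qed.

End Bernstein.

(** * The space of even Hoelder functions on the circle *)

Section HolderTools.
Context {R : realType}.
Implicit Types (f g : R -> R) (x y : R).

(** The half-line version is the one that applies to primitives, which are only
    built to the right of a base point. *)
Lemma lipschitz_of_derive_gt (c : R) f (df : R -> R) (C : R) :
  (forall x, c < x -> is_derive x 1 f (df x)) -> (forall x, `|df x| <= C) ->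
  forall x y, c < x -> c < y -> `|f x - f y| <= C * `|x - y|.
Proof.
move=> fdf dfC x y; wlog xy : x y / x <= y.
  move=> H cx cy; have [xy|/ltW yx] := leP x y; first exact: H.
  by rewrite distrC [`|x - y|]distrC; exact: H.
move=> cx cy.
have cf z : c < z -> {for z, continuous f}.
  move=> cz; apply: differentiable_continuous; apply/derivable1_diffP.
  by case: (fdf _ cz).
have [w _ fw] : exists2 w, w \in `[x, y]%R & f y - f x = df w * (y - x).
  apply: MVT_segment => // [z|].
    by rewrite in_itv/= => /andP[xz _]; apply: fdf; exact: lt_trans xz.
  apply: continuous_in_subspaceT => z; rewrite inE/= in_itv/= => /andP[xz _].
  by apply: cf; exact: lt_le_trans xz.
by rewrite distrC fw normrM [`|x - y|]distrC ler_wpM2r.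
Qed.

Lemma lipschitz_of_derive f (df : R -> R) (C : R) :
  (forall x, is_derive x 1 f (df x)) -> (forall x, `|df x| <= C) ->
  forall x y, `|f x - f y| <= C * `|x - y|.
Proof.
move=> fdf dfC x y.
apply: (@lipschitz_of_derive_gt (Num.min x y - 1) f df) => //.
- by rewrite ltrBlDr gt_min ltrDl ltr01.
- by rewrite ltrBlDr gt_min ltrDl ltr01 orbT.
Qed.

(** The Lipschitz bound is the stronger one at distances below [1], the uniform
    bound beyond. *)
Lemma holder_of_lipschitz (alpha : R) f (M C : R) : 0 < alpha <= 1 ->
  (forall x, `|f x| <= M) -> (forall x y, `|f x - f y| <= C * `|x - y|) ->
  forall x y, `|f x - f y| <= (C + 2 * M) * `|x - y| `^ alpha.
Proof.
move=> /andP[a0 a1] fM fC x y.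
have M0 : 0 <= M by exact: le_trans (fM 0).
have C0 : 0 <= C.
  by have := le_trans (normr_ge0 _) (fC 1 0); rewrite subr0 normr1 mulr1.
have [->|xy] := eqVneq x y.
  by rewrite subrr normr0 mulr_ge0 ?powR_ge0// addr_ge0// mulr_ge0.
have d0 : 0 < `|x - y| by rewrite normr_gt0 subr_eq0.
have p0 : 0 <= `|x - y| `^ alpha by exact: powR_ge0.
rewrite mulrDl; have [d1|d1] := leP `|x - y| 1.
  have : `|x - y| <= `|x - y| `^ alpha by rewrite ger1_powR// d0.
  have := fC x y; have : 0 <= 2 * M * `|x - y| `^ alpha by rewrite !mulr_ge0.
  by nra.
have : 1 <= `|x - y| `^ alpha.
  by rewrite -[leLHS](powRr0 `|x - y|) ler_powR ?ltW.
have : `|f x - f y| <= M + M.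
  by rewrite (le_trans (ler_normB _ _))// lerD.
have : 0 <= C * `|x - y| `^ alpha by rewrite mulr_ge0.
by nra.
Qed.

(** The quantifier over [f] comes last so that one representative serves all
    even periodic functions at once, in particular a function and the cosine. *)
Lemma even_periodic_repr x : exists2 y, 0 <= y <= pi & forall f,
  (forall z, f (z + 2 * pi) = f z) -> (forall z, f (- z) = f z) -> f x = f y.
Proof.
have pi20 : 0 < 2 * pi :> R by rewrite mulr_gt0// pi_gt0.
pose n := Num.floor ((x + pi) / (2 * pi)).
have /andP[n1 n2] : n%:~R <= (x + pi) / (2 * pi) < (n + 1)%:~R.
  exact: floor_itv.
pose z := x - n%:~R * (2 * pi).
have z1 : - pi <= z.
  by move: n1; rewrite ler_pdivlMr// /z; lra.
have z2 : z <= pi.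
  by move: n2; rewrite ltr_pdivrMr// intrD mulrDl /z; lra.
exists `|z|; first by rewrite normr_ge0 ler_norml z1 z2.
move=> f fp fe; have -> : f `|z| = f z.
  by have [_|_] := ger0P z; rewrite // fe.
have fn (k : nat) u : f (u + k%:R * (2 * pi)) = f u.
  elim: k => [|k IHk]; first by rewrite mul0r addr0.
  by rewrite -natr1 mulrDl mul1r addrA fp.
rewrite /z; case: n {n1 n2 z z1 z2} => k.
  by rewrite -[in LHS](subrK (k%:R * (2 * pi)) x) fn.
by rewrite NegzE mulrNz mulNr opprK fn.
Qed.

(** A lower bound for the variation of the cosine that does not degenerate at
    the ends of [[0, pi]], where the derivative vanishes. *)
Lemma cos_separated (d x y : R) : 0 < d -> 0 <= x <= pi -> 0 <= y <= pi ->
  d <= `|x - y| -> 2 * sin (d / 2) ^+ 2 <= `|cos x - cos y|.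
Proof.
move=> d0; wlog xy : x y / x <= y.
  move=> H x0 y0; have [/H|/ltW/H] := leP x y; first exact.
  by rewrite distrC [`|cos y - _|]distrC; exact.
move=> /andP[x0 x1] /andP[y0 y1]; rewrite (distrC x) (ger0_norm (_ : 0 <= y - x)) ?subr_ge0// => dxy.
pose a := (x + y) / 2; pose b := (y - x) / 2.
have -> : cos x - cos y = 2 * (sin a * sin b).
  have -> : x = a - b by rewrite /a /b; lra.
  have -> : y = a + b by rewrite /a /b; lra.
  by rewrite cosB cosD; ring.
have p0 := @pi_gt0 R.
have sd0 : 0 < sin (d / 2) by apply: sin_gt0_pi; apply/andP; split; lra.
have sdb : sin (d / 2) <= sin b.
  have [->//|ne] := eqVneq (d / 2) b.
  apply/ltW; rewrite ltr_sin ?in_itv/= /b; [|by apply/andP; split; lra..].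
  by rewrite lt_neqAle ne /b; lra.
have sba : sin b <= sin a.
  have -> : sin a = cos (a - pi / 2) by rewrite cosBpihalf.
  have -> : sin b = cos (pi / 2 - b) by rewrite -cosN opprB cosBpihalf.
  rewrite -[leRHS]cos_norm.
  have [->//|ne] := eqVneq `|a - pi / 2| (pi / 2 - b).
  have ab : `|a - pi / 2| <= pi / 2 - b.
    by rewrite ler_norml /a /b; lra.
  have ab0 : 0 <= pi / 2 - b <= pi by rewrite /b; apply/andP; split; lra.
  apply/ltW; rewrite ltr_cos ?in_itv/= ?normr_ge0 ?ab0//.
    by rewrite lt_neqAle ne.
  by rewrite (le_trans ab)//; case/andP: ab0.
rewrite ger0_norm; last by rewrite !mulr_ge0//; lra.
by rewrite expr2; nra.
Qed.

End HolderTools.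

Section HolderAlgebra.
Context {R : realType} {alpha : R}.
Local Notation X := (holder_even alpha).
Implicit Types f g : X.

Lemma holder_mul_subproof f g : (fun x => f x * g x) \in holder_even_pred alpha.
Proof.
have [fp fe [C fC]] := holder_evenP f; have [gp ge [D gD]] := holder_evenP g.
apply/holder_even_predP; split=> [x|x|]; rewrite ?fp ?fe ?gp ?ge//.
have C0 : 0 <= C by case: (fC 0 0) => + _; exact: le_trans.
have D0 : 0 <= D by case: (gD 0 0) => + _; exact: le_trans.
exists (2 * (C * D)) => x y.
have [Cx Cxy] := fC x y; have [Dx Dxy] := gD x y; have [Dy _] := gD y x.
split; first by rewrite normrM; have := ler_pM (normr_ge0 _) (normr_ge0 _) Cx Dx; nra.
have -> : f x * g x - f y * g y = f x * (g x - g y) + (f x - f y) * g y by ring.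
rewrite (le_trans (ler_normD _ _))// !normrM.
have := ler_pM (normr_ge0 _) (normr_ge0 _) Cx Dxy.
have := ler_pM (normr_ge0 _) (normr_ge0 _) Cxy Dy.
lra.
Qed.

Definition holder_mul f g : X := HolderEven (holder_mul_subproof f g).

Lemma holder_mul_norm f g : `|holder_mul f g| <= `|f| * `|g|.
Proof.
rewrite !holder_normE.
have sf := sup_norm_ge0 f; have sg := sup_norm_ge0 g.
have hf := holder_seminorm_ge0 f; have hg := holder_seminorm_ge0 g.
apply: (@le_trans _ _ (sup_norm f * sup_norm g +
  (sup_norm f * holder_seminorm alpha g + holder_seminorm alpha f * sup_norm g))).
  apply: holder_norm_le => [x|x y xy] /=.
    by rewrite normrM ler_pM// le_sup_norm.
  have -> : f x * g x - f y * g y = f x * (g x - g y) + (f x - f y) * g y by ring.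
  rewrite (le_trans (ler_normD _ _))// !normrM mulrDl lerD//.
    by rewrite -mulrA ler_pM// ?le_sup_norm// le_holder_seminorm.
  by rewrite mulrAC ler_pM// ?le_sup_norm// le_holder_seminorm.
by nra.
Qed.

Lemma holder_mulC f g : holder_mul f g = holder_mul g f.
Proof. by apply: holder_eqP => x /=; rewrite mulrC. Qed.

Lemma holder_mulDr a f g h :
  holder_mul f (a *: g + h) = a *: holder_mul f g + holder_mul f h.
Proof. by apply: holder_eqP => x /=; rewrite !fctE mulrDr mulrCA. Qed.

Lemma holder_mulDl a f g h :
  holder_mul (a *: g + h) f = a *: holder_mul g f + holder_mul h f.
Proof. by rewrite holder_mulC holder_mulDr !(holder_mulC f). Qed.

Lemma holder_sqrE f : holder_sqr f = holder_mul f f.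
Proof. by apply: holder_eqP => x /=; rewrite expr2. Qed.

Lemma holder_continuous f : 0 < alpha -> continuous f.
Proof.
move=> a0 x; apply/cvgrPdist_lt => e e0.
pose d := (e / (`|f| + 1)) `^ alpha^-1.
have n0 : 0 < `|f| + 1 by rewrite ltr_wpDl.
have d0 : 0 < d by rewrite powR_gt0// divr_gt0.
near=> y.
have [->|xy] := eqVneq x y; first by rewrite subrr normr0.
apply: le_lt_trans (le_holder_norm_dist f xy) _.
have xyd : `|x - y| < d by near: y; exact: cvgr_dist_lt.
have : `|x - y| `^ alpha < d `^ alpha.
  by apply: gt0_ltr_powR => //; rewrite nnegrE ltW.
rewrite /d -powRrM mulVf ?gt_eqF// powRr1 ?divr_ge0 ?ltW// ltr_pdivlMr//.
have := powR_ge0 `|x - y| alpha; have := normr_ge0 f; nra.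
Unshelve. all: by end_near. Qed.

End HolderAlgebra.

Section CosinePolynomials.
Context {R : realType} {alpha : R}.
Hypothesis ha : 0 < alpha <= 1.
Local Notation X := (holder_even alpha).
Implicit Types f g : X.

Lemma cos_natmul_derive (n : nat) (x : R) :
  is_derive x 1 (fun x => cos (n%:R * x)) (- (n%:R * sin (n%:R * x))).
Proof.
have H : is_derive x 1 (n%:R \*: @id R) (n%:R *: 1) by exact: is_deriveZ.
have := is_derive1_comp (is_derive_cos (n%:R * x)) H.
by rewrite /GRing.scale/= mulr1 mulNr mulrC.
Qed.

Lemma cosX_subproof (n : nat) :
  (fun x : R => cos (n%:R * x)) \in holder_even_pred alpha.
Proof.
apply/holder_even_predP; split=> [x|x|].
- have -> : n%:R * (x + 2 * pi) = n%:R * x + (pi *+ 2) *+ n.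
    by rewrite -[(pi *+ 2) *+ n]mulr_natr -[pi *+ 2]mulr_natr; ring.
  by rewrite periodicn//; exact: cosD2pi.
- by rewrite mulrN cosN.
exists (1 + (n%:R + 2 * 1)) => x y; split.
  by rewrite (le_trans (cos_max _))// lerDl addr_ge0.
rewrite mulrDl ler_wpDl ?mul1r ?powR_ge0//.
apply: (@holder_of_lipschitz _ _ (fun z => cos (n%:R * z)) 1 n%:R ha) => [z|].
  exact: cos_max.
apply: (lipschitz_of_derive (cos_natmul_derive n)) => z.
by rewrite normrN normrM ger0_norm// ler_piMr// sin_max.
Qed.

Definition cosX (n : nat) : X := HolderEven (cosX_subproof n).

Inductive cos_poly : X -> Prop :=
| cos_poly_cos n : cos_poly (cosX n)
| cos_poly_lin a f g : cos_poly f -> cos_poly g -> cos_poly (a *: f + g).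

Lemma cos_polyZ a f : cos_poly f -> cos_poly (a *: f).
Proof.
move=> cf; have -> : a *: f = (a - 1) *: f + f.
  by rewrite scalerBl scale1r subrK.
exact: cos_poly_lin.
Qed.

Lemma cos_polyD f g : cos_poly f -> cos_poly g -> cos_poly (f + g).
Proof. by move=> cf cg; rewrite -[f]scale1r; exact: cos_poly_lin. Qed.

Lemma cos_poly_mul_cos f : cos_poly f -> cos_poly (holder_mul (cosX 1) f).
Proof.
elim=> [n|a g h _ IHg _ IHh]; last by rewrite holder_mulDr; exact: cos_poly_lin.
case: n => [|n].
  have -> : holder_mul (cosX 1) (cosX 0) = cosX 1; last exact: cos_poly_cos.
  by apply: holder_eqP => x /=; rewrite mul0r cos0 mulr1.
have -> : holder_mul (cosX 1) (cosX n.+1) = 2^-1 *: cosX n + 2^-1 *: cosX n.+2.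
  apply: holder_eqP => x /=; rewrite !fctE /GRing.scale/=.
  have -> : n%:R * x = n.+1%:R * x - 1 * x by rewrite -natr1; ring.
  have -> : n.+2%:R * x = n.+1%:R * x + 1 * x by rewrite -(natr1 n.+1); ring.
  by rewrite cosB cosD; field.
by apply: cos_polyD; apply: cos_polyZ; exact: cos_poly_cos.
Qed.

Lemma cos_poly_horner (p : {poly R}) : exists2 f : X, cos_poly f &
  forall x, f x = p.[(1 + cos x) / 2].
Proof.
elim/poly_ind: p => [|p c [f cf fE]].
  exists (0 *: cosX 0) => [|x]; first by apply: cos_polyZ; exact: cos_poly_cos.
  by rewrite scale0r horner0.
exists (2^-1 *: (f + holder_mul (cosX 1) f) + c *: cosX 0).
  apply: cos_polyD; apply: cos_polyZ; last exact: cos_poly_cos.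
  by apply: cos_polyD => //; exact: cos_poly_mul_cos.
move=> x; rewrite !hornerE -fE /= !fctE /GRing.scale/= mul0r cos0 mul1r.
by field.
Qed.

(** In the variable [t = (1 + cos x) / 2] an even periodic function becomes a
    continuous function on [[0, 1]], approximated by Bernstein polynomials. *)
Lemma cos_poly_dense f (e : R) : 0 < e ->
  exists2 g, cos_poly g & forall x, `|f x - g x| <= e.
Proof.
move=> e0; pose h t := f (acos (2 * t - 1)).
have [a0 _] := andP ha.
have hmod e' : 0 < e' -> exists C, forall s t, 0 <= s <= 1 -> 0 <= t <= 1 ->
    `|h s - h t| <= e' + C * (s - t) ^+ 2.
  move=> e'0; have n0 : 0 < `|f| + 1 by rewrite ltr_wpDl.
  pose d := Num.min pi ((e' / (`|f| + 1)) `^ alpha^-1).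
  have d0 : 0 < d by rewrite lt_min pi_gt0/= powR_gt0// divr_gt0.
  pose m := 2 * sin (d / 2) ^+ 2.
  have m0 : 0 < m.
    rewrite mulr_gt0// exprn_gt0// sin_gt0_pi// divr_gt0//= ltr_pdivrMr//.
    rewrite (@le_lt_trans _ _ pi)// ?ge_min ?lexx//.
    by rewrite mulr_natr mulr2n ltrDl pi_gt0.
  exists (2 * `|f| * (2 / m) ^+ 2) => s t s01 t01.
  have dom (u : R) : 0 <= u <= 1 -> -1 <= 2 * u - 1 <= 1 by move=> ?; lra.
  pose x := acos (2 * s - 1); pose y := acos (2 * t - 1).
  have x0 : 0 <= x <= pi by rewrite acos_ge0 ?acos_lepi ?dom.
  have y0 : 0 <= y <= pi by rewrite acos_ge0 ?acos_lepi ?dom.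
  have cxy : cos x - cos y = 2 * (s - t).
    by rewrite !acosK ?in_itv/= ?dom//; ring.
  rewrite -[h s]/(f x) -[h t]/(f y).
  have r0 : 0 <= 2 * `|f| * (2 / m) ^+ 2 * (s - t) ^+ 2.
    by rewrite mulr_ge0 ?sqr_ge0// mulr_ge0 ?sqr_ge0// mulr_ge0.
  have [xyd|dxy] := ltP `|x - y| d.
    rewrite ler_wpDr//; have [->|xy] := eqVneq x y.
      by rewrite subrr normr0 ltW.
    rewrite (le_trans (le_holder_norm_dist f xy))//.
    have : `|x - y| `^ alpha <= e' / (`|f| + 1).
      have -> : e' / (`|f| + 1) = ((e' / (`|f| + 1)) `^ alpha^-1) `^ alpha.
        by rewrite -powRrM mulVf ?gt_eqF// powRr1 ?divr_ge0 ?ltW.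
      apply: ge0_ler_powR; rewrite ?nnegrE ?powR_ge0// ?ltW//.
      by apply: lt_le_trans xyd _; rewrite ge_min lexx orbT.
    rewrite ler_pdivlMr//.
    have := powR_ge0 `|x - y| alpha; have := normr_ge0 f; nra.
  rewrite ler_wpDl ?(ltW e'0)//.
  have := cos_separated d0 x0 y0 dxy; rewrite -/m cxy => mst.
  have : `|f x - f y| <= `|f| + `|f|.
    by rewrite (le_trans (ler_normB _ _))// lerD// le_holder_norm.
  have m1 : 1 <= (2 / m) ^+ 2 * (s - t) ^+ 2.
    rewrite -exprMn -real_normK ?num_real// exprn_ege1//.
    have -> : 2 / m * (s - t) = (2 * (s - t)) / m by ring.
    by rewrite normrM normfV (gtr0_norm m0) ler_pdivlMr// mul1r.
  move=> H; rewrite -[leRHS]mulrA (le_trans H)//.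
  have -> : `|f| + `|f| = 2 * `|f| by ring.
  by rewrite ler_peMr// mulr_ge0.
have [p hp] := bernstein_approx hmod e0.
have [g cg gE] := cos_poly_horner p; exists g => // x.
have [y y0 xy] := even_periodic_repr x.
have [fp fe _] := holder_evenP f; have [gp ge _] := holder_evenP g.
rewrite (xy f fp fe) (xy g gp ge) gE.
have -> : f y = h ((1 + cos y) / 2).
  rewrite /h (_ : 2 * ((1 + cos y) / 2) - 1 = cos y); last by field.
  by rewrite cosK// in_itv.
apply: hp; have := cos_max y; rewrite ler_norml => /andP[c1 c2].
by apply/andP; split; lra.
Qed.

(** The device behind every operator identity below: it suffices to compute on
    cosines. *)
Lemma cos_dense_functional (F : X -> R) (C : R) :
  (forall a f g, F (a *: f + g) = a * F f + F g) ->
  (forall f M, (forall x, `|f x| <= M) -> `|F f| <= C * M) ->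
  (forall n, F (cosX n) = 0) -> forall f, F f = 0.
Proof.
move=> Flin Fb Fcos.
have Fp g : cos_poly g -> F g = 0.
  by elim=> // a u v _ Fu _ Fv; rewrite Flin Fu Fv mulr0 addr0.
move=> f; apply/eqP; rewrite -normr_le0; apply/ler_addgt0Pr => e e0.
rewrite add0r; have C0 : 0 <= C.
  have := Fb 0 1; rewrite mulr1 => F1.
  by apply: le_trans (normr_ge0 (F 0)) (F1 _) => x; rewrite normr0.
have [g cg fg] := @cos_poly_dense f (e / (C + 1)) (ltac:(by rewrite divr_gt0// ltr_wpDl)).
have -> : F f = F (f - g).
  by rewrite [f - g]addrC -scaleN1r Flin (Fp g cg) mulr0 add0r.
rewrite (le_trans (Fb (f - g) _ fg))// mulrCA ger_pMr// ler_pdivrMr ?ltr_wpDl//.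
by rewrite mul1r lerDl.
Qed.

End CosinePolynomials.

(** * Convolution with an integrable kernel *)

Section IntegralTools.
Context {R : realType}.
Local Notation leb := (@lebesgue_measure R).
Implicit Types (K f g F : R -> R) (a b x y M e : R).

Lemma kernel_mul_integrable K g M : leb.-integrable [set: R] (EFin \o K) ->
  continuous g -> (forall x, `|g x| <= M) ->
  leb.-integrable [set: R] (EFin \o (fun y => K y * g y)).
Proof.
move=> iK cg gM.
rewrite (_ : _ \o _ = ((EFin \o K) \* (EFin \o g))%E); last first.
  by apply/funext => y /=; rewrite EFinM.
apply: integrableMl => //; first exact: measurable_realfun.continuous_measurable_fun.
exists M; split; first exact: num_real.
by move=> B MB x _ /=; rewrite (le_trans (gM x))// ltW.
Qed.

Lemma kernel_mul_bound K g M : leb.-integrable [set: R] (EFin \o K) ->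
  continuous g -> (forall x, `|g x| <= M) ->
  `|\int[leb]_y (K y * g y)| <= (\int[leb]_y `|K y|) * M.
Proof.
move=> iK cg gM; have iKg := kernel_mul_integrable iK cg gM.
apply: le_trans (le_normr_Rintegral measurableT iKg) _.
have iN := integrable_norm iK.
rewrite -RintegralZr//; apply: le_Rintegral => //.
- exact: (integrable_norm iKg).
- rewrite (_ : _ \o _ = (fun x => M%:E * (EFin \o (Num.norm \o K)) x)%E).
    exact: integrableZl.
  by apply/funext => x /=; rewrite mulrC EFinM.
- by move=> x _ /=; rewrite normrM ler_wpM2l.
Qed.

Lemma kernel_norm_ge0 K : 0 <= \int[leb]_y `|K y|.
Proof. by apply: Rintegral_ge0 => x _. Qed.

Lemma segment_integrable f a b : {within `[a, b], continuous f} ->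
  leb.-integrable `[a, b] (EFin \o f).
Proof. by apply: continuous_compact_integrable; exact: segment_compact. Qed.

Lemma continuous_segment_integrable f a b : continuous f ->
  leb.-integrable `[a, b] (EFin \o f).
Proof. by move=> cf; apply: segment_integrable; exact: continuous_subspaceT. Qed.

Lemma continuous_segment_bounded f a b : continuous f ->
  exists2 B : R, 0 <= B & forall x, a <= x <= b -> `|f x| <= B.
Proof.
move=> cf; have : compact (f @` `[a, b]).
  apply: continuous_compact; last exact: segment_compact.
  exact: continuous_subspaceT.
move=> /compact_bounded [B [_ BP]]; exists (`|B| + 1); first exact: addr_ge0.
move=> x xab; apply: (BP (`|B| + 1)); last by exists x => //=; rewrite in_itv.
by rewrite (le_lt_trans (ler_norm _))// ltrDl.
Qed.

Lemma Rintegral_derive F f a b : a < b ->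
  (forall x, a <= x <= b -> is_derive x 1 F (f x)) ->
  {within `[a, b], continuous f} ->
  \int[leb]_(x in `[a, b]) f x = F b - F a.
Proof.
move=> ab dF cf.
have cF x : a <= x <= b -> {for x, continuous F}.
  move=> xab; apply: differentiable_continuous; apply/derivable1_diffP.
  by case: (dF _ xab).
have ab' : a <= b := ltW ab.
rewrite /Rintegral (@continuous_FTC2 _ f F)//.
- split=> [x||].
  + by rewrite in_itv/= => /andP[ax xb]; case: (dF x) => //; rewrite !ltW.
  + by apply: cvg_at_right_filter; apply: cF; rewrite lexx.
  + by apply: cvg_at_left_filter; apply: cF; rewrite lexx andbT.
- move=> x; rewrite in_itv/= => /andP[ax xb]; rewrite derive1E.
  by case: (dF x) => //; rewrite !ltW.
Qed.

Lemma Rintegral_segment_bound f a b M : a <= b ->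
  {within `[a, b], continuous f} -> (forall x, a <= x <= b -> `|f x| <= M) ->
  `|\int[leb]_(x in `[a, b]) f x| <= (b - a) * M.
Proof.
move=> ab cf fM; have icf := segment_integrable cf.
apply: le_trans (le_normr_Rintegral _ icf) _ => //.
have -> : (b - a) * M = \int[leb]_(x in `[a, b]) M.
  rewrite Rintegral_cst//; have /= := @lebesgue_measure_itv R `[a, b].
  rewrite lte_fin => ->; rewrite mulrC.
  by case: ltP => //= ba; rewrite (_ : b = a) ?subrr//; apply/le_anti; rewrite ab ba.
apply: le_Rintegral => //; first exact: integrable_norm.
exact: continuous_segment_integrable (@cst_continuous _ _ M).
Qed.

Lemma primitive_gt f c : continuous f ->
  exists F, forall x, c < x -> is_derive x 1 F (f x).
Proof.
move=> cf; exists (fun x => \int[leb]_(t in `[c, x]) f t) => x cx.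
have [dF <-] : derivable (fun x => \int[leb]_(t in `[c, x]) f t) x 1 /\
    (fun x => \int[leb]_(t in `[c, x]) f t)^`()%classic x = f x.
  apply: (@continuous_FTC1_closed _ f c x (x + 1)) => //; last exact: cf.
    by rewrite ltrDl.
  exact: continuous_segment_integrable.
by rewrite derive1E; exact: derivableP.
Qed.

(** Two close points with distant values would accumulate, by compactness, at a
    point of discontinuity. *)
Lemma continuous_segment_modulus (h : R -> R) : continuous h ->
  forall e, 0 < e -> exists C, forall s t, 0 <= s <= 1 -> 0 <= t <= 1 ->
    `|h s - h t| <= e + C * (s - t) ^+ 2.
Proof.
move=> ch e e0.
have [B B0 Bh] := continuous_segment_bounded 0 1 ch.
apply: contrapT => no.
have {no} no (n : nat) : exists st : R * R, [/\ 0 <= st.1 <= 1, 0 <= st.2 <= 1 &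
    e + n%:R * (st.1 - st.2) ^+ 2 < `|h st.1 - h st.2|].
  apply: contrapT => nst; apply: no; exists n%:R => s t s01 t01.
  by rewrite leNgt; apply/negP => H; apply: nst; exists (s, t).
pose st n := sval (cid (no n)).
have stP n : [/\ 0 <= (st n).1 <= 1, 0 <= (st n).2 <= 1 &
    e + n%:R * ((st n).1 - (st n).2) ^+ 2 < `|h (st n).1 - h (st n).2|].
  exact: svalP (cid (no n)).
have FA : ((st n).1 @[n --> \oo]) [set` `[0, 1]].
  by exists 0%N => // n _; rewrite /= in_itv/=; case: (stP n).
have [p [_ clp]] := @segment_compact _ 0 1 _ _ FA.
have e20 : 0 < e / 2 by rewrite divr_gt0.
have [d d0 hd] : exists2 d, 0 < d & forall t, `|p - t| < d -> `|h p - h t| < e / 2.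
  have /cvgrPdist_lt/(_ _ e20)/nbhs_ballP[d /= d0 dP] := ch p.
  by exists d => // t pt; apply: dP; rewrite -ball_normE.
have d20 : 0 < d / 2 by rewrite divr_gt0.
pose N := (Num.bound (2 * B / (d / 2) ^+ 2)).
have NB (n : nat) : (N <= n)%N -> 2 * B < n%:R * (d / 2) ^+ 2.
  move=> Nn; rewrite -ltr_pdivrMr ?exprn_gt0//.
  apply: lt_le_trans (archi_boundP _) _; last by rewrite ler_nat.
  by rewrite divr_ge0 ?sqr_ge0// mulr_ge0.
have tail : ((st n).1 @[n --> \oo]) ((fun n => (st n).1) @` [set n | (N <= n)%N]).
  by exists N => // n Nn; exists n.
have [_ [[n /= Nn <-]]] := clp _ _ tail (nbhsx_ballx p (d / 2) d20).
rewrite -ball_normE /= => pn; have [s01 t01] := stP n; apply/negP; rewrite -leNgt.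
have [std|dst] := ltP `|(st n).1 - (st n).2| (d / 2).
  apply: (@le_trans _ _ e); last by rewrite lerDl mulr_ge0// sqr_ge0.
  have -> : h (st n).1 - h (st n).2 = (h p - h (st n).2) - (h p - h (st n).1).
    by ring.
  rewrite (le_trans (ler_normB _ _))// [leRHS]splitr lerD// ltW// hd//.
    have -> : p - (st n).2 = (p - (st n).1) + ((st n).1 - (st n).2) by ring.
    by rewrite (le_lt_trans (ler_normD _ _))// [ltRHS]splitr ltrD.
  by rewrite (lt_trans pn)// ltr_pdivrMr// ltr_pMr// ltrDl.
apply: (@le_trans _ _ (2 * B)).
  rewrite (le_trans (ler_normB _ _))// mulr_natl mulr2n.
  by rewrite lerD// Bh.
apply: ler_wpDl; first exact: ltW.
apply: le_trans (ltW (NB n Nn)) _; rewrite ler_wpM2l//.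
by rewrite -[leRHS]real_normK ?num_real// ler_pXn2r// nnegrE ltW.
Qed.

Lemma kernel_restrict_integrable K (D : set R) : measurable D ->
  leb.-integrable D (EFin \o K) -> leb.-integrable [set: R] (EFin \o (K \_ D)).
Proof.
move=> mD iK; rewrite -restrict_EFin.
exact: (proj1 (@integrable_mkcond _ _ R leb D (EFin \o K) mD) iK).
Qed.

Lemma kernel_norm_restrict K (D : set R) :
  \int[leb]_y `|(K \_ D) y| = \int[leb]_(y in D) `|K y|.
Proof.
rewrite [RHS]Rintegral_mkcond; apply: eq_Rintegral => y _; rewrite !patchE.
by case: ifPn => // _; rewrite normr0.
Qed.

Lemma kernel_norm_triangle K1 K2 : leb.-integrable [set: R] (EFin \o K1) ->
  leb.-integrable [set: R] (EFin \o K2) ->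
  \int[leb]_y `|K1 y + K2 y| <= \int[leb]_y `|K1 y| + \int[leb]_y `|K2 y|.
Proof.
move=> i1 i2; have iD : leb.-integrable [set: R] (EFin \o (fun y => K1 y + K2 y)).
  exact: integrableD i1 i2.
rewrite -RintegralD//; [|exact: integrable_norm..].
apply: le_Rintegral => //; first exact: (integrable_norm iD).
  exact: integrableD (integrable_norm i1) (integrable_norm i2).
by move=> y _; exact: ler_normD.
Qed.

Lemma kernel_tail_small K e : leb.-integrable [set: R] (EFin \o K) -> 0 < e ->
  exists2 A : R, 0 < A & \int[leb]_y `|(K \_ (~` `[- A, A])) y| <= e.
Proof.
move=> iK e0; pose f_ (n : nat) y := (`|(K \_ (~` `[- n.+1%:R, n.+1%:R])) y|)%:E.
have iN := integrable_norm iK.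
have H : (\int[leb]_y f_ n y)%E @[n --> \oo] --> 0%E.
  rewrite -[X in _ --> X](integral0 leb setT).
  apply: (@dominated_cvg _ _ _ leb setT measurableT f_ (cst 0%E)
    (fun y => (`|K y|)%:E)) => //.
  - move=> n.
    have : leb.-integrable [set: R] (EFin \o (K \_ (~` `[- n.+1%:R, n.+1%:R]))).
      apply: kernel_restrict_integrable; first exact: measurableC.
      by apply: integrableS iK => //; exact: measurableC.
    by move/integrable_norm => /integrableP[].
  - move=> y _; apply: cvg_near_cst; exists (Num.bound `|y|) => // n /= yn.
    rewrite /f_ patchE ifF ?normr0//; apply/negbTE; rewrite notin_setE /= => H.
    apply: H; rewrite in_itv/= -ler_norml.
    apply: le_trans (ltW (archi_boundP _)) _ => //.
    by rewrite ler_nat ltnW.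
  - move=> n y _; rewrite /f_ lee_fin normr_id patchE; case: ifP => // _.
    by rewrite normr0.
have /fine_cvgP[_ /cvgrPdist_le/(_ _ e0)[n _ nP]] := H.
exists n.+1%:R => //; have := nP n (leqnn n); rewrite sub0r normrN.
exact: le_trans (ler_norm _).
Qed.

(** Cut off the tail, approximate by a continuous function in [L^1] on the
    remaining segment, then uniformly by a polynomial. *)
Lemma poly_dense_integrable K e : leb.-integrable [set: R] (EFin \o K) -> 0 < e ->
  exists (A : R) (P : {poly R}), [/\ 0 < A,
    leb.-integrable [set: R] (EFin \o (horner P \_ `[- A, A])) &
    \int[leb]_y `|K y - (horner P \_ `[- A, A]) y| <= e].
Proof.
move=> iK e0; have e30 : 0 < e / 3 by rewrite divr_gt0.
have [A A0 tailA] := kernel_tail_small iK e30.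
have iKA : leb.-integrable `[- A, A] (EFin \o K) by exact: integrableS iK.
have [g [cg ig gK]] : exists g, [/\ continuous g, leb.-integrable `[- A, A] (EFin \o g) &
    \int[leb]_(y in `[- A, A]) `|K y - g y| <= e / 3].
  have fin : (leb `[(- A)%R, A] < +oo)%E.
    have /= -> := @lebesgue_measure_itv R `[- A, A].
    by case: ifP; rewrite // ltry.
  have [g_ [cg ig]] := approximation_continuous_integrable (measurable_itv _) fin iKA.
  move=> /fine_cvgP[_ /cvgrPdist_le/(_ _ e30)[n _ nP]]; exists (g_ n); split=> //.
  have := nP n (leqnn n); rewrite sub0r normrN.
  exact: le_trans (ler_norm _).
have A20 : 0 < 2 * A by rewrite mulr_gt0.
pose h t := g (- A + 2 * A * t).
have ch : continuous h.
  move=> t; apply: continuous_comp; last exact: cg.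
  apply: cvgD; first exact: cvg_cst.
  by apply: cvgM; [exact: cvg_cst|exact: cvg_id].
have d0 : 0 < e / 3 / (2 * A) by rewrite divr_gt0.
have [p hp] := bernstein_approx (continuous_segment_modulus ch) d0.
pose P := p \Po ((2 * A)^-1 *: ('X + A%:P)).
have gP y : - A <= y <= A -> `|g y - P.[y]| <= e / 3 / (2 * A).
  move=> /andP[y1 y2]; pose t := (2 * A)^-1 * (y + A).
  have -> : P.[y] = p.[t] by rewrite /P horner_comp !hornerE.
  have -> : g y = h t.
    by rewrite /h /t mulrA divff ?gt_eqF// mul1r addrC addrK.
  apply: hp; rewrite /t mulr_ge0 ?invr_ge0 ?(ltW A20)//=; last by lra.
  by rewrite ler_pdivrMl// mulr1; lra.
have cP : continuous (horner P) by move=> y; exact: continuous_horner.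
have iP : leb.-integrable `[- A, A] (EFin \o horner P).
  exact: continuous_segment_integrable.
exists A, P; split => //; first exact: kernel_restrict_integrable.
have mI : measurable (`[- A, A] : set R) by exact: measurable_itv.
have i1 : leb.-integrable [set: R] (EFin \o (K \_ (~` `[- A, A]))).
  apply: kernel_restrict_integrable; first exact: measurableC.
  by apply: integrableS iK => //; exact: measurableC.
have i2 : leb.-integrable [set: R] (EFin \o ((fun y => K y - g y) \_ `[- A, A])).
  by apply: kernel_restrict_integrable => //; exact: integrableB iKA ig.
have i3 : leb.-integrable [set: R] (EFin \o ((fun y => g y - P.[y]) \_ `[- A, A])).
  by apply: kernel_restrict_integrable => //; exact: integrableB ig iP.
have -> : (fun y => `|K y - (horner P \_ `[- A, A]) y|) =
   (fun y => `|(K \_ (~` `[- A, A])) y + (((fun y => K y - g y) \_ `[- A, A]) y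
             + ((fun y => g y - P.[y]) \_ `[- A, A]) y)|).
  apply/funext => y; rewrite !patchE in_setC; case: ifP => _ /=.
    by rewrite add0r addrA subrK.
  by rewrite subr0 !addr0.
apply: le_trans (kernel_norm_triangle i1 _) _; first exact: integrableD i2 i3.
have -> : e = e / 3 + (e / 3 + e / 3) by field.
rewrite lerD//; apply: le_trans (kernel_norm_triangle i2 i3) _.
rewrite !kernel_norm_restrict lerD//.
have cgP : continuous (fun y => `|g y - P.[y]|).
  move=> y; apply: cvg_norm; apply: cvgB; [exact: cg|exact: cP].
apply: le_trans (ler_norm _) _.
apply: le_trans (Rintegral_segment_bound _ (continuous_subspaceT cgP) _) _.
- by lra.
- by move=> y yA; rewrite normr_id; exact: gP.
- rewrite (_ : _ * _ = e / 3)//.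
  by have An0 := lt0r_neq0 A0; field.
Qed.

End IntegralTools.

Section ConvolutionOperator.
Context {R : realType} {alpha : R}.
Hypothesis ha : 0 < alpha <= 1.
Local Notation X := (holder_even alpha).
Local Notation leb := (@lebesgue_measure R).
Implicit Types (K : R -> R) (f g : X) (x y M e : R).

Let a0 : 0 < alpha. Proof. by case/andP: ha. Qed.

(** The Fourier multiplier of convolution by [K] at an integer frequency. *)
Definition symbol K (n : nat) : R := \int[leb]_y (K y * cos (n%:R * y)).

Lemma shift_continuous (f : R -> R) x : continuous f -> continuous (fun y => f (x - y)).
Proof.
move=> cf y; apply: continuous_comp; last exact: cf.
by apply: cvgB; [exact: cvg_cst|exact: cvg_id].
Qed.

Lemma convolution_integrable K f x : leb.-integrable [set: R] (EFin \o K) ->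
  leb.-integrable [set: R] (EFin \o (fun y => K y * f (x - y))).
Proof.
move=> iK; apply: (kernel_mul_integrable (M := `|f|)) => //.
  exact/shift_continuous/holder_continuous.
by move=> y; exact: le_holder_norm.
Qed.

Lemma convolution_lin K a f g x : leb.-integrable [set: R] (EFin \o K) ->
  convolution K (a *: f + g : X) x = a * convolution K f x + convolution K g x.
Proof.
move=> iK; have i1 := convolution_integrable f x iK.
have i2 := convolution_integrable g x iK.
rewrite /convolution -RintegralZl//.
have i3 : leb.-integrable [set: R] (EFin \o (fun y => a * (K y * f (x - y)))).
  exact: integrableZl i1.
rewrite -(RintegralD measurableT i3 i2); apply: eq_Rintegral => y _ /=.
by rewrite !fctE /GRing.scale/= mulrDr mulrCA.
Qed.

Lemma convolution_bound K f M x : leb.-integrable [set: R] (EFin \o K) ->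
  (forall x, `|f x| <= M) -> `|convolution K f x| <= (\int[leb]_y `|K y|) * M.
Proof.
by move=> iK fM; apply: kernel_mul_bound => //; exact/shift_continuous/holder_continuous.
Qed.

Lemma convolution_diff_bound K f M x y : leb.-integrable [set: R] (EFin \o K) ->
  (forall z, `|f (x - z) - f (y - z)| <= M) ->
  `|convolution K f x - convolution K f y| <= (\int[leb]_y `|K y|) * M.
Proof.
move=> iK fM; rewrite /convolution.
rewrite -(RintegralB measurableT (convolution_integrable f x iK)
  (convolution_integrable f y iK)).
under eq_Rintegral do rewrite -mulrBr.
apply: kernel_mul_bound => // z; apply: cvgB;
  exact/shift_continuous/holder_continuous.
Qed.

Lemma convolution_cos K n x : leb.-integrable [set: R] (EFin \o K) ->
  (\int[leb]_y (K y * sin (n%:R * y)) = 0) ->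
  convolution K (cosX ha n) x = symbol K n * cos (n%:R * x).
Proof.
move=> iK Ks.
have cn : continuous ( *%R (n%:R : R)).
  by move=> z; apply: cvgM; [exact: cvg_cst|exact: cvg_id].
have ic : leb.-integrable [set: R] (EFin \o (fun y => K y * cos (n%:R * y))).
  apply: (kernel_mul_integrable (M := 1)) => // [z|z]; last exact: cos_max.
  by apply: continuous_comp; [exact: cn|exact: continuous_cos].
have isn : leb.-integrable [set: R] (EFin \o (fun y => K y * sin (n%:R * y))).
  apply: (kernel_mul_integrable (M := 1)) => // [z|z]; last exact: sin_max.
  by apply: continuous_comp; [exact: cn|exact: continuous_sin].
have ic' : leb.-integrable [set: R]
    (EFin \o (fun y => K y * cos (n%:R * y) * cos (n%:R * x))).
  exact: (integrableZr measurableT (cos (n%:R * x)) ic).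
have is' : leb.-integrable [set: R]
    (EFin \o (fun y => K y * sin (n%:R * y) * sin (n%:R * x))).
  exact: (integrableZr measurableT (sin (n%:R * x)) isn).
rewrite /symbol /convolution -[RHS]addr0 -[X in _ + X](mul0r (sin (n%:R * x))).
rewrite -{}[X in _ + X * _]Ks -!RintegralZr// -(RintegralD measurableT ic' is').
by apply: eq_Rintegral => y _ /=; rewrite mulrBr cosB; ring.
Qed.

(** The vanishing of the sine moments makes convolution by [K] agree with
    convolution by the reflected kernel on cosines, hence everywhere. *)
Lemma convolution_even K f x : leb.-integrable [set: R] (EFin \o K) ->
  (forall n, \int[leb]_y (K y * sin (n%:R * y)) = 0) ->
  convolution K f (- x) = convolution K f x.
Proof.
move=> iK Ks; apply/eqP; rewrite -subr_eq0; apply/eqP.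
pose F (h : X) := convolution K h (- x) - convolution K h x.
apply: (@cos_dense_functional _ _ ha F (2 * \int[leb]_y `|K y|)).
- by move=> a h k; rewrite /F !convolution_lin//; ring.
- move=> h M hM; rewrite /F (le_trans (ler_normB _ _))//.
  by rewrite -mulrA mulr_natl mulr2n lerD// convolution_bound.
- by move=> n; rewrite /F !convolution_cos// mulrN cosN subrr.
Qed.

Lemma convolution_operator K : leb.-integrable [set: R] (EFin \o K) ->
  (forall n, \int[leb]_y (K y * sin (n%:R * y)) = 0) ->
  exists L : {linear X -> X}, forall f x, L f x = convolution K f x.
Proof.
move=> iK Ks; pose N := \int[leb]_y `|K y|.
have N0 : 0 <= N := kernel_norm_ge0 K.
have sub f : convolution K f \in holder_even_pred alpha.
  have [fp fe _] := holder_evenP f.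
  apply/holder_even_predP; split=> [x|x|].
  - by rewrite /convolution; apply: eq_Rintegral => y _; rewrite -(fp (x - y)) addrAC.
  - exact: convolution_even.
  exists (N * `|f|) => x y; split.
    by apply: convolution_bound => // z; exact: le_holder_norm.
  rewrite -mulrA; apply: convolution_diff_bound => // z.
  have [->|xy] := eqVneq x y.
    by rewrite subrr normr0 mulr_ge0 ?powR_ge0.
  have -> : x - y = (x - z) - (y - z) by ring.
  by apply: le_holder_norm_dist; rewrite (inj_eq (addIr _)).
pose T f : X := HolderEven (sub f).
have Tlin : linear T.
  by move=> a f g; apply: holder_eqP => x /=; exact: convolution_lin.
pose Tm := GRing.isLinear.Build R X X *:%R T Tlin.
pose L : {linear X -> X} := HB.pack T Tm.
by exists L.
Qed.

(** By parts, convolution with a polynomial on a segment only sees the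
    primitive of [f], which is Lipschitz with constant [sup |f|]. *)
Lemma poly_convolution_lipschitz (A : R) (P : {poly R}) : 0 < A ->
  exists2 C : R, 0 <= C & forall f M x y, (forall z, `|f z| <= M) ->
    `|\int[leb]_(z in `[- A, A]) (P.[z] * (f (x - z) - f (y - z)))| <=
    C * M * `|x - y|.
Proof.
move=> A0; have bd (Q : {poly R}) : exists2 B : R, 0 <= B &
    forall z : R, - A <= z <= A -> `|Q.[z]| <= B.
  by apply: continuous_segment_bounded => z; exact: continuous_horner.
have [B B0 PB] := bd P; have [D D0 PD] := bd P^`().
exists (2 * A * D + 2 * B) => [|f M x y fM].
  by rewrite addr_ge0// !mulr_ge0// ltW.
pose c := Num.min x y - A - 1.
have cx (z : R) : - A <= z <= A -> c < x - z.
  move=> /andP[_ zA]; rewrite /c ltrBlDr ltrBlDr gt_min; apply/orP; left; lra.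
have cy (z : R) : - A <= z <= A -> c < y - z.
  move=> /andP[_ zA]; rewrite /c ltrBlDr ltrBlDr gt_min; apply/orP; right; lra.
have cf : continuous f by exact: holder_continuous.
have [Phi dPhi] := primitive_gt c cf.
pose S z := Phi (x - z) - Phi (y - z).
have SM (z : R) : - A <= z <= A -> `|S z| <= M * `|x - y|.
  move=> zA; have -> : x - y = (x - z) - (y - z) by ring.
  by apply: (lipschitz_of_derive_gt dPhi) => //; [exact: cx|exact: cy].
have dS (z : R) : - A <= z <= A -> is_derive z 1 S (- (f (x - z) - f (y - z))).
  move=> zA.
  have dshift (u : R) : is_derive z 1 (fun z => u - z) (- 1).
    have -> : (fun z => u - z) = cst u - id by [].
    by apply: is_derive_eq; rewrite sub0r.
  have d1 := @is_derive1_comp _ Phi (fun z => x - z) z _ _ (dPhi _ (cx z zA)) (dshift x).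
  have d2 := @is_derive1_comp _ Phi (fun z => y - z) z _ _ (dPhi _ (cy z zA)) (dshift y).
  have := is_deriveB d1 d2.
  by rewrite !mulrN1 -opprD.
pose dF z := P^`().[z] * S z - P.[z] * (f (x - z) - f (y - z)).
have cS : {within `[- A, A], continuous S}.
  apply: continuous_in_subspaceT => z; rewrite inE/= in_itv/= => zA.
  by apply: differentiable_continuous; apply/derivable1_diffP; case: (dS _ zA).
have cP (Q : {poly R}) : continuous (horner Q) by move=> z; exact: continuous_horner.
have c1 : {within `[- A, A], continuous (fun z => P^`().[z] * S z)}.
  move=> z; apply: cvgM; last exact: cS.
  exact: (continuous_subspaceT (cP P^`())).
have c2 : continuous (fun z => P.[z] * (f (x - z) - f (y - z))).
  move=> z; apply: cvgM; first exact: cP.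
  by apply: cvgB; exact: shift_continuous.
have cdF : {within `[- A, A], continuous dF}.
  move=> z; apply: cvgB; first exact: c1.
  exact: (continuous_subspaceT c2).
have := @Rintegral_derive _ (fun z => P.[z] * S z) dF (- A) A.
move=> /(_ _ _ cdF) E.
have {}E : \int[leb]_(z in `[- A, A]) dF z = P.[A] * S A - P.[- A] * S (- A).
  apply: E => [|z zA]; first lra.
  apply: (is_derive_eq (is_deriveM (is_derive_poly P z) (dS z zA))).
  by rewrite /GRing.scale/= /dF; ring.
rewrite /dF RintegralB// in E; [|exact: segment_integrable c1|
  exact: continuous_segment_integrable c2].
set I := (X in `|X|).
have {E} -> : I = \int[leb]_(z in `[- A, A]) (P^`().[z] * S z) -
    (P.[A] * S A - P.[- A] * S (- A)).
  by rewrite -E opprB addrC subrK.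
have AA : - A <= A by lra.
have M0 : 0 <= M * `|x - y| by apply: le_trans (SM A _); rewrite ?AA ?lexx.
have bI : `|\int[leb]_(z in `[- A, A]) (P^`().[z] * S z)| <=
    (A - - A) * (D * (M * `|x - y|)).
  apply: Rintegral_segment_bound => // z zA.
  by rewrite normrM ler_pM// ?PD ?SM.
have b1 : `|P.[A] * S A| <= B * (M * `|x - y|).
  by rewrite normrM ler_pM// ?PB ?SM// AA lexx.
have b2 : `|P.[- A] * S (- A)| <= B * (M * `|x - y|).
  by rewrite normrM ler_pM// ?PB ?SM// AA lexx.
rewrite (le_trans (ler_normB _ _))//.
have -> : (2 * A * D + 2 * B) * M * `|x - y| = (A - - A) * (D * (M * `|x - y|)) +
  (B * (M * `|x - y|) + B * (M * `|x - y|)) by ring.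
by rewrite lerD// (le_trans (ler_normB _ _))// lerD.
Qed.

(** Ehrling-type inequality: approximating [K] in [L^1] by a polynomial on a
    segment, whose convolution gains smoothness, the Hoelder seminorm of [K * f]
    is controlled by a small multiple of the full norm and the uniform norm. *)
Lemma convolution_ehrling K e : leb.-integrable [set: R] (EFin \o K) -> 0 < e ->
  exists2 C : R, 0 <= C & forall f M x y, (forall z, `|f z| <= M) ->
    `|convolution K f x - convolution K f y| <=
    (e * `|f| + C * M) * `|x - y| `^ alpha.
Proof.
move=> iK e0; have [A [P [A0 iP KP]]] := poly_dense_integrable iK e0.
have [C C0 CP] := poly_convolution_lipschitz P A0.
set Q := horner P \_ `[- A, A].
rewrite -/Q in iP KP.
have N0 := kernel_norm_ge0 Q; set N := \int[leb]_y `|Q y| in N0.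
exists (C + 2 * N) => [|f M x y fM]; first by rewrite addr_ge0// mulr_ge0.
have iD : leb.-integrable [set: R] (EFin \o (fun y => K y - Q y)).
  exact: integrableB iK iP.
have split z : convolution K f z =
    convolution (fun y => K y - Q y) f z + convolution Q f z.
  rewrite /convolution -(RintegralD measurableT
    (convolution_integrable f z iD) (convolution_integrable f z iP)).
  by apply: eq_Rintegral => t _ /=; rewrite -mulrDl subrK.
rewrite !split opprD addrACA (le_trans (ler_normD _ _))// mulrDl lerD//.
  have [->|xy] := eqVneq x y.
    by rewrite !subrr normr0 !mulr_ge0 ?powR_ge0// ltW.
  apply: le_trans (_ : (\int[leb]_y `|K y - Q y|) * (`|f| * `|x - y| `^ alpha) <= _).
    apply: convolution_diff_bound => // z.
    have -> : x - y = (x - z) - (y - z) by ring.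
    by apply: le_holder_norm_dist; rewrite (inj_eq (addIr _)).
  by rewrite -mulrA ler_wpM2r// mulr_ge0 ?powR_ge0.
have -> : (C + 2 * N) * M = C * M + 2 * (N * M) by ring.
apply: (holder_of_lipschitz ha) => [z|{}x {}y]; first exact: convolution_bound.
rewrite /convolution -(RintegralB measurableT (convolution_integrable f x iP)
  (convolution_integrable f y iP)).
rewrite (_ : \int[leb]_t _ =
  \int[leb]_(z in `[- A, A]) (P.[z] * (f (x - z) - f (y - z)))); first exact: CP.
rewrite [RHS]Rintegral_mkcond; apply: eq_Rintegral => z _ /=.
by rewrite /Q !patchE; case: ifPn => _; rewrite ?mulrBr// !mul0r subrr.
Qed.

End ConvolutionOperator.

(** * Compactness of operators satisfying an Ehrling-type inequality *)

Section EhrlingCompact.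
Context {R : realType} {alpha : R}.
Hypothesis ha : 0 < alpha <= 1.
Local Notation X := (holder_even alpha).
Implicit Types (f g : X).

(** Bounded sets of Hoelder functions are totally bounded for the uniform norm:
    colour a function by its rounded values at finitely many sample points. *)
Lemma uniform_colouring (r d : R) : 0 <= r -> 0 < d ->
  exists (I : finType) (c : X -> I), forall f g, `|f| <= r -> `|g| <= r ->
    c f = c g -> forall x, `|f x - g x| <= d.
Proof.
move=> r0 d0; have [a0 _] := andP ha.
have pi0 := @pi_gt0 R.
have d30 : 0 < d / 3 by rewrite divr_gt0.
pose w := (d / 3 / (r + 1)) `^ alpha^-1.
have w0 : 0 < w by rewrite powR_gt0// divr_gt0// ltr_wpDl.
have r10 : 0 < r + 1 by rewrite ltr_wpDl.
pose N := (Num.bound (pi / w)).+1.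
have N0 : (0 : R) < N%:R by rewrite ltr0n.
have piN : pi / N%:R <= w.
  rewrite ler_pdivrMr// mulrC -ler_pdivrMr//.
  apply: le_trans (ltW (archi_boundP _)) _; first by rewrite divr_ge0 ?ltW.
  by rewrite ler_nat.
pose m := Num.bound (2 * r / (d / 3)).
pose pt (i : nat) : R := i%:R * (pi / N%:R).
pose q f (i : nat) := Num.truncn ((f (pt i) + r) / (d / 3)).
have qm f i : `|f| <= r -> 0 <= (f (pt i) + r) / (d / 3) /\ (q f i < m.+1)%N.
  move=> fr; have := le_trans (le_holder_norm f (pt i)) fr.
  rewrite ler_norml => /andP[f1 f2].
  have p0 : 0 <= (f (pt i) + r) / (d / 3) by rewrite divr_ge0// ?(ltW d30)//; lra.
  split=> //; rewrite /q ltnS -(ler_nat R).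
  have /andP[+ _] := truncn_itv p0; move/le_trans; apply.
  apply: le_trans (ltW (archi_boundP _)).
    by rewrite ler_pM2r ?invr_gt0//; lra.
  by rewrite divr_ge0 ?mulr_ge0// ltW.
exists {ffun 'I_N.+1 -> 'I_m.+1}, (fun f => [ffun i : 'I_N.+1 => inord (q f i)]).
move=> f g fr gr /ffunP cfg x.
have [y /andP[y0 ypi] xy] := even_periodic_repr x.
have [fp fe _] := holder_evenP f; have [gp ge _] := holder_evenP g.
rewrite (xy f fp fe) (xy g gp ge).
have yN0 : 0 <= y / (pi / N%:R) by rewrite divr_ge0// divr_ge0// ltW.
pose i := Num.truncn (y / (pi / N%:R)).
have /andP[i1 i2] := truncn_itv yN0.
have h0 : 0 < pi / N%:R :> R by rewrite divr_gt0.
have iN : (i < N.+1)%N.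
  rewrite ltnS -(ler_nat R) (le_trans i1)// ler_pdivrMr// mulrC divfK//.
  by rewrite gt_eqF.
have pty : `|y - pt i| <= w.
  apply: le_trans piN; rewrite ler_norml.
  rewrite ler_pdivlMr// in i1; rewrite ltr_pdivrMr// -natr1 mulrDl mul1r in i2.
  by rewrite /pt; apply/andP; split; lra.
have osc (h : X) : `|h| <= r -> `|h y - h (pt i)| <= d / 3.
  move=> hr; have [<-|ypt] := eqVneq y (pt i); first by rewrite subrr normr0 ltW.
  apply: le_trans (le_holder_norm_dist h ypt) _.
  have : `|y - pt i| `^ alpha <= d / 3 / (r + 1).
    have -> : d / 3 / (r + 1) = w `^ alpha.
      by rewrite /w -powRrM mulVf ?gt_eqF// powRr1 ?divr_ge0 ?ltW.
    by apply: ge0_ler_powR; rewrite ?nnegrE ?powR_ge0// ltW.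
  rewrite ler_pdivlMr//.
  have := powR_ge0 `|y - pt i| alpha; have := normr_ge0 h; nra.
have mid : `|f (pt i) - g (pt i)| <= d / 3.
  have := cfg (Ordinal iN); rewrite !ffunE => /(congr1 val) /=.
  have [f0 fm] := qm f i fr; have [g0 gm] := qm g i gr.
  rewrite !inordK// => qfg.
  have /andP[f1 f2] := truncn_itv f0; have /andP[g1 g2] := truncn_itv g0.
  rewrite -[Num.truncn _]/(q f i) qfg in f1 f2.
  rewrite -[Num.truncn _]/(q g i) in g1 g2.
  rewrite ler_pdivlMr// in f1; rewrite ltr_pdivrMr// -natr1 mulrDl mul1r in f2.
  rewrite ler_pdivlMr// in g1; rewrite ltr_pdivrMr// -natr1 mulrDl mul1r in g2.
  by rewrite ler_norml; apply/andP; split; lra.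
have -> : f y - g y = (f y - f (pt i)) + (f (pt i) - g (pt i)) - (g y - g (pt i)).
  by ring.
rewrite (le_trans (ler_normB _ _))//.
have := ler_normD (f y - f (pt i)) (f (pt i) - g (pt i)).
have := osc f fr; have := osc g gr; lra.
Qed.

Lemma ehrling_compact (L : {linear X -> X}) :
  (forall e : R, 0 < e -> exists2 C : R, 0 <= C & forall f M,
     (forall z, `|f z| <= M) -> `|L f| <= e * `|f| + C * M) ->
  compact_op L.
Proof.
move=> LE B [r0 [_ Br0]]; apply: totally_bounded_compact => e e0.
pose r := `|r0| + 1.
have r1 : 0 < r by rewrite ltr_wpDl.
have Br f : B f -> `|f| <= r.
  by apply: (Br0 r); rewrite (le_lt_trans (ler_norm _))// ltrDl.
have e10 : 0 < e / (4 * r) by rewrite divr_gt0// mulr_gt0.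
have [C C0 LC] := LE _ e10.
have d0 : 0 < e / (4 * (C + 1)) by rewrite divr_gt0// mulr_gt0// ltr_wpDl.
have [I [c cP]] := uniform_colouring (ltW r1) d0.
pose pre y := get [set f | B f /\ L f = y].
have preP y : (L @` B) y -> B (pre y) /\ L (pre y) = y.
  move=> [f Bf Lf]; apply: (@getPex _ [set f | B f /\ L f = y]).
  by exists f.
exists I, (c \o pre) => x y /preP[Bx Lx] /preP[By Ly] /= cxy.
rewrite -Lx -Ly -linearB.
have sm := cP _ _ (Br _ Bx) (Br _ By) cxy.
apply: le_lt_trans (LC (pre x - pre y) _ sm) _.
have nb : `|pre x - pre y| <= r + r.
  by rewrite (le_trans (ler_normB _ _))// lerD// Br.
have : e / (4 * r) * `|pre x - pre y| <= e / (4 * r) * (r + r).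
  by rewrite ler_wpM2l// ltW.
have -> : e / (4 * r) * (r + r) = e / 2 by have := lt0r_neq0 r1 => rn0; field.
have : C * (e / (4 * (C + 1))) <= e / 4.
  rewrite mulrCA ler_pM2l// ler_pdivrMr ?mulr_gt0 ?ltr_wpDl//; lra.
lra.
Qed.

End EhrlingCompact.

Section ConvolutionCompact.
Context {R : realType} {alpha : R}.
Hypothesis ha : 0 < alpha <= 1.
Local Notation X := (holder_even alpha).
Local Notation leb := (@lebesgue_measure R).
Variables (K : R -> R) (L : {linear X -> X}).
Hypothesis iK : leb.-integrable [set: R] (EFin \o K).
Hypothesis LK : forall f x, L f x = convolution K f x.

Lemma convolution_norm_ehrling (e : R) : 0 < e -> exists2 C : R, 0 <= C & forall (f : X) M,
  (forall z, `|f z| <= M) -> `|L f| <= e * `|f| + C * M.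
Proof.
move=> e0; have [C C0 CP] := convolution_ehrling ha iK e0.
have N0 := kernel_norm_ge0 K; set N := \int[leb]_y `|K y| in N0.
exists (N + C) => [|f M fM]; first exact: addr_ge0.
have -> : e * `|f| + (N + C) * M = N * M + (e * `|f| + C * M) by ring.
apply: holder_norm_le => [x|x y _]; rewrite !LK; last exact: CP.
exact: convolution_bound.
Qed.

Lemma convolution_bounded_op : bounded_op L.
Proof.
have [C C0 CP] := convolution_norm_ehrling ltr01.
exists (1 + C) => f; rewrite mulrDl; apply: CP => z; exact: le_holder_norm.
Qed.

Lemma convolution_compact_op : compact_op L.
Proof. by apply: (ehrling_compact ha); exact: convolution_norm_ehrling. Qed.

End ConvolutionCompact.

(** * Fourier cosine coefficients *)

Section FourierCoefficients.
Context {R : realType} {alpha : R}.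
Hypothesis ha : 0 < alpha <= 1.
Local Notation X := (holder_even alpha).
Local Notation leb := (@lebesgue_measure R).
Implicit Types (f g : X) (n m : nat) (M a : R).

Let a0 : 0 < alpha. Proof. by case/andP: ha. Qed.
Let pi0 : 0 < pi :> R. Proof. exact: pi_gt0. Qed.
Let Npi : - pi < pi :> R. Proof. have := pi0; lra. Qed.

Definition pairing (f : X) (psi : R -> R) : R := \int[leb]_(x in `[- pi, pi]) (f x * psi x).

Lemma pairing_continuous f (psi : R -> R) : continuous psi ->
  continuous (fun x => f x * psi x).
Proof. by move=> cpsi x; apply: cvgM; [exact: holder_continuous|exact: cpsi]. Qed.

Lemma pairing_lin a f g (psi : R -> R) : continuous psi ->
  pairing (a *: f + g) psi = a * pairing f psi + pairing g psi.
Proof.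
move=> cpsi; have i1 := continuous_segment_integrable (- pi) pi (@pairing_continuous f _ cpsi).
have i2 := continuous_segment_integrable (- pi) pi (@pairing_continuous g _ cpsi).
rewrite /pairing -RintegralZl//.
have i3 : leb.-integrable `[- pi, pi] (EFin \o (fun x => a * (f x * psi x))).
  exact: integrableZl i1.
rewrite -(RintegralD _ i3 i2)//; apply: eq_Rintegral => x _ /=.
by rewrite !fctE /GRing.scale/=; ring.
Qed.

Lemma pairingZ a f (psi : R -> R) : continuous psi ->
  pairing (a *: f) psi = a * pairing f psi.
Proof.
move=> cpsi; rewrite -[a *: f]addr0 pairing_lin// (_ : pairing 0 psi = 0) ?addr0//.
by have := pairing_lin (-1) 0 0 cpsi; rewrite scaler0 addr0 mulN1r addNr.
Qed.

Lemma pairing_bound f (psi : R -> R) M B : continuous psi ->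
  (forall x, `|f x| <= M) -> (forall x, - pi <= x <= pi -> `|psi x| <= B) ->
  `|pairing f psi| <= 2 * pi * B * M.
Proof.
move=> cpsi fM psiB.
have -> : 2 * pi * B * M = (pi - - pi) * (M * B) by ring.
apply: Rintegral_segment_bound; first exact: ltW.
  by apply: continuous_subspaceT; exact: pairing_continuous.
by move=> x xpi; rewrite normrM ler_pM// psiB.
Qed.

Definition fcoef f n : R := pairing f (fun x => cos (n%:R * x)).

Let cosn_continuous n : continuous (fun x : R => cos (n%:R * x)).
Proof.
move=> x; apply: continuous_comp; last exact: continuous_cos.
by apply: cvgM; [exact: cvg_cst|exact: cvg_id].
Qed.

Lemma fcoef_lin a f g n : fcoef (a *: f + g) n = a * fcoef f n + fcoef g n.
Proof. exact: pairing_lin. Qed.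

Lemma fcoef_bound f n M : (forall x, `|f x| <= M) -> `|fcoef f n| <= 2 * pi * M.
Proof.
move=> fM; rewrite -[X in X * M]mulr1; apply: pairing_bound => // x _.
exact: cos_max.
Qed.

Lemma fcoef0 n : fcoef 0 n = 0.
Proof.
by have := fcoef_lin (-1) 0 0 n; rewrite scaler0 addr0 mulN1r addNr.
Qed.

Lemma fcoefD f g n : fcoef (f + g) n = fcoef f n + fcoef g n.
Proof. by rewrite -[f]scale1r fcoef_lin mul1r scale1r. Qed.

Lemma fcoefZ a f n : fcoef (a *: f) n = a * fcoef f n.
Proof. exact: pairingZ. Qed.

Lemma fcoefB f g n : fcoef (f - g) n = fcoef f n - fcoef g n.
Proof. by rewrite fcoefD -scaleN1r fcoefZ mulN1r. Qed.

Lemma fcoef_sum (I : finType) (c : I -> R) (e : I -> X) n :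
  fcoef (\sum_i c i *: e i) n = \sum_i c i * fcoef (e i) n.
Proof.
rewrite (big_morph (fcoef^~ n) (fun f g => fcoefD f g n) (fcoef0 n)).
by apply: eq_bigr => i _; rewrite fcoefZ.
Qed.

Lemma sin_natmul_pi n : sin (n%:R * pi) = 0 :> R.
Proof. by rewrite mulr_natl -[pi *+ n]add0r alternatingn; [rewrite sin0 mulr0|exact: sinDpi]. Qed.

Lemma sin_natmul_derive n (x : R) :
  is_derive x 1 (fun x => sin (n%:R * x)) (n%:R * cos (n%:R * x)).
Proof.
have H : is_derive x 1 (n%:R \*: @id R) (n%:R *: 1) by exact: is_deriveZ.
have := is_derive1_comp (is_derive_sin (n%:R * x)) H.
by rewrite /GRing.scale/= mulr1 mulrC.
Qed.

(** Orthogonality: [n cos(mx) sin(nx) - m sin(mx) cos(nx)] is a primitive of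
    [(n^2 - m^2) cos(mx) cos(nx)] that vanishes at both ends. *)
Lemma fcoef_cos_neq m n : m != n -> fcoef (cosX ha m) n = 0.
Proof.
move=> mn; pose F (x : R) := n%:R * (cos (m%:R * x) * sin (n%:R * x)) -
  m%:R * (sin (m%:R * x) * cos (n%:R * x)).
pose f (x : R) : R := (n%:R ^+ 2 - m%:R ^+ 2) * (cos (m%:R * x) * cos (n%:R * x)).
have ccc : continuous (fun x : R => cos (m%:R * x) * cos (n%:R * x)).
  by move=> x; apply: cvgM; exact: cosn_continuous.
have cf : continuous f.
  by move=> x; apply: cvgM; [exact: cvg_cst|exact: ccc].
have dF (x : R) : is_derive x 1 F (f x : R).
  have d1 := is_deriveM (cos_natmul_derive m x) (sin_natmul_derive n x).
  have d2 := is_deriveM (sin_natmul_derive m x) (cos_natmul_derive n x).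
  apply: (is_derive_eq (is_deriveB (is_deriveZ n%:R d1) (is_deriveZ m%:R d2))).
  by rewrite /GRing.scale/= /f; ring.
have := @Rintegral_derive _ F f (- pi) pi Npi (fun x _ => dF x)
  (continuous_subspaceT cf).
rewrite /F !mulrN !sinN !sin_natmul_pi oppr0 !(mulr0, mul0r) subr0 subr0.
rewrite /f RintegralZl//; last exact: continuous_segment_integrable.
move/eqP; rewrite mulf_eq0 => /orP[|/eqP//].
rewrite subr_sqr mulf_eq0 subr_eq0 -natrD eqr_nat pnatr_eq0 addn_eq0.
by move=> /orP[/eqP nm|/andP[/eqP n0 /eqP m0]]; move: mn; rewrite ?nm ?n0 ?m0 eqxx.
Qed.

(** Where [f] is nonzero, [f^2] is bounded below on an interval of length [w],
    taken to the left of a point of [[0, pi]] so as to stay in [[-pi, pi]]. *)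
Lemma sqr_integral_eq0 f : pairing f f = 0 -> f = 0.
Proof.
move=> f0; apply: holder_eqP => x /=; apply/eqP; apply: contraT => fx0.
have [y /andP[y0 ypi] xy] := even_periodic_repr x.
have [fp fe _] := holder_evenP f; rewrite (xy f fp fe) in fx0.
have cf : continuous f by exact: holder_continuous.
pose c := f y ^+ 2 / 2.
have fy0 : 0 < f y ^+ 2 by rewrite exprn_even_gt0.
have c0 : 0 < c by rewrite divr_gt0.
have cff : continuous (fun x => f x * f x) := @pairing_continuous f _ cf.
have [d /= d0 dP] : exists2 d : R, 0 < d & forall t, `|y - t| < d -> c <= f t * f t.
  have /cvgrPdist_lt/(_ _ c0)/nbhs_ballP[d /= d0 dP] := cff y.
  exists d => // t yt; have := dP t; rewrite -ball_normE /= => /(_ yt).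
  rewrite ltr_norml => /andP[_]; rewrite /c expr2; lra.
pose w := Num.min (d / 2) pi.
have w0 : 0 < w by rewrite lt_min pi0 divr_gt0.
have wpi : w <= pi by rewrite ge_min lexx orbT.
have wd : w <= d / 2 by rewrite ge_min lexx.
pose J : set R := [set` `[y - w, y]].
have Jsub : J `<=` `[- pi, pi].
  by move=> t; rewrite /J /= !in_itv/= => /andP[t1 t2]; apply/andP; split; lra.
have mJ : measurable J by exact: measurable_itv.
have iJ : leb.-integrable `[- pi, pi] (EFin \o (cst c \_ J)).
  rewrite -restrict_EFin; apply/integrable_restrict => //.
  apply: integrableS (_ : leb.-integrable `[- pi, pi] _) => //.
    exact: measurableI.
  exact: continuous_segment_integrable (@cst_continuous _ _ c).
have : \int[leb]_(t in `[- pi, pi]) (cst c \_ J) t <= pairing f f.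
  apply: le_Rintegral => //; first exact: continuous_segment_integrable.
  move=> t _; rewrite patchE; case: ifPn => [|_]; last exact: sqr_ge0.
  rewrite inE /J /= in_itv/= => /andP[t1 t2]; apply: dP.
  by rewrite ger0_norm; lra.
rewrite f0 -Rintegral_mkcondr (setIidr Jsub) Rintegral_cst//.
have /= -> := @lebesgue_measure_itv R `[y - w, y].
rewrite lte_fin ifT; last by lra.
rewrite /=; nra.
Qed.

(** Uniqueness theorem for cosine series: the functional [g |-> int f g] is
    continuous for the uniform norm, so it vanishes, in particular at [f]. *)
Lemma fcoef_unique f : (forall n, fcoef f n = 0) -> f = 0.
Proof.
move=> fn; apply: sqr_integral_eq0.
have cf : continuous f by exact: holder_continuous.
pose F g := pairing g f.
apply: (@cos_dense_functional _ _ ha F (2 * pi * `|f|)).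
- by move=> a g h; exact: pairing_lin.
- by move=> g M gM; apply: pairing_bound => // x _; exact: le_holder_norm.
- by move=> n; rewrite -[RHS](fn n) /F /fcoef /pairing;
    apply: eq_Rintegral => x _; rewrite mulrC.
Qed.

Lemma fcoef_inj f g : (forall n, fcoef f n = fcoef g n) -> f = g.
Proof.
move=> fg; apply/eqP; rewrite -subr_eq0; apply/eqP/fcoef_unique => n.
by rewrite fcoefB fg subrr.
Qed.

Lemma fcoef_cos_neq0 n : fcoef (cosX ha n) n != 0.
Proof.
apply/eqP => /sqr_integral_eq0 c0.
have /= : cosX ha n 0 = 0 by rewrite c0.
by rewrite mulr0 cos0 => /eqP; rewrite oner_eq0.
Qed.

Definition coef_null (S : set nat) : set X := [set f | forall n, S n -> fcoef f n = 0].

Lemma coef_null_closed_subspace (S : set nat) : closed_subspace (coef_null S).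
Proof.
split=> [f clf n Sn|n _|a f g f0 g0 n Sn]; first 1 last.
- exact: fcoef0.
- by rewrite fcoef_lin f0 ?g0// mulr0 addr0.
apply/eqP; rewrite -normr_le0; apply/ler_addgt0Pr => e e0; rewrite add0r.
have p20 : 0 < 2 * pi :> R by rewrite mulr_gt0.
have e10 : 0 < e / (2 * pi) by rewrite divr_gt0.
have [g [/(_ n Sn) g0]] := clf _ (nbhsx_ballx f _ e10).
rewrite -ball_normE /= => fg.
rewrite -[fcoef f n]subr0 -g0 -fcoefB.
apply: le_trans (fcoef_bound n (le_holder_norm (f - g))) _.
by rewrite -ler_pdivlMl// mulrC ltW.
Qed.

End FourierCoefficients.

(** * Convolution operators are diagonal, hence Fredholm of index zero *)

Section FredholmConvolution.
Context {R : realType} {alpha : R}.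
Hypothesis ha : 0 < alpha <= 1.
Local Notation X := (holder_even alpha).
Local Notation leb := (@lebesgue_measure R).
Local Notation cosX := (cosX ha).
Variables (K : R -> R) (L : {linear X -> X}).
Hypothesis iK : leb.-integrable [set: R] (EFin \o K).
Hypothesis Ks : forall n : nat, \int[leb]_y (K y * sin (n%:R * y)) = 0.
Hypothesis LK : forall f x, L f x = convolution K f x.
Implicit Types (f g : X) (n : nat).

Lemma convolution_op_cos n : L (cosX n) = symbol K n *: cosX n.
Proof. by apply: holder_eqP => x; rewrite LK convolution_cos. Qed.

Lemma fcoef_convolution f n : fcoef (L f) n = symbol K n * fcoef f n.
Proof.
apply/eqP; rewrite -subr_eq0; apply/eqP.
pose F g := fcoef (L g) n - symbol K n * fcoef g n.
pose N := \int[leb]_y `|K y|.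
apply: (@cos_dense_functional _ _ ha F (2 * pi * (N + `|symbol K n|))).
- by move=> a g h; rewrite /F linearP !fcoef_lin//; ring.
- move=> g M gM; rewrite /F (le_trans (ler_normB _ _))//.
  have -> : 2 * pi * (N + `|symbol K n|) * M =
    2 * pi * (N * M) + `|symbol K n| * (2 * pi * M) by ring.
  rewrite lerD//; last by rewrite normrM ler_wpM2l// fcoef_bound.
  by apply: fcoef_bound => // x; rewrite LK; exact: convolution_bound.
- move=> m; rewrite /F convolution_op_cos fcoefZ//.
  have [->|mn] := eqVneq m n; first by rewrite subrr.
  by rewrite fcoef_cos_neq// !mulr0 subrr.
Qed.

(** If [cos(nx)] is an eigenvector for [mu > 0], the Ehrling inequality bounds
    its Hoelder norm, which grows like a power of [n]. *)
Lemma resonances_finite (mu : R) : 0 < mu ->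
  exists N : nat, forall n, symbol K n = mu -> (n < N)%N.
Proof.
move=> mu0; have [a0 _] := andP ha.
have h0 : 0 < mu / 2 by rewrite divr_gt0.
have [C C0 CP] := convolution_norm_ehrling ha iK LK h0.
pose B := C / (mu / 2) + 1; have B0 : 0 < B by rewrite ltr_wpDl// divr_ge0// ltW.
exists (Num.bound (pi * B `^ alpha^-1)).+1 => n Kn.
have cB : `|cosX n| <= B.
  have := CP (cosX n) 1 (fun z => cos_max _).
  rewrite convolution_op_cos Kn normrZ gtr0_norm// mulr1 => H.
  have : mu / 2 * `|cosX n| <= C by lra.
  by rewrite mulrC -ler_pdivlMr// /B => H'; lra.
rewrite ltnS -(ler_nat R); have [->|n0] := eqVneq n 0%N; first by [].
have nR : 0 < n%:R :> R by rewrite ltr0n lt0n.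
have pn0 : 0 < pi / n%:R :> R by rewrite divr_gt0// pi_gt0.
have : `|cosX n 0 - cosX n (pi / n%:R)| <= B * (pi / n%:R) `^ alpha.
  apply: le_trans (le_holder_norm_dist (cosX n) _) _.
    by rewrite eq_sym gt_eqF.
  by rewrite sub0r normrN (gtr0_norm pn0) ler_wpM2r// powR_ge0.
rewrite /= mulr0 cos0 mulrCA divff ?gt_eqF// mulr1 cospi opprK.
rewrite (@ger0_norm _ (1 + 1))// => H.
have {}H : 1 <= B * (pi / n%:R) `^ alpha by lra.
have Bpi : n%:R <= pi * B `^ alpha^-1.
  rewrite leNgt; apply/negP => nB.
  have {}nB : pi / n%:R < (B `^ alpha^-1)^-1.
    by rewrite ltr_pdivrMr// ltr_pdivlMl ?powR_gt0// mulrC.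
  have : (pi / n%:R) `^ alpha < B^-1.
    have -> : B^-1 = ((B `^ alpha^-1)^-1) `^ alpha.
      apply: (mulfI (lt0r_neq0 B0)); rewrite divff ?gt_eqF//.
      rewrite -[X in _ = X * _](_ : (B `^ alpha^-1) `^ alpha = B); last first.
        by rewrite -powRrM mulVf ?gt_eqF// powRr1// ltW.
      rewrite -powRM ?invr_ge0 ?powR_ge0// divff ?powR1//.
      by rewrite gt_eqF// powR_gt0.
    by apply: gt0_ltr_powR => //; rewrite nnegrE ?invr_ge0 ?powR_ge0// ltW.
  by rewrite -(ltr_pM2l B0) divff ?gt_eqF// ltNge H.
by rewrite (le_trans Bpi)// ltW// archi_boundP// mulr_ge0 ?powR_ge0// pi_ge0.
Qed.

(** The resonant cosines span the kernel. The functions without resonant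
    coefficients form the range, by Riesz' theorem on that invariant subspace,
    and subtracting the resonant part of the cosine series shows that the same
    cosines span a complement. *)
Lemma convolution_fredholm (mu : R) (T : {linear X -> X}) : 0 < mu ->
  (forall f, T f = mu *: f - L f) -> fredholm_index T 0.
Proof.
move=> mu0 TE; have [N NP] := resonances_finite mu0.
have Lb := convolution_bounded_op ha iK LK.
have Lc := convolution_compact_op ha iK LK.
pose s := [seq n <- iota 0 N | symbol K n == mu].
have sP n : (n \in s) = (symbol K n == mu).
  rewrite mem_filter mem_iota add0n /=; case: eqP => //= Kn; exact: NP.
have us : uniq s by rewrite filter_uniq// iota_uniq.
pose d := size s; pose r (i : 'I_d) := nth 0%N s i.
have rs i : r i \in s by rewrite mem_nth.
have r_inj i j : (r i == r j) = (i == j) by rewrite nth_uniq.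
pose e (i : 'I_d) := cosX (r i).
have coef_e (c : 'I_d -> R) j :
    fcoef (\sum_i c i *: e i) (r j) = c j * fcoef (cosX (r j)) (r j).
  rewrite fcoef_sum// (bigD1 j)//= big1 ?addr0// => i ij.
  by rewrite fcoef_cos_neq ?mulr0// r_inj.
have coef_e0 (c : 'I_d -> R) n : n \notin s -> fcoef (\sum_i c i *: e i) n = 0.
  move=> ns; rewrite fcoef_sum// big1// => i _; rewrite fcoef_cos_neq ?mulr0//.
  by apply: contraNneq ns => <-.
have s_r n : n \in s -> exists i, r i = n.
  move=> ns; have ind : (index n s < d)%N by rewrite index_mem.
  by exists (Ordinal ind); rewrite /r /= nth_index.
pose Z := [set n | n \in s]; pose Y : set X := coef_null Z.
have Ys : closed_subspace Y by exact: coef_null_closed_subspace.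
have coefT f n : fcoef (T f) n = (mu - symbol K n) * fcoef f n.
  by rewrite TE fcoefB// fcoefZ// fcoef_convolution mulrBl.
have TY f : Y (T f).
  move=> n ns; have : n \in s := ns.
  by rewrite sP coefT => /eqP ->; rewrite subrr mul0r.
have indep (c : 'I_d -> R) : Y (\sum_(i < d) c i *: e i) -> forall i, c i = 0.
  move=> Yc i; have := Yc _ (rs i); rewrite coef_e => /eqP.
  by rewrite mulf_eq0 (negbTE (fcoef_cos_neq0 ha _)) orbF => /eqP.
have indep0 (c : 'I_d -> R) : \sum_(i < d) c i *: e i = 0 -> forall i, c i = 0.
  by move=> c0; apply: indep; rewrite c0; have [] := Ys.
pose proj f := \sum_(i < d) (fcoef f (r i) / fcoef (cosX (r i)) (r i)) *: e i.
have projY f : Y (f - proj f).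
  move=> n /s_r[j <-]; rewrite fcoefB// coef_e divfK ?subrr//.
  exact: fcoef_cos_neq0.
have dimker : has_dim [set v | T v = 0] d.
  exists e; split=> //; apply/seteqP; split=> [v /= Tv0|_ [c ->] /=].
    exists (fun i => fcoef v (r i) / fcoef (cosX (r i)) (r i)).
    apply/eqP; rewrite -subr_eq0; apply/eqP/(fcoef_unique ha) => n.
    have [ns|ns] := boolP (n \in s); first exact: projY.
    rewrite fcoefB// coef_e0// subr0; apply/eqP.
    have := coefT v n; rewrite Tv0 fcoef0// => /esym/eqP; rewrite mulf_eq0.
    by rewrite subr_eq0 eq_sym -sP (negbTE ns).
  rewrite linear_sum big1// => i _; rewrite linearZ /= TE convolution_op_cos.
  by have := rs i; rewrite sP => /eqP ->; rewrite subrr scaler0.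
have Yinj v : Y v -> mu *: v - L v = 0 -> v = 0.
  move=> Yv; rewrite -TE => Tv0; apply: (fcoef_unique ha) => n.
  have [ns|ns] := boolP (n \in s); first exact: Yv.
  have := coefT v n; rewrite Tv0 fcoef0// => /esym/eqP; rewrite mulf_eq0.
  by rewrite subr_eq0 eq_sym -sP (negbTE ns) => /eqP.
have rangeT : range T = Y.
  apply/seteqP; split=> [_ [f _ <-]//|g Yg].
  have TY' v : Y v -> Y (mu *: v - L v) by rewrite -TE.
  have [f _ fg] := riesz_surjective Lb Lc mu0 Ys TY' Yinj Yg.
  by exists f => //; rewrite TE.
split.
- have [C LC] := Lb; exists (mu + C) => f; rewrite TE mulrDl.
  by rewrite (le_trans (ler_normB _ _))// lerD// normrZ gtr0_norm.
- by rewrite rangeT; have [] := Ys.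
exists d, d; split=> //; last by rewrite subrr.
exists [set v | exists c : 'I_d -> R, v = \sum_(i < d) c i *: e i]; split.
- by exists e.
- move=> v; exists (v - proj v), (proj v); split; first by rewrite rangeT.
    by exists (fun i => fcoef v (r i) / fcoef (cosX (r i)) (r i)).
  by rewrite subrK.
apply/seteqP; split=> [v [+ [c vc]]|_ ->].
  by rewrite rangeT vc /= => /indep c0; rewrite big1// => i _; rewrite c0 scale0r.
split; first by exists 0 => //; rewrite linear0.
by exists (fun=> 0); rewrite big1// => i _; rewrite scale0r.
Qed.

End FredholmConvolution.

(** * Analyticity of maps affine-quadratic in the vector variable *)

Section PolynomialSeries.
Context {R : realType} {V W : normedModType R}.
Implicit Types (k : nat) (r s a : R).

Definition scalar_prod k (P : pred 'I_k) (v : 'I_k -> V * R) : R :=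
  \prod_(l | P l) (v l).2.

Lemma scalar_prod_in k (P : pred 'I_k) (v : 'I_k -> V * R) i (x : V * R) : P i ->
  scalar_prod P [eta v with i |-> x] = x.2 * \prod_(l | P l && (l != i)) (v l).2.
Proof.
move=> Pi; rewrite /scalar_prod (bigD1 i)//= eqxx; congr (_ * _).
by apply: eq_bigr => l /andP[_ /negbTE ->].
Qed.

Lemma scalar_prod_out k (P : pred 'I_k) (v : 'I_k -> V * R) i (x : V * R) : ~~ P i ->
  scalar_prod P [eta v with i |-> x] = scalar_prod P v.
Proof.
move=> Pi; apply: eq_bigr => l Pl /=; case: eqP => // li.
by rewrite -li Pl in Pi.
Qed.

Lemma scalar_prod_bound k (P : pred 'I_k) (v : 'I_k -> V * R) :
  `|scalar_prod P v| <= \prod_(l | P l) `|v l|.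
Proof.
rewrite normr_prod; apply: ler_prod => l _; rewrite normr_ge0/=.
by rewrite prod_normE le_max lexx orbT.
Qed.

Lemma multilinear_scalar k (P : pred 'I_k) (c : W) : (forall i, P i) ->
  multilinear (fun v : 'I_k -> V * R => scalar_prod P v *: c).
Proof.
move=> PT v i a x y; rewrite !scalar_prod_in//=.
by rewrite scalerA -scalerDl; congr (_ *: _); rewrite mulrDl mulrA.
Qed.

Lemma multilinear_linear k (i0 : 'I_k) (A : V -> W) :
  (forall a u v, A (a *: u + v) = a *: A u + A v) ->
  multilinear (fun v : 'I_k -> V * R =>
    scalar_prod (predC1 i0) v *: A (v i0).1).
Proof.
move=> Alin v i a x y; have [->|ii0] := eqVneq i i0.
  rewrite !scalar_prod_out ?inE ?eqxx//= eqxx /= Alin scalerDr !scalerA.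
  by rewrite (mulrC a).
have Pi : predC1 i0 i by rewrite /= ii0.
rewrite !scalar_prod_in//= eq_sym (negbTE ii0).
by rewrite scalerA -scalerDl; congr (_ *: _); rewrite mulrDl mulrA.
Qed.

Lemma multilinear_bilinear k (i0 j0 : 'I_k) (B : V -> V -> W) : i0 != j0 ->
  (forall a u v w, B (a *: u + v) w = a *: B u w + B v w) ->
  (forall a u v w, B w (a *: u + v) = a *: B w u + B w v) ->
  multilinear (fun v : 'I_k -> V * R =>
    scalar_prod (predC (pred2 i0 j0)) v *: B (v i0).1 (v j0).1).
Proof.
move=> ij Bl Br v i a x y; have [->|ii0] := eqVneq i i0.
  rewrite !scalar_prod_out ?inE ?eqxx//= eqxx eq_sym (negbTE ij) /= Bl scalerDr.
  by rewrite !scalerA (mulrC a).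
have [->|ij0] := eqVneq i j0.
  rewrite !scalar_prod_out ?inE ?eqxx ?orbT//= eqxx (negbTE ij) /= Br scalerDr.
  by rewrite !scalerA (mulrC a).
have Pi : predC (pred2 i0 j0) i by rewrite /= negb_or ii0 ij0.
rewrite !scalar_prod_in//= eq_sym (negbTE ii0) eq_sym (negbTE ij0).
by rewrite scalerA -scalerDl; congr (_ *: _); rewrite mulrDl mulrA.
Qed.

Lemma multilinearD k (m1 m2 : ('I_k -> V * R) -> W) :
  multilinear m1 -> multilinear m2 -> multilinear (fun v => m1 v + m2 v).
Proof. by move=> H1 H2 v i a x y; rewrite H1 H2 scalerDr addrACA. Qed.

Lemma multilinearZ k b (m1 : ('I_k -> V * R) -> W) :
  multilinear m1 -> multilinear (fun v => b *: m1 v).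
Proof. by move=> H1 v i a x y; rewrite H1 scalerDr !scalerA (mulrC a). Qed.

Lemma multilinear_sum k (I : finType) (P : pred I) (m1 : I -> ('I_k -> V * R) -> W) :
  (forall j, P j -> multilinear (m1 j)) ->
  multilinear (fun v => \sum_(j | P j) m1 j v).
Proof.
move=> H1 v i a x y; rewrite scaler_sumr -big_split /=.
by apply: eq_bigr => j Pj; rewrite H1.
Qed.

Variables (c : nat -> W) (A : nat -> V -> W) (B : nat -> V -> V -> W).

(** The symmetric [k]-linear form whose diagonal is
    [s^k c_k + s^(k-1) A_(k-1) h + s^(k-2) B_(k-2) (h, h)]: average over the
    arguments whose vector components are fed to [A] or [B]. For [k < 2] the
    predecessors are truncated, but the corresponding sums are empty. *)
Definition quadratic_form k (v : 'I_k -> V * R) : W :=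
  scalar_prod predT v *: c k +
  (k%:R^-1 *: \sum_i scalar_prod (predC1 i) v *: A k.-1 (v i).1 +
   (k%:R * k.-1%:R)^-1 *: \sum_(ij : 'I_k * 'I_k | ij.1 != ij.2)
      scalar_prod (predC (pred2 ij.1 ij.2)) v *: B k.-2 (v ij.1).1 (v ij.2).1).

Hypothesis A_lin : forall k a u v, A k (a *: u + v) = a *: A k u + A k v.
Hypothesis B_linl : forall k a u v w, B k (a *: u + v) w = a *: B k u w + B k v w.
Hypothesis B_linr : forall k a u v w, B k w (a *: u + v) = a *: B k w u + B k w v.

Lemma quadratic_form_multilinear k : multilinear (@quadratic_form k).
Proof.
apply: multilinearD; first exact: multilinear_scalar.
apply: multilinearD; apply: multilinearZ; apply: multilinear_sum => i.
  by move=> _; apply: multilinear_linear; exact: A_lin.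
by move=> ij; exact: multilinear_bilinear.
Qed.

Lemma quadratic_form_symmetric k : symmetric_map (@quadratic_form k).
Proof.
move=> p v; rewrite /quadratic_form.
have pinj : injective p by exact: perm_inj.
congr (_ + (_ + _)).
- by congr (_ *: _); rewrite /scalar_prod [RHS](reindex_inj pinj).
- congr (_ *: _); rewrite [RHS](reindex_inj pinj); apply: eq_bigr => i _ /=.
  congr (_ *: _); rewrite /scalar_prod [RHS](reindex_inj pinj).
  by apply: eq_bigl => l /=; rewrite (inj_eq pinj).
- have p2inj : injective (fun ij : 'I_k * 'I_k => (p ij.1, p ij.2)).
    by move=> [i j] [i' j'] [/pinj -> /pinj ->].
  congr (_ *: _); rewrite [RHS](reindex_inj p2inj).
  apply: eq_big => [ij|ij _] /=; first by rewrite (inj_eq pinj).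
  congr (_ *: _); rewrite /scalar_prod [RHS](reindex_inj pinj).
  by apply: eq_bigl => l /=; rewrite !(inj_eq pinj).
Qed.

Variables (r D : R).
Hypotheses (r0 : 0 < r) (D0 : 0 <= D).
Hypothesis c_bound : forall k, r ^+ k * `|c k| <= D.
Hypothesis A_bound : forall k u, r ^+ k * `|A k u| <= D * `|u|.
Hypothesis B_bound : forall k u v, r ^+ k * `|B k u v| <= D * `|u| * `|v|.

Lemma card_offdiag k : #|[pred ij : 'I_k * 'I_k | ij.1 != ij.2]| = (k * k.-1)%N.
Proof.
rewrite -sum1_card (eq_bigl (fun ij : 'I_k * 'I_k => predT ij.1 && (ij.1 != ij.2)))//.
rewrite -(pair_big_dep predT (fun i j : 'I_k => i != j) (fun _ _ => 1%N))/=.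
under eq_bigr => i _.
  rewrite sum1_card (_ : #|_| = k.-1); last first.
    rewrite -[k in RHS]card_ord -(cardC1 i); apply: eq_card => j.
    by rewrite !inE eq_sym.
  over.
by rewrite sum_nat_const card_ord.
Qed.

Lemma quadratic_form_bound k (v : 'I_k -> V * R) :
  r ^+ k * `|quadratic_form v| <= D * (1 + r + r ^+ 2) * \prod_(i < k) `|v i|.
Proof.
set Pi := \prod_(i < k) `|v i|.
have Pi0 : 0 <= Pi by apply: prodr_ge0.
have rk0 n : 0 <= r ^+ n by rewrite exprn_ge0// ltW.
have v1 i : `|(v i).1| <= `|v i| by rewrite prod_normE le_max lexx.
have bc : r ^+ k * `|scalar_prod predT v *: c k| <= D * Pi.
  rewrite normrZ mulrCA [D * _]mulrC ler_pM ?mulr_ge0//.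
  exact: scalar_prod_bound.
have bA : r ^+ k * `|k%:R^-1 *: \sum_i scalar_prod (predC1 i) v *: A k.-1 (v i).1|
    <= D * r * Pi.
  case: k v @Pi Pi0 v1 {bc} => [|k] v Pi Pi0 v1.
    by rewrite big_ord0 scaler0 normr0 mulr0 !mulr_ge0// ltW.
  rewrite normrZ ger0_norm ?invr_ge0// mulrCA ler_pdivrMl ?ltr0n//.
  have -> : k.+1%:R * (D * r * Pi) = \sum_(i < k.+1) D * r * Pi.
    by rewrite sumr_const card_ord mulr_natl.
  apply: le_trans (_ : \sum_(i < k.+1) r ^+ k.+1 *
    `|scalar_prod (predC1 i) v *: A k (v i).1| <= _).
    by rewrite -mulr_sumr ler_wpM2l// ler_norm_sum.
  apply: ler_sum => i _; rewrite normrZ exprS.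
  have -> : r * r ^+ k * (`|scalar_prod (predC1 i) v| * `|A k (v i).1|) =
    r * (`|scalar_prod (predC1 i) v| * (r ^+ k * `|A k (v i).1|)) by ring.
  have -> : D * r * Pi = r * (\prod_(l | l != i) `|v l| * (D * `|v i|)).
    by rewrite /Pi (bigD1 i)//=; ring.
  rewrite ler_wpM2l ?(ltW r0)// ler_pM ?mulr_ge0//.
    exact: scalar_prod_bound.
  by apply: le_trans (A_bound _ _) _; rewrite ler_wpM2l.
have bB : r ^+ k * `|(k%:R * k.-1%:R)^-1 *: \sum_(ij : 'I_k * 'I_k | ij.1 != ij.2)
      scalar_prod (predC (pred2 ij.1 ij.2)) v *: B k.-2 (v ij.1).1 (v ij.2).1|
    <= D * r ^+ 2 * Pi.
  case: k v @Pi Pi0 v1 {bc bA} => [|[|k]] v Pi Pi0 v1.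
  - by rewrite mul0r invr0 scale0r normr0 mulr0 mulr_ge0// mulr_ge0// sqr_ge0.
  - by rewrite mulr0 invr0 scale0r normr0 mulr0 mulr_ge0// mulr_ge0// sqr_ge0.
  rewrite normrZ ger0_norm ?invr_ge0 ?mulr_ge0// mulrCA.
  rewrite ler_pdivrMl ?mulr_gt0 ?ltr0n//.
  have -> : k.+2%:R * k.+1%:R * (D * r ^+ 2 * Pi) =
      \sum_(ij : 'I_k.+2 * 'I_k.+2 | ij.1 != ij.2) D * r ^+ 2 * Pi.
    by rewrite sumr_const card_offdiag -natrM mulr_natl.
  apply: le_trans (_ : \sum_(ij : 'I_k.+2 * 'I_k.+2 | ij.1 != ij.2) r ^+ k.+2 *
    `|scalar_prod (predC (pred2 ij.1 ij.2)) v *: B k (v ij.1).1 (v ij.2).1| <= _).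
    by rewrite -mulr_sumr ler_wpM2l// ler_norm_sum.
  have er : r ^+ k.+2 = r ^+ k * r ^+ 2 by rewrite -exprD addn2.
  apply: ler_sum => -[i j] /= ij; rewrite normrZ er.
  set sp := scalar_prod _ v.
  have -> : r ^+ k * r ^+ 2 * (`|sp| * `|B k (v i).1 (v j).1|) =
    r ^+ 2 * (`|sp| * (r ^+ k * `|B k (v i).1 (v j).1|)) by ring.
  have -> : D * r ^+ 2 * Pi =
      r ^+ 2 * (\prod_(l | predC (pred2 i j) l) `|v l| * (D * `|v i| * `|v j|)).
    rewrite /Pi (bigD1 i)//= (bigD1 j) 1?eq_sym//=.
    rewrite (eq_bigl (predC (pred2 i j))); first by ring.
    by move=> l; rewrite /= negb_or.
  rewrite ler_wpM2l ?exprn_ge0 ?(ltW r0)// ler_pM ?mulr_ge0//.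
    exact: scalar_prod_bound.
  apply: le_trans (B_bound _ _ _) _.
  by rewrite -!mulrA ler_wpM2l// ler_pM.
have tri (x y z : W) : `|x + (y + z)| <= `|x| + (`|y| + `|z|).
  by rewrite (le_trans (ler_normD _ _))// lerD2l ler_normD.
apply: le_trans (ler_wpM2l (rk0 k) (tri _ _ _)) _.
have -> : D * (1 + r + r ^+ 2) * Pi = D * Pi + (D * r * Pi + D * r ^+ 2 * Pi) by ring.
by rewrite !mulrDr !lerD.
Qed.

Lemma scalar_prod_diag k (P : pred 'I_k) (h : V) s :
  scalar_prod P (fun=> (h, s)) = s ^+ #|P|.
Proof. by rewrite -prodr_const; apply: eq_bigl. Qed.

Lemma card_predC2 k (i j : 'I_k.+2) : i != j -> #|predC (pred2 i j)| = k.
Proof.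
move=> ij; have := cardC (pred2 i j); rewrite card2 ij card_ord => /eqP.
by rewrite !addSn add0n !eqSS => /eqP.
Qed.

Lemma quadratic_form_diag k h s : quadratic_form (fun _ : 'I_k => (h, s)) =
  s ^+ k *: c k +
  ((if k is k'.+1 then s ^+ k' *: A k' h else 0) +
   (if k is k'.+2 then s ^+ k' *: B k' h h else 0)).
Proof.
rewrite /quadratic_form; congr (_ + (_ + _)).
- by rewrite scalar_prod_diag card_ord.
- case: k => [|k]; first by rewrite big_ord0 scaler0.
  under eq_bigr => i _ do rewrite scalar_prod_diag cardC1 card_ord /=.
  by rewrite sumr_const card_ord -[_ *: _ *+ _]scaler_nat !scalerA mulKf// pnatr_eq0.
- case: k => [|[|k]]; [by rewrite mul0r invr0 scale0r|by rewrite mulr0 invr0 scale0r|].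
  under eq_bigr => ij ij0 do rewrite scalar_prod_diag card_predC2//.
  rewrite sumr_const card_offdiag -[_ *: _ *+ _]scaler_nat !scalerA -natrM mulKf//.
  by rewrite pnatr_eq0.
Qed.

Lemma analytic_at_quadratic (F : V * R -> W) (p : V * R) :
  (forall h s, `|h| < r -> `|s| < r -> exists lc lA lB,
    [/\ series (fun k => s ^+ k *: c k) @ \oo --> lc,
        series (fun k => s ^+ k *: A k h) @ \oo --> lA,
        series (fun k => s ^+ k *: B k h h) @ \oo --> lB &
        F (p + (h, s)) = lc + (lA + lB)]) ->
  analytic_at F p.
Proof.
move=> HF; exists quadratic_form, r, (D * (1 + r + r ^+ 2)); split=> //.
- by move=> k; split; [exact: quadratic_form_multilinear|exact: quadratic_form_symmetric].
- by move=> k v; exact: quadratic_form_bound.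
move=> [h s]; rewrite prod_normE /= gt_max => /andP[hr sr].
have [lc [lA [lB [cc cA cB ->]]]] := HF h s hr sr.
rewrite (_ : series _ = series (fun k => s ^+ k *: c k) \+
  (series (fun k => if k is k'.+1 then s ^+ k' *: A k' h else 0) \+
   series (fun k => if k is k'.+2 then s ^+ k' *: B k' h h else 0))); last first.
  apply/funext => n; rewrite /series /= -!big_split /=.
  by apply: eq_bigr => k _; exact: quadratic_form_diag.
apply: cvgD => //; apply: cvgD.
  rewrite -cvg_shiftS (_ : (fun n => _) = series (fun k => s ^+ k *: A k h))//.
  by apply/funext => n; rewrite /series /= big_nat_recl// add0r.
rewrite -cvg_shiftS -cvg_shiftS.
rewrite (_ : (fun n => _) = series (fun k => s ^+ k *: B k h h))//.
by apply/funext => n; rewrite /series /= !big_nat_recl// !add0r.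
Qed.

End PolynomialSeries.

(** * Power series of operators and bifurcation maps *)

Section BoundedOperators.
Context {R : realType} {V W : normedModType R}.

Lemma bounded_op_gt0 (T : V -> W) : bounded_op T ->
  exists2 C : R, 0 < C & forall v, `|T v| <= C * `|v|.
Proof.
move=> [C TC]; exists (`|C| + 1); first by rewrite ltr_wpDl.
move=> v; apply: le_trans (TC v) _; rewrite ler_wpM2r//.
by rewrite (le_trans (ler_norm C))// lerDl.
Qed.

Lemma bounded_op_continuous (T : {linear V -> W}) : bounded_op T -> continuous T.
Proof.
move=> /bounded_op_gt0[C C0 TC] x; apply/cvgrPdist_lt => e e0.
have d0 : 0 < e / C by rewrite divr_gt0.
near=> y; rewrite -linearB (le_lt_trans (TC _))//.
rewrite mulrC -ltr_pdivlMr; last exact: C0.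
by near: y; exact: cvgr_dist_lt.
Unshelve. all: by end_near. Qed.

Lemma quadratic_remainder_diff (T : {linear V -> W}) (f : V -> W) (C : R) :
  bounded_op T -> f 0 = 0 -> (forall h, `|f h - T h| <= C * `|h| ^+ 2) ->
  differentiable f 0 /\ 'd f 0 = T :> (V -> W).
Proof.
move=> bT f0 fC; have cT := bounded_op_continuous bT.
have E : f \o shift 0 = cst (f 0) + T +o_ 0 id.
  apply/eqaddoP => e e0; near=> h.
  rewrite /= !fctE /= addr0 f0 add0r (le_trans (fC h))//.
  have hd : `|h| <= e / (`|C| + 1).
    rewrite -normrN -sub0r ltW//; near: h; apply: cvgr_dist_lt => //.
    by rewrite divr_gt0// ltr_wpDl.
  rewrite ler_pdivlMr ?ltr_wpDl// in hd.
  have := ler_norm C; have := normr_ge0 C; have := normr_ge0 h; nra.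
have dE := diff_unique cT E; split=> //.
by apply/diff_locallyP; rewrite dE.
Unshelve. all: by end_near. Qed.

End BoundedOperators.

Section OperatorSeries.
Context {R : realType} {V : completeNormedModType R}.
Implicit Types (G H : nat -> V -> V) (Gs Hs : R -> V -> V) (r s : R).

(** An operator-valued power series on the disc of radius [r]. Convergence is
    only required pointwise: the coefficient bounds are uniform. *)
Definition op_series r G Gs := exists D : R, [/\ 0 <= D,
  forall k a u v, G k (a *: u + v) = a *: G k u + G k v,
  forall k u, r ^+ k * `|G k u| <= D * `|u| &
  forall s u, `|s| < r -> series (fun k => s ^+ k *: G k u) @ \oo --> Gs s u].

Lemma op_series_lin r G Gs s a u v : op_series r G Gs -> `|s| < r ->
  Gs s (a *: u + v) = a *: Gs s u + Gs s v.
Proof.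
move=> [D [_ Glin _ Gcvg]] sr.
have c1 := Gcvg s (a *: u + v) sr.
apply: (cvg_unique (@norm_hausdorff _ _) c1).
rewrite (_ : series _ = (fun n => a *: series (fun k => s ^+ k *: G k u) n +
    series (fun k => s ^+ k *: G k v) n)).
  by apply: cvgD; [apply: cvgZr; exact: Gcvg|exact: Gcvg].
apply/funext => n; rewrite /series /= scaler_sumr -big_split /=.
apply: eq_bigr => k _; rewrite Glin scalerDr; congr (_ + _).
by rewrite !scalerA mulrC.
Qed.

Lemma op_seriesD r G Gs H Hs b : op_series r G Gs -> op_series r H Hs ->
  op_series r (fun k u => G k u + b *: H k u) (fun s u => Gs s u + b *: Hs s u).
Proof.
move=> [D [D0 Glin Gb Gcvg]] [E [E0 Hlin Hb Hcvg]].
exists (D + `|b| * E); split.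
- by rewrite addr_ge0// mulr_ge0.
- move=> k a u v; rewrite Glin Hlin !scalerDr !scalerA (mulrC b) -!scalerA.
  by rewrite addrACA.
- move=> k u; case: (ltP r 0) => [rn|r0].
    have [ok|nok] := leP (r ^+ k) 0.
      rewrite (@le_trans _ _ 0)// ?mulr_le0_ge0// mulr_ge0// addr_ge0//.
      exact: mulr_ge0.
    rewrite (le_trans (ler_wpM2l (ltW nok) (ler_normD _ _)))// mulrDr mulrDl.
    by rewrite lerD// normrZ mulrCA -mulrA ler_wpM2l.
  rewrite (le_trans (ler_wpM2l (exprn_ge0 k r0) (ler_normD _ _)))// mulrDr mulrDl.
  by rewrite lerD// normrZ mulrCA -mulrA ler_wpM2l.
- move=> s u sr; rewrite (_ : series _ = (fun n =>
    series (fun k => s ^+ k *: G k u) n + b *: series (fun k => s ^+ k *: H k u) n)).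
    by apply: cvgD; [exact: Gcvg|apply: cvgZr; exact: Hcvg].
  apply/funext => n; rewrite /series /= scaler_sumr -big_split /=.
  apply: eq_bigr => k _; rewrite scalerDr; congr (_ + _).
  by rewrite !scalerA mulrC.
Qed.

Lemma op_series_comp r G Gs (T : {linear V -> V}) : bounded_op T ->
  op_series r G Gs -> op_series r (fun k u => G k (T u)) (fun s u => Gs s (T u)).
Proof.
move=> /bounded_op_gt0[C C0 TC] [D [D0 Glin Gb Gcvg]].
exists (D * C); split.
- by rewrite mulr_ge0// ltW.
- by move=> k a u v; rewrite linearP Glin.
- by move=> k u; rewrite (le_trans (Gb _ _))// -mulrA ler_wpM2l.
- by move=> s u; exact: Gcvg.
Qed.

Lemma op_series_cst r (T : {linear V -> V}) : bounded_op T ->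
  op_series r (fun k u => if k is 0%N then T u else 0) (fun _ => T).
Proof.
move=> /bounded_op_gt0[C C0 TC]; exists C; split.
- exact: ltW.
- by move=> [|k] a u v; [rewrite linearP|rewrite scaler0 addr0].
- by move=> [|k] u; [rewrite expr0 mul1r|rewrite normr0 mulr0 mulr_ge0// ltW].
- move=> s u sr; rewrite -cvg_shiftS; apply: cvg_near_cst; near=> n.
  rewrite /series /= big_nat_recl// expr0 scale1r big1 ?addr0// => k _.
  by rewrite scaler0.
Unshelve. all: by end_near. Qed.

Lemma op_series_affine r mu : 0 < r ->
  op_series r (fun k u => if k is 0%N then mu *: u else if k is 1%N then u else 0)
    (fun s u => (mu + s) *: u).
Proof.
move=> r0; exists (`|mu| + r); split.
- by rewrite addr_ge0// ltW.
- move=> [|[|k]] a u v; [|by []|by rewrite scaler0 addr0].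
  by rewrite scalerDr !scalerA mulrC.
- move=> [|[|k]] u.
  + by rewrite expr0 mul1r normrZ ler_wpM2r// lerDl ltW.
  + by rewrite expr1 ler_wpM2r// lerDr.
  + by rewrite normr0 mulr0 mulr_ge0// addr_ge0// ltW.
- move=> s u sr; rewrite -cvg_shiftS -cvg_shiftS; apply: cvg_near_cst; near=> n.
  rewrite /series /= !big_nat_recl// expr0 scale1r expr1 big1 ?addr0.
    by rewrite scalerDl.
  by move=> k _; rewrite scaler0.
Unshelve. all: by end_near. Qed.

(** The Neumann series of [(1 + s M)^-1], whose sum is characterized by the
    resolvent equation. *)
Lemma op_series_neumann (M : {linear V -> V}) : bounded_op M ->
  exists2 r0 : R, 0 < r0 & forall r, 0 < r <= r0 -> exists Gs,
    op_series r (fun k u => (-1) ^+ k *: iter k M u) Gs /\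
    forall s u, `|s| < r -> Gs s u = u - s *: M (Gs s u).
Proof.
move=> bM; have [C C0 MC] := bounded_op_gt0 bM; have cM := bounded_op_continuous bM.
exists C^-1; first by rewrite invr_gt0.
move=> r /andP[r0 rC].
have iterb k u : r ^+ k * `|(-1) ^+ k *: iter k M u| <= `|u|.
  rewrite normrZ normrX normrN normr1 expr1n mul1r.
  elim: k => [|k IHk]; first by rewrite expr0 mul1r.
  apply: le_trans IHk; rewrite exprSr -mulrA ler_wpM2l ?exprn_ge0 ?(ltW r0)//=.
  rewrite -ler_pdivlMl// (le_trans (MC _))// ler_wpM2r//.
  by rewrite -[C]invrK lef_pV2 ?posrE ?invr_gt0.
have iter_lin k a u v : iter k M (a *: u + v) = a *: iter k M u + iter k M v.
  by elim: k => //= k ->; rewrite linearP.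
have Gcvg s u : `|s| < r -> cvgn (series (fun k => s ^+ k *: ((-1) ^+ k *: iter k M u))).
  move=> sr; apply: normed_cvg.
  have z1 : `| `|s| / r | < 1.
    by rewrite normrM normr_id normfV (gtr0_norm r0) ltr_pdivrMr// mul1r.
  apply: (@series_le_cvg _ _ (geometric `|u| (`|s| / r))) => [n|n|n|].
  - exact: normr_ge0.
  - by rewrite /geometric /= mulr_ge0// exprn_ge0// divr_ge0// ltW.
  - rewrite /geometric /= normrZ normrX exprMn exprVn mulrCA ler_wpM2l ?exprn_ge0//.
    by rewrite mulrC ler_pdivlMl ?exprn_gt0.
  - exact: is_cvg_geometric_series.
exists (fun s u => limn (series (fun k => s ^+ k *: ((-1) ^+ k *: iter k M u)))).
split.
  exists 1; split=> //.
  - by move=> k a u v; rewrite iter_lin scalerDr !scalerA mulrC.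
  - by move=> k u; rewrite mul1r.
move=> s u sr; have cs := Gcvg s u sr.
set S := series _ in cs *; set l := limn S.
have c1 : S n.+1 @[n --> \oo] --> l by rewrite cvg_shiftS; exact: cs.
apply: (cvg_unique (@norm_hausdorff _ _) c1).
rewrite (_ : (fun n => S n.+1) = (fun n => u - s *: M (S n))).
  apply: cvgB; first exact: cvg_cst.
  apply: cvgZr; apply: cvg_comp cs _; exact: cM.
apply/funext => n; rewrite /S /series /= big_nat_recl// !expr0 !scale1r; congr (_ + _).
rewrite linear_sum scaler_sumr -sumrN; apply: eq_bigr => k _.
by rewrite !linearZ /= !scalerA scalerN -scaleNr !exprS; congr (_ *: _); ring.
Qed.

End OperatorSeries.

Section BifurcationMaps.
Context {R : realType} {alpha : R}.
Local Notation X := (holder_even alpha).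
Implicit Types (phi h u v : X) (r s : R).

(** Expanding [(phi + h)^2] leaves terms of degree at most two in [h], which is
    the shape handled by [quadratic_form]. *)
Lemma analytic_at_op_series r G Gs H Hs (F : X * R -> X) (p : X * R) : 0 < r ->
  op_series r G Gs -> op_series r H Hs ->
  (forall h s, `|h| < r -> `|s| < r ->
     F (p + (h, s)) = Gs s (p.1 + h) + Hs s (holder_mul (p.1 + h) (p.1 + h))) ->
  analytic_at F p.
Proof.
move=> r0 oG oH FE; have [D [D0 Glin Gb Gcvg]] := oG.
have [E [E0 Hlin Hb Hcvg]] := oH.
set phi := p.1 in FE *.
have rk0 k : 0 <= r ^+ k by rewrite exprn_ge0// ltW.
have HB : forall k u v, r ^+ k * `|H k (holder_mul u v)| <= E * (`|u| * `|v|).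
  by move=> k u v; rewrite (le_trans (Hb _ _))// ler_wpM2l// holder_mul_norm.
pose c k := G k phi + H k (holder_mul phi phi).
pose A k h := G k h + 2 *: H k (holder_mul phi h).
pose B k h h' := H k (holder_mul h h').
pose C := D * (1 + `|phi|) + E * (1 + 2 * `|phi| + `|phi| * `|phi|).
have C0 : 0 <= C.
  by rewrite addr_ge0// mulr_ge0// ?addr_ge0// ?addr_ge0// mulr_ge0.
have EC : E <= C.
  have := normr_ge0 phi; rewrite /C => f0.
  have := mulr_ge0 D0 f0; have := mulr_ge0 E0 f0; have := mulr_ge0 E0 (mulr_ge0 f0 f0).
  lra.
have H0 k : H k 0 = 0.
  by have := Hlin k (-1) 0 0; rewrite scaler0 addr0 scaleN1r addNr.
apply: (@analytic_at_quadratic _ _ _ c A B _ _ _ r C).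
- move=> k a u v; rewrite /A Glin holder_mulDr Hlin scalerDr !scalerA (mulrC 2).
  by rewrite scalerDr -scalerA addrACA.
- by move=> k a u v w; rewrite /B holder_mulDl Hlin.
- by move=> k a u v w; rewrite /B holder_mulDr Hlin.
- exact: r0.
- exact: C0.
- move=> k; rewrite /c (le_trans (ler_wpM2l (rk0 k) (ler_normD _ _)))// mulrDr.
  have := Gb k phi; have := HB k phi phi; have := normr_ge0 phi; rewrite /C => f0.
  have := mulr_ge0 D0 f0; have := mulr_ge0 E0 f0; lra.
- move=> k u; rewrite /A (le_trans (ler_wpM2l (rk0 k) (ler_normD _ _)))// mulrDr.
  rewrite normrZ ger0_norm// mulrCA.
  have := Gb k u; have := HB k phi u; rewrite /C => h1 h2.
  have f0 := normr_ge0 phi; have u0 := normr_ge0 u.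
  have := mulr_ge0 (mulr_ge0 D0 f0) u0; have := mulr_ge0 E0 u0.
  have := mulr_ge0 (mulr_ge0 E0 (mulr_ge0 f0 f0)) u0; lra.
- move=> k u v; rewrite /B (le_trans (HB k u v))// mulrA.
  by rewrite ler_wpM2r// ler_wpM2r.
move=> h s hr sr.
exists (Gs s phi + Hs s (holder_mul phi phi)),
  (Gs s h + 2 *: Hs s (holder_mul phi h)), (Hs s (holder_mul h h)).
have sumE (a b : nat -> X) (t : R) (la lb : X) :
    series a @ \oo --> la -> series b @ \oo --> lb ->
    series (fun k => a k + t *: b k) @ \oo --> la + t *: lb.
  move=> ca cb; rewrite (_ : series _ = (fun n => series a n + t *: series b n)).
    by apply: cvgD => //; exact: cvgZr.
  by apply/funext => n; rewrite /series /= scaler_sumr -big_split.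
split.
- have := sumE _ _ 1 _ _ (Gcvg s phi sr) (Hcvg s (holder_mul phi phi) sr).
  rewrite scale1r; apply: cvg_trans; apply: near_eq_cvg; apply: nearW => n.
  by apply: eq_bigr => k _; rewrite /c scalerDr scale1r.
- have := sumE _ _ 2 _ _ (Gcvg s h sr) (Hcvg s (holder_mul phi h) sr).
  apply: cvg_trans; apply: near_eq_cvg; apply: nearW => n.
  by apply: eq_bigr => k _; rewrite /A scalerDr !scalerA mulrC.
- exact: Hcvg.
rewrite FE//.
have -> : holder_mul (phi + h) (phi + h) =
    1 *: holder_mul phi phi + (2 *: holder_mul phi h + holder_mul h h).
  by apply: holder_eqP => x /=; rewrite !fctE /GRing.scale/=; ring.
have -> : phi + h = 1 *: phi + h by rewrite scale1r.
rewrite (op_series_lin _ _ _ oG sr) !(op_series_lin _ _ _ oH sr) !scale1r.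
by rewrite -!addrA; congr (_ + _); rewrite addrCA.
Qed.

Lemma bifurcation_map_diff (mu : R) (L : R -> {linear X -> X}) (N : X -> R -> X)
    (C : R) (T : {linear X -> X}) : bounded_op T ->
  (forall f, T f = mu *: f - L mu f) ->
  (forall h, `|N h mu| <= C * `|h| ^+ 2) ->
  [/\ differentiable (N ^~ mu) 0, 'd (N ^~ mu) 0 = (fun=> 0) :> (X -> X),
      differentiable ((bifurcation_map L N) ^~ mu) 0 &
      'd ((bifurcation_map L N) ^~ mu) 0 = T :> (X -> X)].
Proof.
move=> bT TE NC.
have N0 : N 0 mu = 0.
  by apply/eqP; rewrite -normr_le0; have := NC 0; rewrite normr0 expr0n mulr0.
have b0 : bounded_op (\0 : {linear X -> X}).
  by exists 0 => v; rewrite /= normr0 mul0r.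
have [dN dN0] := @quadratic_remainder_diff _ _ _ (\0 : {linear X -> X}) (N ^~ mu) C b0 N0
  (ltac:(by move=> h; rewrite /= subr0)).
have F0 : bifurcation_map L N 0 mu = 0.
  by rewrite /bifurcation_map scaler0 linear0 subr0 add0r.
have [dF dFT] := @quadratic_remainder_diff _ _ _ T ((bifurcation_map L N) ^~ mu) C bT F0
  (ltac:(by move=> h; rewrite /bifurcation_map TE addrAC subrr add0r)).
by split.
Qed.

End BifurcationMaps.

(** * Bifurcation maps built on convolution operators *)

Section ConvolutionBifurcation.
Context {R : realType} {alpha : R}.
Hypothesis ha : 0 < alpha <= 1.
Local Notation X := (holder_even alpha).
Local Notation leb := (@lebesgue_measure R).

Lemma linear_combination (V : normedModType R) (L : {linear V -> V}) (a b : R) :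
  bounded_op L -> exists T : {linear V -> V},
    bounded_op T /\ forall f, T f = a *: f + b *: L f.
Proof.
move=> [C LC]; pose T f := a *: f + b *: L f.
have Tlin : linear T.
  move=> c f g; rewrite /T (linearP L) !scalerDr !scalerA (mulrC a) (mulrC b).
  by rewrite -!scalerA addrACA.
pose Tm := GRing.isLinear.Build R V V *:%R T Tlin.
exists (HB.pack T Tm : {linear V -> V}); split=> //.
exists (`|a| + `|b| * C) => v; rewrite /= /T mulrDl -mulrA.
by rewrite (le_trans (ler_normD _ _))// !normrZ lerD// ler_wpM2l.
Qed.

Lemma holder_sqr_norm (f : X) : `|holder_sqr f| <= `|f| ^+ 2.
Proof. by rewrite holder_sqrE expr2 holder_mul_norm. Qed.

(** Only analyticity and the description of the solution set depend on the
    equation: compactness and the index come with the convolution structure. *)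
Lemma zero_set_formulation_convolution (K : R -> R -> R) (sol : R -> X -> Prop)
    (L : R -> {linear X -> X}) (N : X -> R -> X) :
  (forall mu, 0 < mu -> [/\ leb.-integrable [set: R] (EFin \o K mu),
     forall n : nat, \int[leb]_y (K mu y * sin (n%:R * y)) = 0 &
     forall f x, L mu f x = convolution (K mu) f x]) ->
  (forall mu, 0 < mu -> exists C, forall h, `|N h mu| <= C * `|h| ^+ 2) ->
  (forall p : X * R, 0 < p.2 ->
     analytic_at (fun q : X * R => bifurcation_map L N q.1 q.2) p) ->
  (forall phi (mu : R), 0 < mu -> (sol mu phi <-> bifurcation_map L N phi mu = 0)) ->
  zero_set_formulation sol L N.
Proof.
move=> HK HN Ha Hs.
have T_of mu : 0 < mu -> exists2 T : {linear X -> X}, bounded_op T &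
    forall f, T f = mu *: f - L mu f.
  move=> mu0; have [iK _ LK] := HK mu mu0.
  have [T [bT TE]] := linear_combination mu (-1) (convolution_bounded_op ha iK LK).
  by exists T => // f; rewrite TE scaleN1r.
split; [exact: Ha|exact: Hs|move=> mu mu0..]; have [iK Ks LK] := HK mu mu0.
- by split; [exact: convolution_bounded_op LK|exact: convolution_compact_op LK].
-have [T bT TE] := T_of mu mu0; have [C NC] := HN mu mu0.
  by have [] := bifurcation_map_diff bT TE NC.
-have [T bT TE] := T_of mu mu0; have [C NC] := HN mu mu0.
  have [_ _ dF dFT] := bifurcation_map_diff bT TE NC; split=> //.
  apply: (convolution_fredholm ha iK Ks LK mu0) => f.
  by rewrite dFT TE.
Qed.

(** * The Whitham equation *)

Lemma whitham_formulation (K : R -> R) : is_whitham_kernel K ->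
  exists (L : R -> {linear X -> X}) (N : X -> R -> X),
    [/\ zero_set_formulation (fun mu (phi : X) => whitham_solution K mu phi) L N,
        forall phi (mu : R), 0 < mu -> N phi mu = - holder_sqr phi
      & forall mu nu : R, 0 < mu -> 0 < nu ->
          L mu =1 L nu /\ N ^~ mu =1 N ^~ nu].
Proof.
move=> [iK FK].
(* The transform is real, so the sine moments vanish. *)
have Ks (n : nat) : \int[leb]_y (K y * sin (n%:R * y)) = 0.
  have := FK n%:R; rewrite /fourier_transform => -[_ /eqP].
  rewrite oppr_eq0 => /eqP H; rewrite -[RHS]H.
  by apply: eq_Rintegral => y _; rewrite mulrC [y * _]mulrC mulrC.
have [L LK] := convolution_operator ha iK Ks.
exists (fun=> L), (fun phi _ => - holder_sqr phi); split; [|by []|by []].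
apply: (@zero_set_formulation_convolution (fun=> K)).
- by [].
- by move=> mu _; exists 1 => h; rewrite normrN mul1r holder_sqr_norm.
- move=> [phi mu] /= mu0.
  have bL := convolution_bounded_op ha iK LK.
  have bid : bounded_op (idfun : {linear X -> X}) by exists 1 => v; rewrite mul1r.
  have b0 : bounded_op (\0 : {linear X -> X}).
    by exists 0 => v; rewrite /= normr0 mul0r.
  have oG := op_seriesD (-1) (op_series_affine mu ltr01) (op_series_cst 1 bL).
  have oH := op_seriesD (-1) (op_series_cst 1 b0) (op_series_cst 1 bid).
  apply: (analytic_at_op_series ltr01 oG oH) => h s _ _ /=.
  by rewrite /bifurcation_map /= !scaleN1r add0r holder_sqrE.
- have FE phi mu x : bifurcation_map (fun=> L) (fun phi _ => - holder_sqr phi) phi mu x =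
      - (- mu * phi x + phi x ^+ 2 + convolution K phi x).
    by rewrite -LK /bifurcation_map /= !fctE /GRing.scale/=; ring.
  move=> phi mu _; split=> [sol|F0 x].
    by apply: holder_eqP => x; rewrite FE sol oppr0.
  by apply: oppr_inj; rewrite -FE F0 oppr0.
Qed.

End ConvolutionBifurcation.

(** * The KdV equation *)

Section KdVKernel.
Context {R : realType}.
Local Notation leb := (@lebesgue_measure R).
Variable k : R.
Hypothesis k0 : 0 < k.
Implicit Types (x y : R) (n : nat).

Let C y := expR (k * (pi - y)) + expR (- (k * (pi - y))).
Let S y := expR (k * (pi - y)) - expR (- (k * (pi - y))).

(** The Green function [k cosh (k (pi - y)) / (2 sinh (k pi))] of
    [1 - k^-2 d^2/dy^2] on the circle, carried by one period. *)
Definition kdv_kernel : R -> R :=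
  (fun y => k / (2 * S 0) * C y) \_ `[0, 2 * pi].

Let S0_gt0 : 0 < S 0.
Proof.
rewrite /S subr0 subr_gt0 ltr_expR.
by have := mulr_gt0 k0 (@pi_gt0 R); lra.
Qed.

Let exp_derive x (a : R) :
  is_derive x 1 (fun y => expR (a * (pi - y))) (- a * expR (a * (pi - x))).
Proof.
have d1 : is_derive x 1 (fun y : R => a * (pi - y)) (- a).
  have -> : (fun y => a * (pi - y)) = a \*: (cst pi - id) by [].
  by apply: is_derive_eq; rewrite /GRing.scale/= sub0r mulrN1.
have := @is_derive1_comp _ expR (fun y => a * (pi - y)) x _ _ (is_derive_expR _) d1.
by rewrite mulrC.
Qed.

Let C_derive x : is_derive x 1 C (- k * S x).
Proof.
have -> : C = (fun y => expR (k * (pi - y))) + (fun y => expR (- k * (pi - y))).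
  by apply/funext => y; rewrite /C fctE mulNr.
apply: (is_derive_eq (is_deriveD (exp_derive x k) (exp_derive x (- k)))).
by rewrite /S (mulNr k (pi - x)); ring.
Qed.

Let S_derive x : is_derive x 1 S (- k * C x).
Proof.
have -> : S = (fun y => expR (k * (pi - y))) - (fun y => expR (- k * (pi - y))).
  by apply/funext => y; rewrite /S !fctE mulNr.
apply: (is_derive_eq (is_deriveB (exp_derive x k) (exp_derive x (- k)))).
by rewrite /C (mulNr k (pi - x)); ring.
Qed.

Let C_continuous : continuous C.
Proof.
move=> x; apply: differentiable_continuous; apply/derivable1_diffP.
by case: (C_derive x).
Qed.

Let C_2pi : C (2 * pi) = C 0.
Proof.
rewrite /C subr0 (_ : k * (pi - 2 * pi) = - (k * pi)); last by ring.
by rewrite opprK addrC.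
Qed.

Let S_2pi : S (2 * pi) = - S 0.
Proof.
rewrite /S subr0 (_ : k * (pi - 2 * pi) = - (k * pi)); last by ring.
by rewrite opprK opprB.
Qed.

Let pi20 : 0 < 2 * pi :> R. Proof. by rewrite mulr_gt0// pi_gt0. Qed.

Lemma kdv_kernel_integrable : leb.-integrable [set: R] (EFin \o kdv_kernel).
Proof.
apply: kernel_restrict_integrable => //; apply: continuous_segment_integrable.
by move=> y; apply: cvgM; [exact: cvg_cst|exact: C_continuous].
Qed.

Let kernel_integral (g : R -> R) : continuous g ->
  \int[leb]_y (kdv_kernel y * g y) =
  k / (2 * S 0) * \int[leb]_(y in `[0, 2 * pi]) (C y * g y).
Proof.
move=> cg; rewrite -RintegralZl//; last first.
  apply: continuous_segment_integrable => y.
  by apply: cvgM; [exact: C_continuous|exact: cg].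
rewrite [RHS]Rintegral_mkcond; apply: eq_Rintegral => y _ /=.
by rewrite /kdv_kernel !patchE; case: ifPn => _; rewrite ?mul0r// mulrA.
Qed.

Let sin_2npi n : sin (n%:R * (2 * pi)) = 0 :> R.
Proof. by rewrite mulrA -natrM sin_natmul_pi. Qed.

Let cos_2npi n : cos (n%:R * (2 * pi)) = 1 :> R.
Proof.
have -> : n%:R * (2 * pi) = 0 + (pi *+ 2) *+ n :> R.
  by rewrite -[(pi *+ 2) *+ n]mulr_natr -[pi *+ 2]mulr_natr; ring.
by rewrite periodicn ?cos0//; exact: cosD2pi.
Qed.

Let cn n : continuous (fun y : R => cos (n%:R * y)).
Proof.
move=> x; apply: continuous_comp; last exact: continuous_cos.
by apply: cvgM; [exact: cvg_cst|exact: cvg_id].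
Qed.

Let sn n : continuous (fun y : R => sin (n%:R * y)).
Proof.
move=> x; apply: continuous_comp; last exact: continuous_sin.
by apply: cvgM; [exact: cvg_cst|exact: cvg_id].
Qed.

Let kn_gt0 n : 0 < k ^+ 2 + n%:R ^+ 2.
Proof. by rewrite ltr_pwDl ?exprn_gt0// sqr_ge0. Qed.

(** Both moments come from explicit primitives, since [C' = - k S] and
    [S' = - k C]. *)
Lemma kdv_kernel_sin n : \int[leb]_y (kdv_kernel y * sin (n%:R * y)) = 0.
Proof.
rewrite kernel_integral//.
pose P y := - k * (S y * sin (n%:R * y)) - n%:R * (C y * cos (n%:R * y)).
pose p y := (k ^+ 2 + n%:R ^+ 2) * (C y * sin (n%:R * y)).
have ccs : continuous (fun y => C y * sin (n%:R * y)).
  by move=> y; apply: cvgM; [exact: C_continuous|exact: sn].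
have cp : continuous p by move=> y; apply: cvgM; [exact: cvg_cst|exact: ccs].
have dP (x : R) : is_derive x 1 P (p x : R).
  have d1 := is_deriveM (S_derive x) (sin_natmul_derive n x).
  have d2 := is_deriveM (C_derive x) (cos_natmul_derive n x).
  apply: (is_derive_eq (is_deriveB (is_deriveZ (- k) d1) (is_deriveZ n%:R d2))).
  by rewrite /GRing.scale/= /p; ring.
have := Rintegral_derive pi20 (fun x _ => dP x) (continuous_subspaceT cp).
rewrite /p RintegralZl//; last exact: continuous_segment_integrable.
rewrite /P sin_2npi cos_2npi !mulr0 sin0 cos0 !mulr0 C_2pi subrr => /eqP.
by rewrite mulf_eq0 gt_eqF//= => /eqP ->; rewrite mulr0.
Qed.

Lemma kdv_kernel_symbol n : symbol kdv_kernel n = k ^+ 2 / (k ^+ 2 + n%:R ^+ 2).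
Proof.
rewrite /symbol kernel_integral//.
pose P y := - k * (S y * cos (n%:R * y)) + n%:R * (C y * sin (n%:R * y)).
pose p y := (k ^+ 2 + n%:R ^+ 2) * (C y * cos (n%:R * y)).
have ccc : continuous (fun y => C y * cos (n%:R * y)).
  by move=> y; apply: cvgM; [exact: C_continuous|exact: cn].
have cp : continuous p by move=> y; apply: cvgM; [exact: cvg_cst|exact: ccc].
have dP (x : R) : is_derive x 1 P (p x : R).
  have d1 := is_deriveM (S_derive x) (cos_natmul_derive n x).
  have d2 := is_deriveM (C_derive x) (sin_natmul_derive n x).
  apply: (is_derive_eq (is_deriveD (is_deriveZ (- k) d1) (is_deriveZ n%:R d2))).
  by rewrite /GRing.scale/= /p; ring.
have := Rintegral_derive pi20 (fun x _ => dP x) (continuous_subspaceT cp).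
rewrite /p RintegralZl//; last exact: continuous_segment_integrable.
rewrite /P sin_2npi cos_2npi !mulr0 sin0 cos0 !mulr0 !mulr1 S_2pi !addr0 => H.
have kn := lt0r_neq0 (kn_gt0 n); have Sn0 := lt0r_neq0 S0_gt0.
apply: (mulfI kn); rewrite mulrCA H; field.
by rewrite Sn0 kn.
Qed.

End KdVKernel.

Section KdVEquation.
Context {R : realType} {alpha : R}.
Hypothesis ha : 0 < alpha <= 1.
Local Notation X := (holder_even alpha).
Local Notation leb := (@lebesgue_measure R).
Implicit Types (phi f g : X) (mu x : R) (n : nat) (psi : R -> R).

Let a0 : 0 < alpha. Proof. by case/andP: ha. Qed.

(** The convolution operator [mu (mu - (1/6) d^2/dx^2)^-1], by its symbol. *)
Lemma kdv_operator mu : exists (K : R -> R) (L : {linear X -> X}), 0 < mu ->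
  [/\ leb.-integrable [set: R] (EFin \o K),
      forall n : nat, \int[leb]_y (K y * sin (n%:R * y)) = 0,
      forall n, symbol K n = 6 * mu / (6 * mu + n%:R ^+ 2) &
      forall f x, L f x = convolution K f x].
Proof.
have [mu0|_] := ltP 0 mu; last by exists (fun=> 0), \0.
have mu60 : 0 < 6 * mu by rewrite mulr_gt0.
have k0 : 0 < Num.sqrt (6 * mu) by rewrite sqrtr_gt0.
have iK := kdv_kernel_integrable (Num.sqrt (6 * mu)).
have Ks := kdv_kernel_sin k0.
have [L LK] := convolution_operator ha iK Ks.
exists (kdv_kernel (Num.sqrt (6 * mu))), L => _; split=> // n.
by rewrite kdv_kernel_symbol// sqr_sqrtr// ltW.
Qed.

Lemma test_function_derive psi (j : nat) x : periodic_test_function psi ->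
  is_derive x 1 (derive1n j psi) (derive1n j.+1 psi x).
Proof.
move=> [_ dpsi]; have H := dpsi j x.
by rewrite derive1nS derive1E; exact: derivableP.
Qed.

Lemma test_function_continuous psi (j : nat) : periodic_test_function psi ->
  continuous (derive1n j psi).
Proof.
move=> [_ dpsi] x; apply: differentiable_continuous; exact/derivable1_diffP.
Qed.

Let derive_valE (f : R -> R) x (d : R) : is_derive x 1 f d -> 'D_1 f x = d.
Proof. by case. Qed.

Lemma test_function_derive_periodic psi x : periodic_test_function psi ->
  derive1n 1 psi (x + 2 * pi) = derive1n 1 psi x.
Proof.
move=> tpsi; have [ppsi _] := tpsi.
have d1 := test_function_derive 0 (x + 2 * pi) tpsi.
have ds : is_derive x 1 (fun y : R => y + 2 * pi) 1.
  have -> : (fun y => y + 2 * pi) = id + cst (2 * pi) by [].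
  by apply: is_derive_eq; rewrite addr0.
have d2 := @is_derive1_comp _ psi (fun y => y + 2 * pi) x _ _ d1 ds.
rewrite (_ : psi \o _ = psi) in d2; last by apply/funext => y /=; exact: ppsi.
have d3 := test_function_derive 0 x tpsi.
by rewrite -(derive_valE d3) (derive_valE d2) mulr1.
Qed.

(** Green's identity against [cos(nx)] on the circle. *)
Lemma pairing_cos_green n psi : periodic_test_function psi ->
  pairing (cosX ha n) (derive1n 2 psi) = - n%:R ^+ 2 * pairing (cosX ha n) psi.
Proof.
move=> tpsi; have c0 := @test_function_continuous psi 0 tpsi.
have c2 := @test_function_continuous psi 2 tpsi.
pose F x := cos (n%:R * x) * derive1n 1 psi x + n%:R * (sin (n%:R * x) * psi x).
have ca := @pairing_continuous _ _ ha (cosX ha n) _ c2.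
have cb := @pairing_continuous _ _ ha (cosX ha n) _ c0.
have cb2 : continuous (fun x => n%:R ^+ 2 * (cosX ha n x * psi x)).
  by move=> x; apply: cvgM; [exact: cvg_cst|exact: cb].
pose f x := cosX ha n x * derive1n 2 psi x + n%:R ^+ 2 * (cosX ha n x * psi x).
have cf : continuous f by move=> x; apply: cvgD; [exact: ca|exact: cb2].
have dF (x : R) : is_derive x 1 F (f x : R).
  have d1 := is_deriveM (cos_natmul_derive n x) (test_function_derive 1 x tpsi).
  have d2 := is_deriveM (sin_natmul_derive n x) (test_function_derive 0 x tpsi).
  apply: (is_derive_eq (is_deriveD d1 (is_deriveZ n%:R d2))).
  by rewrite /GRing.scale/= /f /=; ring.
have Npi : - pi < pi :> R by have := @pi_gt0 R; lra.
have := Rintegral_derive Npi (fun x _ => dF x) (continuous_subspaceT cf).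
have -> : F pi = F (- pi).
  have pp : pi = - pi + 2 * pi :> R by ring.
  rewrite /F mulrN cosN sinN sin_natmul_pi oppr0 !mul0r.
  by rewrite [in derive1n 1 psi pi]pp test_function_derive_periodic.
rewrite subrr /f (RintegralD _ (continuous_segment_integrable _ _ ca)
  (continuous_segment_integrable _ _ cb2))// RintegralZl//; last first.
  exact: continuous_segment_integrable.
by move/eqP; rewrite addr_eq0 mulNr => /eqP.
Qed.

Lemma cos_derive1n n (j : nat) : exists a b : R,
  derive1n j (fun x : R => cos (n%:R * x)) =
  fun x => a * cos (n%:R * x) + b * sin (n%:R * x).
Proof.
elim: j => [|j [a [b IH]]].
  by exists 1, 0; apply/funext => x; rewrite /= mul1r mul0r addr0.
exists (b * n%:R), (- (a * n%:R)); apply/funext => x.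
rewrite derive1nS IH derive1E.
have := is_deriveD (is_deriveZ a (cos_natmul_derive n x))
                   (is_deriveZ b (sin_natmul_derive n x)).
by move/derive_valE => ->; rewrite /GRing.scale/=; ring.
Qed.

Lemma cos_test_function n : periodic_test_function (fun x : R => cos (n%:R * x)).
Proof.
split; first by have [] := holder_evenP (cosX ha n).
move=> j x; have [a [b ->]] := cos_derive1n n j.
by case: (is_deriveD (is_deriveZ a (cos_natmul_derive n x))
                   (is_deriveZ b (sin_natmul_derive n x))).
Qed.

Lemma cos_derive2 n x :
  derive1n 2 (fun x : R => cos (n%:R * x)) x = - n%:R ^+ 2 * cos (n%:R * x).
Proof.
have E1 : derive1n 1 (fun x : R => cos (n%:R * x)) = (- n%:R) \*: (fun x => sin (n%:R * x)).
  apply/funext => y; rewrite derive1n1 derive1E (derive_valE (cos_natmul_derive n y)).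
  by rewrite /= /GRing.scale/=; ring.
rewrite derive1nS E1 derive1E.
rewrite (derive_valE (is_deriveZ (- n%:R) (sin_natmul_derive n x))).
by rewrite /GRing.scale/=; ring.
Qed.

Lemma kdv_pairing mu phi psi : periodic_test_function psi ->
  \int[leb]_(x in `[- pi, pi])
      (((1 - mu) * phi x + phi x ^+ 2) * psi x + 6^-1 * phi x * derive1n 2 psi x) =
  pairing ((1 - mu) *: phi + holder_sqr phi) psi + 6^-1 * pairing phi (derive1n 2 psi).
Proof.
move=> tpsi; have c0 := @test_function_continuous psi 0 tpsi.
have c2 := @test_function_continuous psi 2 tpsi.
have ca := @pairing_continuous _ _ ha ((1 - mu) *: phi + holder_sqr phi) _ c0.
have cb := @pairing_continuous _ _ ha phi _ c2.
have cb2 : continuous (fun x => 6^-1 * (phi x * derive1n 2 psi x)).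
  by move=> x; apply: cvgM; [exact: cvg_cst|exact: cb].
rewrite /pairing -RintegralZl//; last exact: continuous_segment_integrable.
rewrite -(RintegralD _ (continuous_segment_integrable _ _ ca)
  (continuous_segment_integrable _ _ cb2))//.
by apply: eq_Rintegral => x _ /=; rewrite mulrA.
Qed.

Section FixedParameter.
Variables (mu : R) (K : R -> R) (L : {linear X -> X}).
Hypothesis mu0 : 0 < mu.
Hypothesis iK : leb.-integrable [set: R] (EFin \o K).
Hypothesis Ks : forall n : nat, \int[leb]_y (K y * sin (n%:R * y)) = 0.
Hypothesis Ksym : forall n, symbol K n = 6 * mu / (6 * mu + n%:R ^+ 2).
Hypothesis LK : forall f x, L f x = convolution K f x.

Let den_neq0 n : 6 * mu + n%:R ^+ 2 != 0.
Proof. by rewrite gt_eqF// ltr_pwDl ?sqr_ge0// mulr_gt0. Qed.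

(** Both sides of the weak equation [mu u - u''/6 = mu g] for [u = L g] are
    functionals of [g], equal on cosines by Green's identity. *)
Lemma kdv_operator_weak g psi : periodic_test_function psi ->
  mu * pairing (g - L g) psi + 6^-1 * pairing (L g) (derive1n 2 psi) = 0.
Proof.
move=> tpsi; have c0 := @test_function_continuous psi 0 tpsi.
have c2 := @test_function_continuous psi 2 tpsi.
have [B B0 hB] := continuous_segment_bounded (- pi) pi c0.
have [D D0 hD] := continuous_segment_bounded (- pi) pi c2.
pose N := \int[leb]_y `|K y|.
have pi0 := @pi_ge0 R.
pose F h := mu * pairing (h - L h) psi + 6^-1 * pairing (L h) (derive1n 2 psi).
apply: (@cos_dense_functional _ _ ha F
  (mu * (2 * pi * B * (1 + N)) + 6^-1 * (2 * pi * D * N))).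
- move=> a f h; rewrite /F linearP.
  have -> : a *: f + h - (a *: L f + L h) = a *: (f - L f) + (h - L h).
    by rewrite opprD addrACA scalerBr.
  by rewrite !pairing_lin//; ring.
- move=> f M fM.
  have LM x : `|L f x| <= N * M by rewrite LK; exact: convolution_bound.
  have b1 : `|pairing (f - L f) psi| <= 2 * pi * B * (M + N * M).
    apply: pairing_bound => // x.
    by rewrite -[(f - L f) x]/(f x - L f x) (le_trans (ler_normB _ _))// lerD.
  have b2 : `|pairing (L f) (derive1n 2 psi)| <= 2 * pi * D * (N * M).
    exact: pairing_bound.
  rewrite /F (le_trans (ler_normD _ _))// !normrM (gtr0_norm mu0).
  rewrite (@ger0_norm _ 6^-1)//.
  have := ler_wpM2l (ltW mu0) b1; have /ler_wpM2l/(_ _ _ b2) : 0 <= 6^-1 :> R by [].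
  lra.
move=> n; rewrite /F (convolution_op_cos ha iK Ks LK) Ksym.
rewrite -[X in X - _]scale1r -scalerBl.
rewrite !pairingZ// pairing_cos_green//.
by field; exact: den_neq0.
Qed.

(** With [g = phi + phi^2], testing against [cos(nx)] says that the [n]-th
    coefficient of [phi] is that of [g] divided by [mu + n^2 / 6]; conversely, the
    weak equation satisfied by [L g] becomes that of [phi] once [L g = mu phi]. *)
Lemma kdv_solution_iff phi : kdv_solution mu phi <->
  mu *: phi - L phi - L (holder_sqr phi) = 0.
Proof.
split=> [sol|F0].
  apply: (fcoef_unique ha) => n.
  rewrite !fcoefB// fcoefZ// !(fcoef_convolution ha iK Ks LK) Ksym.
  have := sol _ (cos_test_function n); rewrite kdv_pairing; last exact: cos_test_function.
  rewrite -[pairing _ (fun x => cos _)]/(fcoef _ n) fcoefD// fcoefZ//.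
  have -> : pairing phi (derive1n 2 (fun x => cos (n%:R * x))) =
      - n%:R ^+ 2 * fcoef phi n.
    rewrite /fcoef /pairing -RintegralZl//.
      by apply: eq_Rintegral => x _; rewrite cos_derive2; ring.
    apply: continuous_segment_integrable.
    exact: (@pairing_continuous _ _ ha phi _ (@test_function_continuous _ 0 (cos_test_function n))).
  move=> H; have dn := den_neq0 n.
  have -> : fcoef (holder_sqr phi) n =
      - (1 - mu) * fcoef phi n + 6^-1 * n%:R ^+ 2 * fcoef phi n by lra.
  by field.
move=> psi tpsi; rewrite kdv_pairing//.
have c0 := @test_function_continuous psi 0 tpsi.
have c2 := @test_function_continuous psi 2 tpsi.
pose g := phi + holder_sqr phi.
have Lg : L g = mu *: phi.
  by apply/eqP; rewrite eq_sym -subr_eq0 /g linearD opprD addrA F0.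
have := kdv_operator_weak g tpsi; rewrite Lg.
have -> : g - mu *: phi = (1 - mu) *: phi + holder_sqr phi.
  by rewrite /g scalerBl scale1r addrAC.
rewrite (pairingZ ha mu phi c2) => H.
apply: (mulfI (lt0r_neq0 mu0)); rewrite mulr0 -[RHS]H; ring.
Qed.

End FixedParameter.

(** Near [mu], [L] is an operator power series: [L(mu + s) - 1] solves the
    resolvent equation [Z + (s / mu) L(mu) Z = L(mu) - 1]. *)
Lemma kdv_operator_series (L : R -> {linear X -> X}) (K : R -> R -> R) mu : 0 < mu ->
  (forall mu, 0 < mu -> [/\ leb.-integrable [set: R] (EFin \o K mu),
      forall n : nat, \int[leb]_y (K mu y * sin (n%:R * y)) = 0,
      forall n, symbol (K mu) n = 6 * mu / (6 * mu + n%:R ^+ 2) &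
      forall f x, L mu f x = convolution (K mu) f x]) ->
  exists (r : R) G Gs, [/\ 0 < r, op_series r G Gs &
    forall s f, `|s| < r -> Gs s f = L (mu + s) f].
Proof.
move=> mu0 HL; have [iK Ks Ksym LK] := HL mu mu0.
have bL := convolution_bounded_op ha iK LK.
have [M [bM ME]] := linear_combination 0 mu^-1 bL.
have [T [bT TE]] := linear_combination (-1) 1 bL.
have [r0 r00 neu] := op_series_neumann bM.
pose r := Num.min r0 mu.
have r_gt0 : 0 < r by rewrite lt_min r00.
have [|Gs [oG GE]] := neu r; first by rewrite r_gt0 ge_min lexx.
have bid : bounded_op (idfun : {linear X -> X}) by exists 1 => v; rewrite mul1r.
have oL := op_seriesD 1 (op_series_cst r bid) (op_series_comp bT oG).
exists r; eexists; eexists; split; [exact: r_gt0|exact: oL|].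
move=> s f sr /=; have := GE s (T f) sr; set Z := Gs s (T f) => ZE.
have ms0 : 0 < mu + s.
  have : `|s| < mu by apply: lt_le_trans sr _; rewrite ge_min lexx orbT.
  by rewrite ltr_norml => /andP[]; lra.
have [iK' Ks' Ksym' LK'] := HL _ ms0.
have d0 n : 6 * mu + n%:R ^+ 2 != 0 :> R.
  by rewrite gt_eqF// ltr_pwDl ?sqr_ge0// mulr_gt0.
have d1 n : 6 * (mu + s) + n%:R ^+ 2 != 0 :> R.
  by rewrite gt_eqF// ltr_pwDl ?sqr_ge0// mulr_gt0.
apply: (fcoef_inj ha) => n.
have := congr1 (fcoef^~ n) ZE; rewrite /= ME TE !(fcoefB, fcoefD, fcoefZ)//.
rewrite !(fcoef_convolution ha iK Ks LK) !(fcoef_convolution ha iK' Ks' LK').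
rewrite Ksym Ksym'; move: (fcoef Z n) (fcoef f n) => z w H.
have mn0 := lt0r_neq0 mu0; have := d0 n; have := d1 n.
move: (n%:R ^+ 2) H => q H q1 q0.
have H' : z * (6 * mu + q) = - q * w - 6 * s * z.
  by rewrite {1}H; field; rewrite q0 mn0.
apply: (mulIf q1); rewrite mulrDl mul1r.
have -> : z * (6 * (mu + s) + q) = - q * w by lra.
by field.
Qed.

Lemma kdv_formulation :
  exists (L : R -> {linear X -> X}) (N : X -> R -> X),
    zero_set_formulation (fun mu phi => kdv_solution mu phi) L N /\
    forall phi mu, 0 < mu -> N phi mu = - L mu (holder_sqr phi).
Proof.
pose K mu := sval (cid (kdv_operator mu)).
pose L mu := sval (cid (svalP (cid (kdv_operator mu)))).
have HL mu : 0 < mu -> [/\ leb.-integrable [set: R] (EFin \o K mu),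
      forall n : nat, \int[leb]_y (K mu y * sin (n%:R * y)) = 0,
      forall n, symbol (K mu) n = 6 * mu / (6 * mu + n%:R ^+ 2) &
      forall f x, L mu f x = convolution (K mu) f x].
  exact: (svalP (cid (svalP (cid (kdv_operator mu))))).
exists L, (fun phi mu => - L mu (holder_sqr phi)); split; last by [].
apply: (@zero_set_formulation_convolution _ _ ha K).
- by move=> mu /HL[].
- move=> mu mu0; have [iK _ _ LK] := HL mu mu0.
  have [C C0 LC] := bounded_op_gt0 (convolution_bounded_op ha iK LK).
  exists C => h; rewrite normrN (le_trans (LC _))// ler_wpM2l ?(ltW C0)//.
  exact: holder_sqr_norm.
- move=> [phi mu] /= mu0.
  have [r [G [Gs [r0 oL LE]]]] := kdv_operator_series mu0 HL.
  have b0 : bounded_op (\0 : {linear X -> X}).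
    by exists 0 => v; rewrite /= normr0 mul0r.
  have oG := op_seriesD (-1) (op_series_affine mu r0) oL.
  have oH := op_seriesD (-1) (op_series_cst r b0) oL.
  apply: (analytic_at_op_series r0 oG oH) => h s _ sr /=.
  by rewrite /bifurcation_map /= !LE// !scaleN1r add0r holder_sqrE.
- move=> phi mu mu0; have [iK Ks Ksym LK] := HL mu mu0.
  exact: (kdv_solution_iff mu0 iK Ks Ksym LK).
Qed.

End KdVEquation.

Theorem theorem3p1 (R : realType) (alpha : R) (halpha : 2^-1 < alpha < 1) :
  (forall K : R -> R, is_whitham_kernel K ->
    exists (L : R -> {linear holder_even alpha -> holder_even alpha})
           (N : holder_even alpha -> R -> holder_even alpha),
      [/\ zero_set_formulation
            (fun mu (phi : holder_even alpha) => whitham_solution K mu phi) L N,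
          forall phi (mu : R), 0 < mu -> N phi mu = - holder_sqr phi
        & forall mu nu : R, 0 < mu -> 0 < nu ->
            L mu =1 L nu /\ N ^~ mu =1 N ^~ nu]) /\
  (exists (L : R -> {linear holder_even alpha -> holder_even alpha})
          (N : holder_even alpha -> R -> holder_even alpha),
      zero_set_formulation
        (fun mu (phi : holder_even alpha) => kdv_solution mu phi) L N /\
      forall phi (mu : R), 0 < mu -> N phi mu = - L mu (holder_sqr phi)).
Proof.
have ha : 0 < alpha <= 1.
  by move: halpha => /andP[a2 a1]; rewrite (lt_trans _ a2) ?invr_gt0// ltW.
by split; [move=> K; exact: whitham_formulation|exact: kdv_formulation].
Qed.
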